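(* Let $H$ be a separable Hilbert space, let $A:D(A)\subset H\to H$ be an unbounded, positive self-adjoint operator with compact inverse $A^{-1}$, and let $\{v_k\}_{k\ge 1}$ be a complete orthonormal system of eigenvectors of $A$ in $H$ with eigenvalues $\lambda_k$, i.e. $Av_k=\lambda_k v_k$, $k=1,2,\dots$. Let $1<\alpha<2$, $\nu>0$, $T>0$, and let $\varphi\in D(A)$. Then there is a unique solution $u$ of the non-local problem $$D_t^\alpha u(t)+A D_t^\alpha u(t)+\nu^2 A u(t)=0,\quad 0<t<T,\qquad u(0)=u(T),\qquad \int_0^T u(t)\,dt=\varphi,$$ and it has the form $$u(t)=\sum_{k=1}^\infty\left(\frac{\varphi_k E_{\alpha,2}(-\nu_k^2T^\alpha)E_{\alpha,1}(-\nu_k^2t^\alpha)}{T\,\Delta_k}+\frac{\varphi_k\, t\,(1-E_{\alpha,1}(-\nu_k^2T^\alpha))E_{\alpha,2}(-\nu_k^2t^\alpha)}{T^2\,\Delta_k}\right)v_k,$$ where $$\Delta_k=\left(E_{\alpha,2}(-\nu_k^2T^\alpha)\right)^2+E_{\alpha,3}(-\nu_k^2T^\alpha)\left(1-E_{\alpha,1}(-\nu_k^2T^\alpha)\right),$$ $\nu_k=\nu\sqrt{\frac{\lambda_k}{1+\lambda_k}}$, and $\varphi_k=(\varphi,v_k)$ are the Fourier coefficients of $\varphi$.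
   Context: The operator $A$ acts by $Ah=\sum_{k=1}^\infty\lambda_k h_k v_k$, where $h_k=(h,v_k)$, with domain $D(A)=\{h\in H:\sum_{k=1}^\infty\lambda_k^2|h_k|^2<\infty\}$. For $\alpha\in(1,2)$, the Caputo fractional derivative of order $\alpha$ of a vector-valued function $h(t)\in H$ is $$D_t^\alpha h(t)=\frac{1}{\Gamma(2-\alpha)}\int_0^t\frac{h''(\xi)}{(t-\xi)^{\alpha-1}}\,d\xi,\quad t>0,$$ provided the right-hand side exists, where $\Gamma$ is Euler's gamma function. The Mittag-Leffler function is $E_{\rho,\mu}(t)=\sum_{n=0}^\infty\frac{t^n}{\Gamma(\rho n+\mu)}$, where $\rho>0$ and $\mu$ is a complex number. Definition of solution: a function $u(t)\in C([0,T];H)$ with $D_t^\alpha u(t),\ Au(t),\ AD_t^\alpha u(t)\in C((0,T);H)$ that satisfies all the conditions of the problem (the equation for $0<t<T$, the condition $u(0)=u(T)$ and the integral condition $\int_0^T u(t)\,dt=\varphi$) is called a solution of the problem. *)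

(* Defs.v *)
From Stdlib Require Import Reals Lra.
From Coquelicot Require Import Coquelicot.
Open Scope R_scope.
Set Implicit Arguments.
Unset Strict Implicit.

(** The scalar field of a Hilbert space is either [R] or [C]. *)

Variant scalar_kind := RealScalars | ComplexScalars.

Definition scalar (K : scalar_kind) : AbsRing :=
  match K with RealScalars => R_AbsRing | ComplexScalars => C_AbsRing end.

Definition sinj (K : scalar_kind) : R -> scalar K :=
  match K return R -> scalar K with
  | RealScalars => fun x => x
  | ComplexScalars => RtoC
  end.
Arguments sinj : clear implicits.

Definition sconj (K : scalar_kind) : scalar K -> scalar K :=
  match K return scalar K -> scalar K with
  | RealScalars => fun z => z
  | ComplexScalars => Cconj
  end.

Definition sre (K : scalar_kind) : scalar K -> R :=
  match K return scalar K -> R with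
  | RealScalars => fun z => z
  | ComplexScalars => fun z => fst z
  end.

Lemma sinj_plus K x y : sinj K (x + y) = plus (sinj K x) (sinj K y).
Proof. destruct K; [reflexivity | exact (RtoC_plus x y)]. Qed.

Lemma sinj_mult K x y : sinj K (x * y) = mult (sinj K x) (sinj K y).
Proof. destruct K; [reflexivity | exact (RtoC_mult x y)]. Qed.

Lemma sinj_one K : sinj K 1 = one.
Proof. destruct K; reflexivity. Qed.

Lemma abs_sinj K x : abs (sinj K x) = Rabs x.
Proof. destruct K; [reflexivity | exact (Cmod_R x)]. Qed.

(** Coquelicot's [is_derive] (in a real variable) and [is_RInt] need a normed
    module over [R_AbsRing].  [as_real H] has the same carrier, addition,
    uniform structure and norm as [H]. *)

Section AsReal.
Variables (K : scalar_kind) (H : NormedModule (scalar K)).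

Definition scalR (r : R) (x : H) : H := scal (sinj K r) x.

Lemma scalR_assoc (x y : R) (u : H) : scalR x (scalR y u) = scalR (mult x y) u.
Proof. unfold scalR; rewrite scal_assoc, <- sinj_mult; reflexivity. Qed.

Lemma scalR_one (u : H) : scalR one u = u.
Proof.
  unfold scalR; change (@one R_Ring) with 1; rewrite sinj_one; apply scal_one.
Qed.

Lemma scalR_distr_l (x : R) (u v : H) :
  scalR x (plus u v) = plus (scalR x u) (scalR x v).
Proof. exact (@scal_distr_l _ (NormedModule.ModuleSpace _ H) (sinj K x) u v). Qed.

Lemma scalR_distr_r (x y : R) (u : H) :
  scalR (plus x y) u = plus (scalR x u) (scalR y u).
Proof.
  unfold scalR; change (plus x y) with (x + y); rewrite sinj_plus.
  exact (@scal_distr_r _ (NormedModule.ModuleSpace _ H) (sinj K x) (sinj K y) u).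
Qed.

Definition as_real_ModuleSpace_mixin : ModuleSpace.mixin_of R_Ring H :=
  ModuleSpace.Mixin R_Ring H scalR
    scalR_assoc scalR_one scalR_distr_l scalR_distr_r.

Definition as_real_NormedModuleAux : NormedModuleAux R_AbsRing :=
  NormedModuleAux.Pack R_AbsRing H
    (NormedModuleAux.Class R_AbsRing H
      (ModuleSpace.Class R_Ring H (AbelianGroup.class H)
         as_real_ModuleSpace_mixin)
      (UniformSpace.class H)) H.

Lemma norm_scalR (r : R) (x : H) : norm (scalR r x) <= Rabs r * norm x.
Proof. unfold scalR; rewrite <- (abs_sinj K); apply (norm_scal (sinj K r) x). Qed.

Definition as_real_NormedModule_mixin :
  NormedModule.mixin_of R_AbsRing as_real_NormedModuleAux :=
  NormedModule.Mixin R_AbsRing as_real_NormedModuleAux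
    (@norm _ H) (@norm_factor _ H)
    (@norm_triangle _ H) norm_scalR
    (@norm_compat1 _ H) (@norm_compat2 _ H) (@norm_eq_zero _ H).

Definition as_real : NormedModule R_AbsRing :=
  NormedModule.Pack R_AbsRing H
    (NormedModule.Class R_AbsRing H
       (NormedModuleAux.class _ as_real_NormedModuleAux)
       as_real_NormedModule_mixin) H.

End AsReal.

(** A Hilbert space is a [CompleteNormedModule (scalar K)] whose norm comes
    from an inner product [ip], linear in its first argument. *)

Record is_inner_product (K : scalar_kind) (H : NormedModule (scalar K))
    (ip : H -> H -> scalar K) : Prop := {
  ip_plus_l : forall x y z, ip (plus x y) z = plus (ip x z) (ip y z);
  ip_scal_l : forall a x y, ip (scal a x) y = mult a (ip x y);
  ip_conj : forall x y, ip y x = sconj (ip x y);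
  ip_norm : forall x, ip x x = sinj K (norm x ^ 2)
}.

Definition separable (K : scalar_kind) (H : NormedModule (scalar K)) : Prop :=
  exists s : nat -> H,
    forall (x : H) (eps : R), 0 < eps -> exists n, norm (minus x (s n)) < eps.

Definition complete_orthonormal_system (K : scalar_kind)
    (H : NormedModule (scalar K)) (ip : H -> H -> scalar K)
    (v : nat -> H) : Prop :=
  (forall k, ip (v k) (v k) = one) /\
  (forall j k, j <> k -> ip (v j) (v k) = zero) /\
  (forall x, (forall k, ip x (v k) = zero) -> x = zero).

(** The values of [op] outside [dom] are meaningless. *)
Record operator (H : Type) := Operator { dom : H -> Prop; op :> H -> H }.

Record is_linear_operator (K : scalar_kind) (H : NormedModule (scalar K))
    (A : operator H) : Prop := {
  dom_zero : dom A zero;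
  dom_plus : forall x y, dom A x -> dom A y -> dom A (plus x y);
  dom_scal : forall a x, dom A x -> dom A (scal a x);
  op_plus : forall x y, dom A x -> dom A y -> A (plus x y) = plus (A x) (A y);
  op_scal : forall a x, dom A x -> A (scal a x) = scal a (A x)
}.

Definition densely_defined (K : scalar_kind) (H : NormedModule (scalar K))
    (A : operator H) : Prop :=
  forall (x : H) (eps : R), 0 < eps ->
    exists y, dom A y /\ norm (minus x y) < eps.

(** The graph of the adjoint: [y] is in D(A* ) and A* y = z. *)
Definition adjoint_graph (K : scalar_kind) (H : NormedModule (scalar K))
    (ip : H -> H -> scalar K) (A : operator H) (y z : H) : Prop :=
  forall x, dom A x -> ip (A x) y = ip x z.

Definition self_adjoint (K : scalar_kind) (H : NormedModule (scalar K))
    (ip : H -> H -> scalar K) (A : operator H) : Prop :=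
  is_linear_operator A /\ densely_defined A /\
  forall y z, adjoint_graph ip A y z <-> dom A y /\ A y = z.

Definition positive_operator (K : scalar_kind) (H : NormedModule (scalar K))
    (ip : H -> H -> scalar K) (A : operator H) : Prop :=
  forall x, dom A x -> x <> zero -> 0 < sre (ip (A x) x).

Definition unbounded_operator (K : scalar_kind) (H : NormedModule (scalar K))
    (A : operator H) : Prop :=
  ~ exists M : R, forall x, dom A x -> norm (A x) <= M * norm x.

Definition compact_map (K : scalar_kind) (H : NormedModule (scalar K))
    (B : H -> H) : Prop :=
  forall x : nat -> H, (exists M : R, forall n, norm (x n) <= M) ->
    exists (sub : nat -> nat) (l : H),
      (forall n, (sub n < sub (S n))%nat) /\
      filterlim (fun n => B (x (sub n))) eventually (locally l).

Definition has_compact_inverse (K : scalar_kind) (H : NormedModule (scalar K))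
    (A : operator H) : Prop :=
  exists B : H -> H,
    (forall h, dom A (B h) /\ A (B h) = h) /\
    (forall x, dom A x -> B (A x) = x) /\
    compact_map B.

(** Euler's Gamma function, for [0 < x]. *)
Definition Gamma (x : R) : R :=
  RInt_gen (fun s => Rpower s (x - 1) * exp (- s))
    (at_right 0) (Rbar_locally p_infty).

(** For [0 < rho] and real [0 < mu]. *)
Definition Mittag_Leffler (rho mu t : R) : R :=
  Series (fun n => t ^ n / Gamma (rho * INR n + mu)).

(** [t ^ a] for [0 <= t] and [0 < a]; the standard library has
    [Rpower 0 a = 1]. *)
Definition rpow (t a : R) : R :=
  if Rle_dec t 0 then 0 else Rpower t a.

(** The Caputo derivative of order [alpha] in (1, 2) of [h] exists at [t] and
    equals [d].  The integral over (0, t) is an improper Riemann integral, at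
    both ends: the kernel is singular at [t], and nothing is assumed about [h]
    at 0. *)
Definition is_Caputo (K : scalar_kind) (H : NormedModule (scalar K))
    (alpha : R) (h : R -> as_real H) (t : R) (d : as_real H) : Prop :=
  exists (h1 h2 : R -> as_real H) (I : as_real H),
    (forall xi, 0 < xi < t -> is_derive h xi (h1 xi)) /\
    (forall xi, 0 < xi < t -> is_derive h1 xi (h2 xi)) /\
    is_RInt_gen (fun xi => scal (/ Rpower (t - xi) (alpha - 1)) (h2 xi))
      (at_right 0) (at_left t) I /\
    d = scal (/ Gamma (2 - alpha)) I.

(** Continuity on [0, T] is relative to [0, T]: the values of [u] outside
    [0, T] are irrelevant. *)
Record is_solution (K : scalar_kind) (H : NormedModule (scalar K))
    (A : operator H) (alpha nu T : R) (phi : H) (u : R -> as_real H) : Prop := {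
  sol_continuous : forall t, 0 <= t <= T ->
    filterlim u (within (fun s => 0 <= s <= T) (locally t)) (locally (u t));
  sol_equation : exists Du : R -> as_real H,
    (forall t, 0 < t < T -> is_Caputo alpha u t (Du t)) /\
    (forall t, 0 < t < T -> dom A (u t) /\ dom A (Du t)) /\
    (forall t, 0 < t < T -> continuous Du t) /\
    (forall t, 0 < t < T -> continuous (fun s => A (u s) : as_real H) t) /\
    (forall t, 0 < t < T -> continuous (fun s => A (Du s) : as_real H) t) /\
    (forall t, 0 < t < T ->
       plus (plus (Du t) (A (Du t) : as_real H))
            (scal (nu ^ 2) (A (u t) : as_real H)) = zero);
  sol_nonlocal : u 0 = u T;
  sol_integral : is_RInt u 0 T phi
}.

(** Sequences are indexed from 0, so index [k] below is the index k + 1 of the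
    mathematical text. *)
Definition nu_k (nu : R) (lam : nat -> R) (k : nat) : R :=
  nu * sqrt (lam k / (1 + lam k)).

Definition Delta_k (alpha nu T : R) (lam : nat -> R) (k : nat) : R :=
  let z := - nu_k nu lam k ^ 2 * rpow T alpha in
  Mittag_Leffler alpha 2 z ^ 2
  + Mittag_Leffler alpha 3 z * (1 - Mittag_Leffler alpha 1 z).

Definition solution_term (K : scalar_kind) (H : NormedModule (scalar K))
    (ip : H -> H -> scalar K) (v : nat -> H) (lam : nat -> R)
    (alpha nu T : R) (phi : H) (t : R) (k : nat) : H :=
  let zT := - nu_k nu lam k ^ 2 * rpow T alpha in
  let zt := - nu_k nu lam k ^ 2 * rpow t alpha in
  let D := Delta_k alpha nu T lam k in
  let phik := ip phi (v k) in
  scal (plus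
    (mult phik (sinj K (Mittag_Leffler alpha 2 zT * Mittag_Leffler alpha 1 zt
                        / (T * D))))
    (mult phik (sinj K (t * (1 - Mittag_Leffler alpha 1 zT)
                        * Mittag_Leffler alpha 2 zt / (T ^ 2 * D)))))
    (v k).

(* Main.v *)
Require Import Defs.
From Stdlib Require Import Reals Lra Lia Classical ClassicalEpsilon.
From Coquelicot Require Import Coquelicot.
Open Scope R_scope.

(** Expanding in the eigenvectors reduces the problem to the scalar equations
    [D^alpha w = c w] with [c = - nu_k^2 < 0], whose solutions are the
    combinations of [m_1 = E_{alpha,1}(c t^alpha)] and
    [m_2 = t E_{alpha,2}(c t^alpha)]; the two extra conditions form a linear
    system with determinant [T^2 Delta_k].

    Positivity of [Delta_k] is an energy argument.  Write [b = alpha - 1] and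
    [m_3 = t^2 E_{alpha,3}(c t^alpha)].  The inequality
    [g D^b g >= D^b (g^2) / 2] for [g = m_1'], where [D^b g = c m_1], and for
    [g = 1 - m_1], where [D^b g = - c m_2], integrates to [m_1^2 < 1] and
    [m_2^2 < 2 m_3], hence [m_2^2 + m_3 (1 - m_1) > 0].

    For uniqueness of the scalar initial value problem, let [f = w'] vanish at 0
    and let [|f(s)| exp (- K s)] attain its maximum over [[0, t]] at [t].  By a
    maximum principle [|Gamma(1 - b) D^b f(t)| >= T^(-b) |f(t)|], while [D^b f = c w]
    is at most [|c f(t)| / K]; for large [K] this forces [f = 0].

    For existence, [- nu_k^2] stays in a compact subset of the negative half
    line because the inverse of [A] is compact, so all coefficient functions are
    bounded and equicontinuous uniformly in [k], and the series can be
    differentiated and integrated termwise. *)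

(** * Improper Riemann integrals *)

(** [is_Caputo] supplies only pointwise derivatives and an improper integral: the second derivative
    is assumed neither continuous nor absolutely integrable, and nothing is assumed at 0. So the
    fundamental theorem of calculus is needed for arbitrary derivatives, the maximum principle rests
    on one-sided estimates of increments, and the limit b of w' at 0, without which w - a m_1 - b
    m_2 cannot be given zero initial data, has to be extracted from the convergence of the Caputo
    integral itself. On the explicit side, every function is a power t^p times a power series in
    t^alpha. This class is closed under products, differentiation and integration against (t - s)^(r
    - 1), the last by the Beta integral. The energies are therefore differentiated coefficientwise,
    never under a singular integral. In [H], vector identities are tested against the vectors
    [pr k z], which turns them into scalar ones; membership in the domain of [A] follows because the
    graph of a self-adjoint operator contains every pair that passes the adjoint test. *)

Ltac Req := lazymatch goal with |- ?x = ?y => change (@eq R x y) end.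

Ltac Rsimp := unfold minus, plus, opp, scal; simpl; unfold mult; simpl.

Ltac unball := unfold ball in *; simpl in *;
  unfold AbsRing_ball, abs, minus, plus, opp in *; simpl in *.

(* No continuity of [dF] is assumed: with mean value tags every Riemann sum of
   [dF] telescopes. *)
Lemma RInt_ge_increment (F dF f : R -> R) (a b I : R) :
  a <= b -> (forall x, a <= x <= b -> is_derive F x (dF x)) ->
  (forall x, a <= x <= b -> dF x <= f x) ->
  is_RInt f a b I -> F b - F a <= I.
Proof.
  intros Hab HF Hdf HI.
  destruct (Req_dec a b) as [->|Hne].
  { assert (H0 := is_RInt_point f b).
    rewrite <- (is_RInt_unique _ _ _ _ HI), (is_RInt_unique _ _ _ _ H0).
    unfold zero; simpl; lra. }
  (* The hypotheses on x and y sit inside the existential so that the chosen tag is a total function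
     of the two end points, as [SF_seq_f2] requires. *)
  assert (Htag : forall x y, exists z, x <= y ->
     x <= z <= y /\ (a <= x -> y <= b -> F y - F x <= f z * (y - x))).
  { intros x y.
    destruct (classic (x <= y /\ a <= x /\ y <= b)) as [[Hxy [Hx Hy]]|H].
    - destruct (MVT_gen F x y dF) as [c [Hc1 Hc2]].
      + rewrite Rmin_left, Rmax_right by lra. intros; apply HF; lra.
      + rewrite Rmin_left, Rmax_right by lra. intros z Hz.
        apply continuity_pt_filterlim, (ex_derive_continuous F).
        exists (dF z); apply HF; lra.
      + rewrite Rmin_left, Rmax_right in Hc1 by lra.
        exists c; intros _; split; [lra|intros; rewrite Hc2].
        apply Rmult_le_compat_r; [lra|apply Hdf; lra].
    - exists x; intros Hxy; split; [lra|]. intros; exfalso; tauto. }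
  set (tag := fun x y => proj1_sig (constructive_indefinite_description _ (Htag x y))).
  assert (Htg : forall x y, x <= y -> x <= tag x y <= y /\
     (a <= x -> y <= b -> F y - F x <= f (tag x y) * (y - x))).
  { intros x y; unfold tag.
    destruct (constructive_indefinite_description _ (Htag x y)) as [z Hz]; exact Hz. }
  (* Induction on the number of cells: removing the leftmost cell of the uniform partition of [x, b]
     leaves the uniform partition of [x1, b]. *)
  assert (Hsum : forall n x, a <= x <= b ->
     F b - F x <= Riemann_sum f (SF_seq_f2 tag (unif_part x b n))).
  { induction n as [|n IH]; intros x Hx.
    - unfold unif_part, seq.mkseq; simpl. unfold Riemann_sum; simpl.
      unfold plus, scal, zero; simpl; unfold mult; simpl.
      replace (x + 0 * (b - x) / (0 + 1)) with x by field.
      replace (x + 1 * (b - x) / (0 + 1)) with b by field.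
      destruct (Htg x b) as [_ H]; [lra|]. specialize (H ltac:(lra) ltac:(lra)). lra.
    - rewrite unif_part_S, SF_cons_f2.
      2:{ unfold unif_part; rewrite seq.size_mkseq; apply Nat.lt_0_succ. }
      rewrite Riemann_sum_cons.
      set (x1 := (x * INR (S n) + b) / INR (S (S n))).
      assert (Hx1 : x <= x1 <= b).
      { unfold x1. assert (0 < INR (S n)) by (apply lt_0_INR; lia).
          rewrite (S_INR (S n)). split.
          - apply Rmult_le_reg_r with (INR (S n) + 1); [lra|].
            unfold Rdiv; rewrite Rmult_assoc, Rinv_l, Rmult_1_r by lra. nra.
          - apply Rmult_le_reg_r with (INR (S n) + 1); [lra|].
            unfold Rdiv; rewrite Rmult_assoc, Rinv_l, Rmult_1_r by lra. nra. }
      assert (Hh : SF_h (SF_seq_f2 tag (unif_part x1 b n)) = x1).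
      { unfold unif_part, seq.mkseq; simpl.
        unfold Rdiv; rewrite !Rmult_0_l, Rplus_0_r; reflexivity. }
      rewrite Hh, head_unif_part; simpl.
      unfold plus, scal; simpl; unfold mult; simpl.
      destruct (Htg x x1) as [_ H]; [lra|]. specialize (H ltac:(lra) ltac:(lra)).
      specialize (IH x1 ltac:(lra)). lra. }
  apply le_epsilon; intros eps Heps.
  assert (HI' := proj1 (filterlim_locally _ _) HI (mkposreal _ Heps)).
  destruct HI' as [d Hd].
  destruct (seq_step_unif_part_ex a b d) as [n Hn].
  assert (Htag2 : forall a0 b0, a0 <= b0 -> a0 <= tag a0 b0 <= b0)
    by (intros; apply Htg; assumption).
  destruct (Riemann_fine_unif_part tag a b n Htag2 Hab) as [H1 [H2 [H3 H4]]].
  specialize (Hd (SF_seq_f2 tag (unif_part a b n))).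
  specialize (Hsum n a ltac:(lra)).
  assert (Hs : sign (b - a) = 1) by (apply sign_eq_1; lra).
  rewrite Hs in Hd.
  set (S := Riemann_sum f _) in *.
  assert (HB : ball I eps (scal 1 S)).
  { apply Hd.
    - rewrite SF_lx_f2; [exact Hn|].
      unfold unif_part; rewrite seq.size_mkseq; apply Nat.lt_0_succ.
    - split; [exact H2|]. rewrite Rmin_left, Rmax_right by lra. split; assumption. }
  unfold scal in HB; simpl in HB; unfold mult in HB; simpl in HB.
  rewrite Rmult_1_l in HB. unball. apply Rabs_def2 in HB. lra.
Qed.

(** The preceding inequality applied to F and to - F. It is the fundamental theorem of calculus for
    a derivative that is merely Riemann integrable. *)
Lemma RInt_derivative (F f : R -> R) (a b I : R) :
  a <= b -> (forall x, a <= x <= b -> is_derive F x (f x)) ->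
  is_RInt f a b I -> I = F b - F a.
Proof.
  intros Hab HF HI. apply Rle_antisym.
  - assert (H : - F b - - F a <= - I).
    { apply (RInt_ge_increment (fun x => - F x) (fun x => - f x) (fun x => - f x) a b); auto.
      - intros x Hx. apply (is_derive_opp F), HF, Hx.
      - intros; lra.
      - apply (is_RInt_opp f), HI. }
    lra.
  - apply (RInt_ge_increment F f f a b); auto. intros; lra.
Qed.

Section RealLimits.
Context {T : Type} (F : (T -> Prop) -> Prop) {FF : Filter F}.

Lemma filterlim_Rplus (f g : T -> R) (a b : R) : filterlim f F (locally a) -> filterlim g F (locally b) ->
  filterlim (fun x => f x + g x) F (locally (a + b)).
Proof.
  intros Hf Hg. apply (filterlim_comp_2 _ _ Rplus Hf Hg), (filterlim_plus (K := R_AbsRing) (V := R_NormedModule)).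
Qed.

Lemma filterlim_Rmult (f g : T -> R) (a b : R) : filterlim f F (locally a) -> filterlim g F (locally b) ->
  filterlim (fun x => f x * g x) F (locally (a * b)).
Proof. intros Hf Hg. apply (filterlim_comp_2 _ _ Rmult Hf Hg), (filterlim_mult (K := R_AbsRing)). Qed.

Lemma filterlim_Rscal (k : R) (f : T -> R) (a : R) : filterlim f F (locally a) ->
  filterlim (fun x => k * f x) F (locally (k * a)).
Proof. apply filterlim_Rmult, filterlim_const. Qed.

Lemma filterlim_Ropp (f : T -> R) (a : R) : filterlim f F (locally a) ->
  filterlim (fun x => - f x) F (locally (- a)).
Proof.
  intros Hf. apply (filterlim_comp _ _ _ f Ropp _ _ _ Hf), (filterlim_opp (K := R_AbsRing) (V := R_NormedModule) a).
Qed.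

Lemma filterlim_Rminus (f g : T -> R) (a b : R) : filterlim f F (locally a) -> filterlim g F (locally b) ->
  filterlim (fun x => f x - g x) F (locally (a - b)).
Proof. intros Hf Hg. apply filterlim_Rplus; [exact Hf|apply filterlim_Ropp, Hg]. Qed.

End RealLimits.

(** Eventually the end points are ordered and the closed segment between them lies in [D].
    Integrands then need to be controlled only on the open interval [D], whatever happens at its
    ends. *)
Definition ends_in (Fa Fb : (R -> Prop) -> Prop) (D : R -> Prop) : Prop :=
  filter_prod Fa Fb
    (fun ab => fst ab <= snd ab /\ forall x, fst ab <= x <= snd ab -> D x).

Lemma ends_in_interval (t : R) :
  0 < t -> ends_in (at_right 0) (at_left t) (fun x => 0 < x < t).
Proof.
  intros Ht. exists (fun a => 0 < a < t / 2) (fun b => t / 2 < b < t).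
  - exists (mkposreal (t / 2) ltac:(lra)); intros y Hy Hy0; simpl in *.
    unball.
    apply Rabs_def2 in Hy; lra.
  - exists (mkposreal (t / 2) ltac:(lra)); intros y Hy Hy0; simpl in *.
    unball.
    apply Rabs_def2 in Hy; lra.
  - intros x y Hx Hy; simpl; split; [lra|intros; lra].
Qed.

Lemma ends_in_half_line :
  ends_in (at_right 0) (Rbar_locally p_infty) (fun x => 0 < x).
Proof.
  exists (fun a => 0 < a < 1) (fun b => 1 < b).
  - exists (mkposreal 1 Rlt_0_1); intros y Hy Hy0; simpl in *.
    unball.
    apply Rabs_def2 in Hy; lra.
  - exists 1; intros; assumption.
  - intros x y Hx Hy; simpl; split; [lra|intros; lra].
Qed.

Lemma is_RInt_gen_ext_in {V : NormedModule R_AbsRing} (Fa Fb : (R -> Prop) -> Prop)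
  {FFa : Filter Fa} {FFb : Filter Fb} (D : R -> Prop) (f g : R -> V) (l : V) :
  ends_in Fa Fb D -> (forall x, D x -> f x = g x) ->
  is_RInt_gen f Fa Fb l -> is_RInt_gen g Fa Fb l.
Proof.
  intros HD Hfg. apply is_RInt_gen_ext.
  unfold ends_in in HD; generalize HD; apply filter_imp.
  intros [a b] [Hab H] x Hx; simpl in *.
  rewrite Rmin_left, Rmax_right in Hx by lra. apply Hfg, H; lra.
Qed.

Lemma is_RInt_gen_ext_interval (f g : R -> R) (t l : R) : 0 < t -> (forall s, 0 < s < t -> f s = g s) ->
  is_RInt_gen f (at_right 0) (at_left t) l -> is_RInt_gen g (at_right 0) (at_left t) l.
Proof.
  intros Ht. apply is_RInt_gen_ext_in with (D := fun s => 0 < s < t); try typeclasses eauto.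
  apply ends_in_interval, Ht.
Qed.

Lemma is_RInt_gen_FTC (Fa Fb : (R -> Prop) -> Prop)
  {FFa : Filter Fa} {FFb : Filter Fb} (D : R -> Prop) (F f : R -> R) (la lb : R) :
  ends_in Fa Fb D ->
  (forall x, D x -> is_derive F x (f x)) -> (forall x, D x -> continuous f x) ->
  filterlim F Fa (locally la) -> filterlim F Fb (locally lb) ->
  is_RInt_gen f Fa Fb (lb - la).
Proof.
  intros HD HF Hc Ha Hb.
  apply filterlimi_locally; intros eps.
  assert (He2 : 0 < eps / 2) by (destruct eps; simpl; lra).
  assert (Ha' := proj1 (filterlim_locally _ _) Ha (mkposreal _ He2)).
  assert (Hb' := proj1 (filterlim_locally _ _) Hb (mkposreal _ He2)).
  assert (HP : filter_prod Fa Fb (fun ab => ball la (eps / 2) (F (fst ab)) /\ ball lb (eps / 2) (F (snd ab)))).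
  { eexists; [exact Ha'|exact Hb'|]. intros x y; simpl; tauto. }
  unfold ends_in in HD. generalize (filter_and _ _ HD HP); apply filter_imp.
  intros [a b] [[Hab H] [Ba Bb]]; simpl in *.
  exists (F b - F a); split.
  - apply (is_RInt_derive F f); rewrite Rmin_left, Rmax_right by lra; intros; auto.
  - unfold ball in *; simpl in *; unfold AbsRing_ball, abs, minus, plus, opp in *; simpl in *.
    replace (F b - F a + - (lb - la)) with ((F b + - lb) - (F a + - la)) by ring.
    eapply Rle_lt_trans; [apply Rabs_triang|]. rewrite Rabs_Ropp. lra.
Qed.

Lemma is_RInt_gen_RInt_dist {V : CompleteNormedModule R_AbsRing} (Fa Fb : (R -> Prop) -> Prop)
  (f : R -> V) (l : V) (eps : posreal) :
  Filter Fa -> Filter Fb ->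
  is_RInt_gen f Fa Fb l ->
  filter_prod Fa Fb (fun ab => ex_RInt f (fst ab) (snd ab) /\
     ball l eps (RInt f (fst ab) (snd ab))).
Proof.
  intros FFa FFb H. assert (H1 := proj1 (filterlimi_locally _ _) H eps).
  generalize H1; apply filter_imp.
  intros [a b] [z [Hz1 Hz2]]; simpl in *. split; [exists z; exact Hz1|].
  rewrite (is_RInt_unique _ _ _ _ Hz1); exact Hz2.
Qed.

Lemma RInt_norm_dom {V : CompleteNormedModule R_AbsRing} (D : R -> Prop) (f : R -> V) (g : R -> R) (a b : R) :
  (forall x, Rmin a b <= x <= Rmax a b -> D x) ->
  (forall x, D x -> continuous f x) -> (forall x, D x -> norm (f x) <= g x) ->
  ex_RInt g a b -> norm (RInt f a b) <= Rabs (RInt g a b).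
Proof.
  intros HD Hc Hn Hg.
  assert (Hf : ex_RInt f a b) by (apply ex_RInt_continuous; auto).
  destruct (Rle_dec a b) as [Hab|Hab].
  - rewrite Rmin_left, Rmax_right in HD by lra.
    eapply Rle_trans; [|apply Rle_abs].
    apply (norm_RInt_le f g a b); auto.
    + apply (RInt_correct f), Hf.
    + apply (RInt_correct g), Hg.
  - rewrite Rmin_right, Rmax_left in HD by lra.
    apply ex_RInt_swap in Hf. apply ex_RInt_swap in Hg.
    rewrite <- (opp_RInt_swap f) by assumption.
    rewrite <- (opp_RInt_swap g) by assumption.
    rewrite (norm_opp (V := V)). unfold opp; simpl. rewrite Rabs_Ropp.
    eapply Rle_trans; [|apply Rle_abs].
    apply (norm_RInt_le f g b a); auto; [lra| |].
    + apply (RInt_correct f), Hf.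
    + apply (RInt_correct g), Hg.
Qed.

Lemma minus_eq_minus {G : AbelianGroup} (a b c d : G) :
  plus a b = plus c d -> minus b c = minus d a.
Proof.
  intros H. change (plus b (opp c) = plus d (opp a)).
  apply (plus_reg_l (G := G) a). rewrite plus_assoc, H.
  rewrite (plus_comm c), <- plus_assoc, (plus_opp_r (G := G)), plus_zero_r.
  rewrite (plus_comm d), plus_assoc, (plus_opp_r (G := G)), plus_zero_l. reflexivity.
Qed.

(** Cauchy criterion. The integrals of f over [a, b] and [a', b'] differ by one piece near each end.
    Each piece is dominated by an integral of g, which is a difference of two integrals of g over
    segments with mixed end points, both within eps / 8 of [lg]. *)
Lemma ex_RInt_gen_dom {V : CompleteNormedModule R_AbsRing} (Fa Fb : (R -> Prop) -> Prop)
  (PFa : ProperFilter Fa) (PFb : ProperFilter Fb) (D : R -> Prop)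
  (f : R -> V) (g : R -> R) (lg : R) :
  ends_in Fa Fb D -> (forall x, D x -> continuous f x) ->
  (forall x, D x -> norm (f x) <= g x) ->
  is_RInt_gen g Fa Fb lg -> exists l : V, is_RInt_gen f Fa Fb l.
Proof.
  intros HD Hc Hn Hg.
  assert (HC : exists y : V, filterlim (fun ab => RInt f (fst ab) (snd ab)) (filter_prod Fa Fb) (locally y)).
  { apply (filterlim_locally_cauchy (U := V) (fun ab => RInt f (fst ab) (snd ab))). intros eps.
    assert (He : 0 < eps / 8) by (destruct eps; simpl; lra).
    assert (H1 := is_RInt_gen_RInt_dist Fa Fb g lg (mkposreal _ He) _ _ Hg).
    unfold ends_in in HD. destruct (filter_and _ _ HD H1) as [Q P HQ HP HQP]; simpl in HQP.
    exists (fun ab => Q (fst ab) /\ P (snd ab)). split.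
    - exists Q P; auto.
    - intros [a b] [a' b'] [Qa Pb] [Qa' Pb']; simpl in *.
      destruct (HQP a b Qa Pb) as [[L1 D1] [E1 B1]].
      destruct (HQP a' b' Qa' Pb') as [[L2 D2] [E2 B2]].
      destruct (HQP a b' Qa Pb') as [[L3 D3] [E3 B3]].
      destruct (HQP a' b Qa' Pb) as [[L4 D4] [E4 B4]].
      assert (ex1 : ex_RInt g a a').
      { apply ex_RInt_Chasles with b; [assumption|apply ex_RInt_swap; assumption]. }
      assert (ex2 : ex_RInt g b b').
      { apply ex_RInt_Chasles with a; [apply ex_RInt_swap|]; assumption. }
      assert (C1 : RInt g a b' = plus (RInt g a a') (RInt g a' b')) by (symmetry; apply RInt_Chasles; assumption).
      assert (C2 : RInt g a b' = plus (RInt g a b) (RInt g b b')) by (symmetry; apply RInt_Chasles; assumption).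
      assert (N1 : norm (RInt f a a') <= Rabs (RInt g a a')).
      { apply (RInt_norm_dom D); auto. intros x Hx.
        destruct (Rle_dec a a').
        - rewrite Rmin_left, Rmax_right in Hx by lra. apply D1.
          split; [lra|]. destruct (Rle_dec x b); [lra|]. lra.
        - rewrite Rmin_right, Rmax_left in Hx by lra. apply D2. lra. }
      assert (N2 : norm (RInt f b b') <= Rabs (RInt g b b')).
      { apply (RInt_norm_dom D); auto. intros x Hx.
        destruct (Rle_dec b b').
        - rewrite Rmin_left, Rmax_right in Hx by lra. apply D3. lra.
        - rewrite Rmin_right, Rmax_left in Hx by lra. apply D4. lra. }
      assert (exf : forall u v, (u <= v) -> (forall x, u <= x <= v -> D x) -> ex_RInt f u v).
      { intros u v Huv Hd. apply ex_RInt_continuous. rewrite Rmin_left, Rmax_right by lra. auto. }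
      assert (F1 := exf _ _ L1 D1). assert (F2 := exf _ _ L2 D2).
      assert (F3 := exf _ _ L3 D3). assert (F4 := exf _ _ L4 D4).
      assert (exf1 : ex_RInt f a a').
      { apply ex_RInt_Chasles with b; [assumption|apply ex_RInt_swap; assumption]. }
      assert (exf2 : ex_RInt f b b').
      { apply ex_RInt_Chasles with a; [apply ex_RInt_swap|]; assumption. }
      assert (G1 : RInt f a b' = plus (RInt f a a') (RInt f a' b')) by (symmetry; apply RInt_Chasles; assumption).
      assert (G2 : RInt f a b' = plus (RInt f a b) (RInt f b b')) by (symmetry; apply RInt_Chasles; assumption).
      unfold plus in C1, C2; simpl in C1, C2.
      unball.
      apply (norm_compat1 (V := V)).
      assert (E : minus (RInt f a' b') (RInt f a b) = minus (RInt f b b') (RInt f a a')).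
      { apply (minus_eq_minus (G := V)). exact (eq_trans (eq_sym G1) G2). }
      apply (Rle_lt_trans _ (norm (minus (RInt f b b') (RInt f a a')))); [right; exact (f_equal norm E)|].
      eapply Rle_lt_trans; [apply (norm_triangle (V := V))|]. rewrite (norm_opp (V := V)).
      apply Rabs_def2 in B1. apply Rabs_def2 in B2. apply Rabs_def2 in B3. apply Rabs_def2 in B4.
      assert (Rabs (RInt g a a') <= eps / 4) by (apply Rabs_le; lra).
      assert (Rabs (RInt g b b') <= eps / 4) by (apply Rabs_le; lra).
      destruct eps as [e He']; simpl in *; lra. }
  destruct HC as [l Hl]. exists l.
  apply filterlimi_locally; intros eps.
  assert (Hl' := proj1 (filterlim_locally _ _) Hl eps).
  unfold ends_in in HD. generalize (filter_and _ _ HD Hl'); apply filter_imp.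
  intros [a b] [[Hab H] Bl]; simpl in *.
  exists (RInt f a b); split; [|exact Bl].
  apply (RInt_correct f), ex_RInt_continuous. rewrite Rmin_left, Rmax_right by lra. auto.
Qed.

Lemma is_RInt_gen_norm_le {V : CompleteNormedModule R_AbsRing} (Fa Fb : (R -> Prop) -> Prop)
  (PFa : ProperFilter Fa) (PFb : ProperFilter Fb) (D : R -> Prop)
  (f : R -> V) (g : R -> R) (lf : V) (lg : R) :
  ends_in Fa Fb D -> (forall x, D x -> norm (f x) <= g x) ->
  is_RInt_gen f Fa Fb lf -> is_RInt_gen g Fa Fb lg -> norm lf <= lg.
Proof.
  unfold ends_in; intros HD Hn. apply RInt_gen_norm.
  - apply (filter_imp _ _) with (2 := HD). intros ab [H _]; exact H.
  - apply (filter_imp _ _) with (2 := HD). intros ab [_ H] x Hx; auto.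
Qed.

Lemma is_RInt_gen_uniq (Fa Fb : (R -> Prop) -> Prop)
  (PFa : ProperFilter Fa) (PFb : ProperFilter Fb) (f : R -> R) (l l' : R) :
  is_RInt_gen f Fa Fb l -> is_RInt_gen f Fa Fb l' -> l = l'.
Proof.
  intros H H'. assert (H1 := is_RInt_gen_unique (V := R_CompleteNormedModule) f l H).
  assert (H2 := is_RInt_gen_unique (V := R_CompleteNormedModule) f l' H'). congruence.
Qed.

(** The weight w carries the singularities and has a finite integral W, so uniform convergence of
    [SN] costs at most [e N * W] in the integral. It serves to integrate a power series termwise
    against a Beta kernel. *)
Lemma is_RInt_gen_uniform_limit (Fa Fb : (R -> Prop) -> Prop)
  (PFa : ProperFilter Fa) (PFb : ProperFilter Fb) (D : R -> Prop)
  (w S : R -> R) (SN : nat -> R -> R) (e : nat -> R) (W M : R) (J : nat -> R) :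
  ends_in Fa Fb D ->
  (forall x, D x -> 0 <= w x) -> (forall x, D x -> continuous w x) ->
  (forall x, D x -> continuous S x) -> (forall x, D x -> Rabs (S x) <= M) ->
  is_RInt_gen w Fa Fb W ->
  (forall N, is_RInt_gen (fun x => w x * SN N x) Fa Fb (J N)) ->
  (forall N x, D x -> Rabs (SN N x - S x) <= e N) -> is_lim_seq e 0 ->
  exists I, is_RInt_gen (fun x => w x * S x) Fa Fb I /\ is_lim_seq J I.
Proof.
  intros HD Hw Hcw HcS HM HW HJ He Hl.
  destruct (ex_RInt_gen_dom (V := R_CompleteNormedModule) Fa Fb PFa PFb D (fun x => w x * S x) (fun x => scal M (w x)) (scal M W)) as [I HI]; auto.
  - intros x Dx. apply (continuous_mult w S); auto.
  - intros x Dx. unfold norm; simpl; unfold abs; simpl. unfold scal; simpl; unfold mult; simpl.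
    rewrite Rabs_mult, (Rabs_pos_eq (w x)) by auto.
    rewrite Rmult_comm. apply Rmult_le_compat_r; auto.
  - apply (is_RInt_gen_scal w); exact HW.
  - exists I; split; [exact HI|].
    assert (HJI : forall N, Rabs (J N - I) <= e N * W).
    { intros N.
      apply (is_RInt_gen_norm_le (V := R_CompleteNormedModule) Fa Fb PFa PFb D
               (fun x => minus (w x * SN N x) (w x * S x)) (fun x => scal (e N) (w x)) (minus (J N) I) (scal (e N) W) HD).
      - intros x Dx. unfold norm; simpl; unfold abs; simpl. unfold scal, minus, plus, opp; simpl; unfold mult; simpl.
        replace (w x * SN N x + - (w x * S x)) with ((SN N x - S x) * w x) by ring.
        rewrite Rabs_mult, (Rabs_pos_eq (w x)) by auto.
        apply Rmult_le_compat_r; auto.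
      - apply (is_RInt_gen_minus (fun x => w x * SN N x) (fun x => w x * S x)); auto.
      - apply (is_RInt_gen_scal w); exact HW. }
    apply is_lim_seq_le_le with (fun N => I - e N * W) (fun N => I + e N * W).
    + intros N. specialize (HJI N). apply Rabs_le_between in HJI. lra.
    + replace (Finite I) with (Finite (I - 0 * W)) by (f_equal; ring).
      apply is_lim_seq_minus'; [apply is_lim_seq_const|].
      apply is_lim_seq_mult'; [exact Hl|apply is_lim_seq_const].
    + replace (Finite I) with (Finite (I + 0 * W)) by (f_equal; ring).
      apply is_lim_seq_plus'; [apply is_lim_seq_const|].
      apply is_lim_seq_mult'; [exact Hl|apply is_lim_seq_const].
Qed.

(** * The Gamma and Beta functions *)

Lemma Rpower_pos (x p : R) : 0 < Rpower x p.
Proof. apply exp_pos. Qed.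

Lemma is_derive_Rpower (x p : R) :
  0 < x -> is_derive (fun y => Rpower y p) x (p * Rpower x (p - 1)).
Proof. intros Hx. apply is_derive_Reals, derivable_pt_lim_power; exact Hx. Qed.

Lemma continuous_of_derive (f : R -> R) (x l : R) : is_derive f x l -> continuous f x.
Proof. intros H. apply (ex_derive_continuous f). exists l; exact H. Qed.

Lemma continuous_Rpower (x p : R) : 0 < x -> continuous (fun y => Rpower y p) x.
Proof. intros Hx. eapply continuous_of_derive, is_derive_Rpower, Hx. Qed.

Lemma continuous_within {T U : UniformSpace} (D : T -> Prop) (f : T -> U) (x : T) :
  continuous f x -> filterlim f (within D (locally x)) (locally (f x)).
Proof. intros H. eapply filterlim_filter_le_1; [apply filter_le_within|exact H]. Qed.

Lemma continuous_at_right {U : UniformSpace} (f : R -> U) (x : R) :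
  continuous f x -> filterlim f (at_right x) (locally (f x)).
Proof. apply continuous_within. Qed.

Lemma continuous_at_left {U : UniformSpace} (f : R -> U) (x : R) :
  continuous f x -> filterlim f (at_left x) (locally (f x)).
Proof. apply continuous_within. Qed.

Lemma Rpower_lt_eps (p eps s : R) : 0 < p -> 0 < eps -> 0 < s < Rpower eps (/ p) -> Rpower s p < eps.
Proof.
  intros Hp He Hs. replace eps with (Rpower (Rpower eps (/ p)) p) at 1.
  - apply Rlt_Rpower_l; lra.
  - rewrite Rpower_mult, Rinv_l by lra. apply Rpower_1, He.
Qed.

Lemma continuous_rpow (x p : R) : 0 < p -> continuous (fun y => rpow y p) x.
Proof.
  intros Hp. destruct (Rtotal_order x 0) as [Hx|[->|Hx]].
  - apply (continuous_ext_loc _ (fun _ => 0)).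
    + exists (mkposreal (-x) ltac:(lra)); intros y Hy.
      unball.
      apply Rabs_def2 in Hy. unfold rpow. destruct (Rle_dec y 0); [reflexivity|lra].
    + apply continuous_const.
  - apply filterlim_locally. intros eps.
    exists (mkposreal (Rpower eps (/ p)) (Rpower_pos _ _)); intros y Hy.
    unball.
    unfold rpow. destruct (Rle_dec 0 0) as [_|]; [|lra].
    rewrite Ropp_0, Rplus_0_r in *.
    destruct (Rle_dec y 0).
    + rewrite Rabs_R0; apply cond_pos.
    + rewrite Rabs_pos_eq by apply Rlt_le, Rpower_pos.
      apply Rpower_lt_eps; [exact Hp|apply cond_pos|].
      rewrite Rabs_pos_eq in Hy; lra.
  - apply (continuous_ext_loc _ (fun y => Rpower y p)).
    + exists (mkposreal x Hx); intros y Hy.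
      unball.
      apply Rabs_def2 in Hy. unfold rpow. destruct (Rle_dec y 0); [lra|reflexivity].
    + apply continuous_Rpower, Hx.
Qed.

Lemma rpow_pos (x p : R) : 0 < x -> rpow x p = Rpower x p.
Proof. intros Hx. unfold rpow. destruct (Rle_dec x 0); [lra|reflexivity]. Qed.

Lemma rpow_neg (x p : R) : x <= 0 -> rpow x p = 0.
Proof. intros Hx. unfold rpow. destruct (Rle_dec x 0); [reflexivity|lra]. Qed.

Lemma rpow_ge_0 (x p : R) : 0 <= rpow x p.
Proof. unfold rpow. destruct (Rle_dec x 0); [lra|apply Rlt_le, Rpower_pos]. Qed.

Lemma filterlim_Rpower_0 (p : R) : 0 < p -> filterlim (fun s => Rpower s p) (at_right 0) (locally 0).
Proof.
  intros Hp. apply filterlim_ext_loc with (fun s => rpow s p).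
  - exists (mkposreal 1 Rlt_0_1); intros y _ Hy. apply rpow_pos, Hy.
  - assert (H := continuous_at_right _ _ (continuous_rpow 0 p Hp)).
    cbv beta in H. rewrite (rpow_neg 0) in H by lra. exact H.
Qed.

(** From ln y <= y at y = s / (2 p). The factor 2 leaves the integrable exp (- s / 2) once the bound
    is multiplied by exp (- s). *)
Lemma Rpower_le_exp (p s : R) : 0 < p -> 0 < s ->
  Rpower s p <= exp (p * ln (2 * p)) * exp (s / 2).
Proof.
  intros Hp Hs. rewrite <- exp_plus. unfold Rpower.
  assert (H : ln s - ln (2 * p) <= s / (2 * p)).
  { rewrite <- ln_div by lra.
    assert (0 < s / (2 * p)) by (apply Rdiv_lt_0_compat; lra).
    assert (H1 := exp_ineq1_le (ln (s / (2 * p)))). rewrite exp_ln in H1 by assumption. lra. }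
  assert (H2 : p * ln s <= p * ln (2 * p) + s / 2).
  { apply Rmult_le_compat_l with (r := p) in H; [|lra].
    replace (p * (s / (2 * p))) with (s / 2) in H by (field; lra). lra. }
  destruct H2 as [H2| ->]; [left; apply exp_increasing, H2|right; reflexivity].
Qed.

Lemma filterlim_exp_half_p_infty (C : R) : filterlim (fun s => C * exp (- (s / 2))) (Rbar_locally p_infty) (locally 0).
Proof.
  replace 0 with (C * 0) by ring.
  apply (filterlim_comp _ _ _ (fun s => exp (- (s / 2))) (fun y => C * y) _ (locally 0)).
  2:{ apply (continuous_scal_r C (fun y : R => y) 0), continuous_id. }
  apply (is_lim_comp exp (fun s => - (s / 2)) p_infty 0 m_infty).
  - apply is_lim_exp_m.
  - apply is_lim_ext with (fun s => (- / 2) * s); [intros; field|].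
    replace m_infty with (Rbar_mult (- / 2) p_infty).
    + apply is_lim_scal_l, is_lim_id.
    + simpl. destruct (Rle_dec 0 (- / 2)) as [H|H]; [exfalso; clear - H; lra|reflexivity].
  - exists 0; intros; discriminate.
Qed.

Lemma is_derive_exp_neg (x : R) : is_derive (fun s => exp (- s)) x (- exp (- x)).
Proof. auto_derive; [exact I|ring]. Qed.

Definition gamma_kernel (p s : R) : R := Rpower s p * exp (- s).

Lemma continuous_gamma_kernel (p s : R) : 0 < s -> continuous (gamma_kernel p) s.
Proof.
  intros Hs. apply (continuous_mult (fun s => Rpower s p) (fun s => exp (- s))).
  - apply continuous_Rpower, Hs.
  - apply (ex_derive_continuous (fun s => exp (- s))). auto_derive. exact I.
Qed.

Lemma gamma_kernel_pos (p s : R) : 0 < gamma_kernel p s.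
Proof. apply Rmult_lt_0_compat; apply exp_pos. Qed.

Lemma gamma_kernel_le (p s : R) : 0 < p -> 0 < s ->
  gamma_kernel p s <= exp (p * ln (2 * p)) * exp (- (s / 2)).
Proof.
  intros Hp Hs. unfold gamma_kernel.
  replace (- (s / 2)) with (s / 2 + - s) by field. rewrite exp_plus, <- Rmult_assoc.
  apply Rmult_le_compat_r; [apply Rlt_le, exp_pos|]. apply Rpower_le_exp; assumption.
Qed.

Lemma gamma_kernel_lim_0 (p : R) : 0 < p -> filterlim (gamma_kernel p) (at_right 0) (locally 0).
Proof.
  intros Hp. unfold gamma_kernel. replace 0 with (0 * exp (- 0)) at 2 by ring.
  apply (filterlim_Rmult (at_right 0)).
  - apply filterlim_Rpower_0, Hp.
  - apply (continuous_at_right (fun s => exp (- s))), (ex_derive_continuous (fun s => exp (- s))).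
    auto_derive. exact I.
Qed.

Lemma gamma_kernel_lim_infty (p : R) : 0 < p ->
  filterlim (gamma_kernel p) (Rbar_locally p_infty) (locally 0).
Proof.
  intros Hp.
  apply (filterlim_le_le (fun _ => 0) (gamma_kernel p) (fun s => exp (p * ln (2 * p)) * exp (- (s / 2)))
           (F := Rbar_locally p_infty) 0).
  - exists 0; intros s Hs. split; [apply Rlt_le, gamma_kernel_pos|apply gamma_kernel_le; assumption].
  - apply filterlim_const.
  - apply (filterlim_exp_half_p_infty (exp (p * ln (2 * p)))).
Qed.

Lemma ex_gamma_kernel_pos (p : R) : 0 < p ->
  exists l : R, is_RInt_gen (gamma_kernel p) (at_right 0) (Rbar_locally p_infty) l.
Proof.
  intros Hp.
  set (C := exp (p * ln (2 * p))).
  apply (ex_RInt_gen_dom (V := R_CompleteNormedModule) (at_right 0) (Rbar_locally p_infty)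
           _ _ (fun x => 0 < x) (gamma_kernel p) (fun s => C * exp (- (s / 2))) (0 - (- 2 * C * exp (- (0 / 2))))).
  - apply ends_in_half_line.
  - intros; apply continuous_gamma_kernel; assumption.
  - intros x Hx. unfold norm; simpl; unfold abs; simpl.
    rewrite Rabs_pos_eq by apply Rlt_le, gamma_kernel_pos. apply gamma_kernel_le; assumption.
  - apply (is_RInt_gen_FTC (at_right 0) (Rbar_locally p_infty) (fun x => 0 < x) (fun s => - 2 * C * exp (- (s / 2)))).
    + apply ends_in_half_line.
    + intros x _. auto_derive; [exact I|]. unfold Rdiv. field.
    + intros x _. apply (ex_derive_continuous (fun s => C * exp (- (s / 2)))). auto_derive. exact I.
    + apply (continuous_at_right (fun s => - 2 * C * exp (- (s / 2)))), (ex_derive_continuous (fun s => - 2 * C * exp (- (s / 2)))).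
      auto_derive. exact I.
    + apply filterlim_exp_half_p_infty.
Qed.

Lemma is_derive_gamma_kernel (p s : R) : 0 < s ->
  is_derive (gamma_kernel p) s (p * gamma_kernel (p - 1) s - gamma_kernel p s).
Proof.
  intros Hs. unfold gamma_kernel.
  assert (H := is_derive_mult (fun s => Rpower s p) (fun s => exp (- s)) s _ _
    (is_derive_Rpower s p Hs) (is_derive_exp_neg s) Rmult_comm).
  unfold plus, mult in H; simpl in H.
  replace (p * (Rpower s (p - 1) * exp (- s)) - Rpower s p * exp (- s))
    with (p * Rpower s (p - 1) * exp (- s) + Rpower s p * - exp (- s)) by ring.
  exact H.
Qed.

(** Integration by parts; both boundary terms vanish because 0 < p. One step carries convergence
    from positive exponents down to exponents in (-1, 0], and comparing values gives the functional
    equation of Gamma. *)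
Lemma gamma_kernel_step (p l : R) : 0 < p ->
  is_RInt_gen (gamma_kernel p) (at_right 0) (Rbar_locally p_infty) l ->
  is_RInt_gen (gamma_kernel (p - 1)) (at_right 0) (Rbar_locally p_infty) (l / p).
Proof.
  intros Hp Hl.
  assert (H : is_RInt_gen (fun s => p * gamma_kernel (p - 1) s - gamma_kernel p s) (at_right 0) (Rbar_locally p_infty) (0 - 0)).
  { apply (is_RInt_gen_FTC (at_right 0) (Rbar_locally p_infty) (fun x => 0 < x) (gamma_kernel p)).
    - apply ends_in_half_line.
    - intros; apply is_derive_gamma_kernel; assumption.
    - intros x Hx. apply (continuous_minus (fun s => p * gamma_kernel (p - 1) s)).
      + apply (continuous_scal_r p (gamma_kernel (p - 1))), continuous_gamma_kernel, Hx.
      + apply continuous_gamma_kernel, Hx.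
    - apply gamma_kernel_lim_0, Hp.
    - apply gamma_kernel_lim_infty, Hp. }
  assert (H1 := is_RInt_gen_scal _ (/ p) _ (is_RInt_gen_plus _ _ _ _ H Hl)).
  replace (l / p) with (scal (/ p) (plus (0 - 0) l)).
  2:{ Rsimp. field; lra. }
  refine (is_RInt_gen_ext_in (at_right 0) (Rbar_locally p_infty) (fun x => 0 < x) _ _ _ _ _ H1).
  - apply ends_in_half_line.
  - intros x _. Rsimp. field; lra.
Qed.

(** [Gamma] is an [RInt_gen], hence defined even where the integral diverges. Convergence is
    obtained at exponent x and lowered by one. *)
Lemma is_RInt_gen_Gamma (x : R) : 0 < x ->
  is_RInt_gen (gamma_kernel (x - 1)) (at_right 0) (Rbar_locally p_infty) (Gamma x).
Proof.
  intros Hx. destruct (ex_gamma_kernel_pos x Hx) as [l Hl].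
  apply (gamma_kernel_step _ _ Hx) in Hl.
  replace (Gamma x) with (l / x); [exact Hl|].
  symmetry. apply (is_RInt_gen_unique (V := R_CompleteNormedModule) (gamma_kernel (x - 1))), Hl.
Qed.

Lemma Gamma_succ (x : R) : 0 < x -> Gamma (x + 1) = x * Gamma x.
Proof.
  intros Hx. assert (H := is_RInt_gen_Gamma (x + 1) ltac:(lra)).
  replace (x + 1 - 1) with x in H by ring.
  apply (gamma_kernel_step _ _ Hx) in H.
  rewrite (is_RInt_gen_uniq _ _ _ _ _ _ _ (is_RInt_gen_Gamma x Hx) H). field; lra.
Qed.

Lemma RInt_le_is_RInt_gen (Fa Fb : (R -> Prop) -> Prop)
  (PFa : ProperFilter Fa) (PFb : ProperFilter Fb) (D : R -> Prop) (f : R -> R) (l a b : R) :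
  ends_in Fa Fb D -> (forall x, D x -> 0 <= f x) -> (forall x, D x -> continuous f x) ->
  Fa (fun x => x <= a) -> Fb (fun x => b <= x) -> a <= b ->
  is_RInt_gen f Fa Fb l -> RInt f a b <= l.
Proof.
  intros HD Hf Hc Ha Hb Hab Hl. apply Rnot_lt_le; intros Hlt.
  assert (He : 0 < RInt f a b - l) by lra.
  assert (H1 := is_RInt_gen_RInt_dist (V := R_CompleteNormedModule) Fa Fb f l (mkposreal _ He) _ _ Hl).
  unfold ends_in in HD.
  assert (H2 : filter_prod Fa Fb (fun ab => fst ab <= a /\ b <= snd ab)).
  { eexists; [exact Ha|exact Hb|]. simpl; auto. }
  destruct (filter_ex _ (filter_and _ _ (filter_and _ _ HD H2) H1)) as [[a' b'] [[[L Dl] [La Lb]] [E B]]].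
  simpl in *.
  assert (ex : forall u v, a' <= u -> u <= v -> v <= b' -> ex_RInt f u v).
  { intros u v Hu Huv Hv. apply (ex_RInt_continuous (V := R_CompleteNormedModule)). rewrite Rmin_left, Rmax_right by lra.
    intros z Hz. apply Hc, Dl; lra. }
  rewrite <- (RInt_Chasles f a' a b'), <- (RInt_Chasles f a b b') in B by (apply ex; lra).
  assert (0 <= RInt f a' a) by (apply RInt_ge_0; [lra|apply ex; lra|intros; apply Hf, Dl; lra]).
  assert (0 <= RInt f b b') by (apply RInt_ge_0; [lra|apply ex; lra|intros; apply Hf, Dl; lra]).
  unball. apply Rabs_def2 in B. lra.
Qed.

Lemma at_right_le (x a : R) : x < a -> at_right x (fun y => y <= a).
Proof.
  intros H. exists (mkposreal (a - x) ltac:(lra)); intros y Hy _. unball. apply Rabs_def2 in Hy; lra.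
Qed.

Lemma at_left_ge (x a : R) : a < x -> at_left x (fun y => a <= y).
Proof.
  intros H. exists (mkposreal (x - a) ltac:(lra)); intros y Hy _. unball. apply Rabs_def2 in Hy; lra.
Qed.

(** Only the part of the integral over [M, M + 1] is kept. Since M is free, Gamma outgrows every
    geometric progression, which is all that the convergence of the Mittag-Leffler series needs. *)
Lemma Gamma_ge (M x : R) : 0 < M -> 1 <= x -> Rpower M (x - 1) * exp (- (M + 1)) <= Gamma x.
Proof.
  intros HM Hx.
  apply Rle_trans with (RInt (gamma_kernel (x - 1)) M (M + 1)).
  - replace (Rpower M (x - 1) * exp (- (M + 1))) with
      (RInt (fun _ => Rpower M (x - 1) * exp (- (M + 1))) M (M + 1)).
    2:{ rewrite RInt_const. Rsimp. ring. }
    apply RInt_le; [lra|apply ex_RInt_const| |].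
    + apply (ex_RInt_continuous (V := R_CompleteNormedModule)). rewrite Rmin_left, Rmax_right by lra.
      intros z Hz. apply continuous_gamma_kernel; lra.
    + intros s Hs. unfold gamma_kernel.
      apply Rmult_le_compat; try (apply Rlt_le, exp_pos).
      * apply Rle_Rpower_l; lra.
      * left. apply exp_increasing; lra.
  - apply (RInt_le_is_RInt_gen (at_right 0) (Rbar_locally p_infty) _ _ (fun x => 0 < x) (gamma_kernel (x - 1))).
    + apply ends_in_half_line.
    + intros; apply Rlt_le, gamma_kernel_pos.
    + intros; apply continuous_gamma_kernel; assumption.
    + apply at_right_le; lra.
    + exists (M + 1); intros; lra.
    + lra.
    + apply is_RInt_gen_Gamma; lra.
Qed.

Lemma Gamma_pos (x : R) : 0 < x -> 0 < Gamma x.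
Proof.
  intros Hx. apply Rmult_lt_reg_l with x; [exact Hx|]. rewrite Rmult_0_r, <- Gamma_succ by exact Hx.
  eapply Rlt_le_trans; [|apply (Gamma_ge 1); lra].
  apply Rmult_lt_0_compat; apply exp_pos.
Qed.

(** * Convolution and the Beta integral *)

Lemma is_derive_RInt_upper (f : R -> R) (a x : R) :
  (forall y, continuous f y) -> is_derive (fun y => RInt f a y) x (f x).
Proof.
  intros Hf. apply (is_derive_RInt f (fun y => RInt f a y) a x); [|apply Hf].
  apply filter_forall. intros y. apply (RInt_correct f), (ex_RInt_continuous (V := R_CompleteNormedModule)).
  intros; apply Hf.
Qed.

(* Differentiating in the endpoint [x] is Fubini on the triangle
   [0 <= t <= s <= x]. *)
Lemma is_derive_convolution (a b : R -> R) (x : R) :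
  (forall y, continuous a y) -> (forall y, continuous b y) ->
  is_derive (fun z => RInt (fun t => b t * RInt a 0 (z - t)) 0 z) x
    (RInt (fun t => b t * a (x - t)) 0 x).
Proof.
  intros Ha Hb.
  set (f := fun z t => b t * RInt a 0 (z - t)).
  assert (HD : forall u v, is_derive (fun z => f z v) u (b v * a (u - v))).
  { intros u v. unfold f. apply (is_derive_scal (fun z => RInt a 0 (z - v)) u (b v)).
    replace (a (u - v)) with (scal 1 (a (u - v))) by (Rsimp; ring).
    apply (is_derive_comp (fun y => RInt a 0 y) (fun z => z - v)).
    - apply is_derive_RInt_upper, Ha.
    - auto_derive; [exact I|ring]. }
  assert (Hf : forall z t, continuous (f z) t).
  { intros z t. apply (continuous_mult b (fun t => RInt a 0 (z - t))); [apply Hb|].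
    apply (continuous_comp (fun t => z - t) (fun y => RInt a 0 y)).
    - apply (continuous_minus (fun _ => z) (fun t => t)); [apply continuous_const|apply continuous_id].
    - eapply continuous_of_derive, is_derive_RInt_upper, Ha. }
  assert (ex : forall z u v, ex_RInt (f z) u v).
  { intros. apply (ex_RInt_continuous (V := R_CompleteNormedModule)). intros; apply Hf. }
  assert (C2 : forall u v, continuity_2d_pt (fun u v => Derive (fun z => f z v) u) u v).
  { intros u v. apply continuity_2d_pt_ext with (fun u v => b v * a (u - v)).
    - intros; symmetry. apply is_derive_unique, HD.
    - apply continuity_2d_pt_mult.
      + apply (continuity_1d_2d_pt_comp b (fun _ v => v)).
        * apply continuity_pt_filterlim, Hb.
        * apply continuity_2d_pt_id2.
      + apply (continuity_1d_2d_pt_comp a (fun u v => u - v)).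
        * apply continuity_pt_filterlim, Ha.
        * apply continuity_2d_pt_minus; [apply continuity_2d_pt_id1|apply continuity_2d_pt_id2]. }
  assert (H := is_derive_RInt_param_bound_comp_aux3 f 0 (fun z => z) x 1).
  replace (RInt (fun t => b t * a (x - t)) 0 x) with
    (RInt (fun t => Derive (fun u => f u t) x) 0 x + f x x * 1).
  - apply H; clear H.
    + apply filter_forall; intros; apply ex.
    + exists (mkposreal 1 Rlt_0_1). apply filter_forall; intros; apply ex.
    + apply (is_derive_id x).
    + exists (mkposreal 1 Rlt_0_1). apply filter_forall; intros y t _. eexists; apply HD.
    + intros; apply C2.
    + exists (mkposreal 1 Rlt_0_1). intros; apply C2.
    + apply continuity_pt_filterlim, Hf.
  - unfold f at 2. rewrite Rminus_diag_eq, RInt_point by reflexivity.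
    unfold zero; simpl. rewrite Rmult_0_r, Rmult_0_l, Rplus_0_r.
    apply RInt_ext. intros; apply is_derive_unique, HD.
Qed.

Lemma is_RInt_gen_continuous_ext (f g : R -> R) (t : R) : 0 < t ->
  (forall x, continuous g x) -> (forall x, 0 < x < t -> g x = f x) ->
  is_RInt_gen f (at_right 0) (at_left t) (RInt g 0 t).
Proof.
  intros Ht Hg Hfg.
  refine (is_RInt_gen_ext_interval g f _ _ Ht Hfg _).
  replace (RInt g 0 t) with (RInt g 0 t - RInt g 0 0).
  2:{ rewrite RInt_point. unfold zero; simpl. ring. }
  assert (Hd : forall x, continuous (fun y => RInt g 0 y) x).
  { intros x. eapply continuous_of_derive, is_derive_RInt_upper, Hg. }
  apply (is_RInt_gen_FTC (at_right 0) (at_left t) (fun x => 0 < x < t) (fun y => RInt g 0 y)).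
  - apply ends_in_interval, Ht.
  - intros; apply is_derive_RInt_upper, Hg.
  - intros; apply Hg.
  - apply (continuous_at_right (fun y => RInt g 0 y)), Hd.
  - apply (continuous_at_left (fun y => RInt g 0 y)), Hd.
Qed.

Lemma filterlim_RInt_gen_infty (f g : R -> R) (l : R) :
  (forall x, continuous g x) -> (forall x, 0 < x -> g x = f x) ->
  is_RInt_gen f (at_right 0) (Rbar_locally p_infty) l ->
  filterlim (fun x => RInt g 0 x) (Rbar_locally p_infty) (locally l).
Proof.
  intros Hg Hfg Hl.
  assert (Hl' : is_RInt_gen g (at_right 0) (Rbar_locally p_infty) l).
  { refine (is_RInt_gen_ext_in (at_right 0) (Rbar_locally p_infty) (fun x => 0 < x) f g _ ends_in_half_line _ Hl).
    intros; symmetry; auto. }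
  apply filterlim_locally; intros eps.
  assert (He : 0 < eps / 2) by (destruct eps; simpl; lra).
  assert (H := is_RInt_gen_RInt_dist (V := R_CompleteNormedModule) _ _ g l (mkposreal _ He) _ _ Hl').
  destruct H as [Q P HQ HP H]; simpl in H.
  assert (Hc : continuous (fun y => RInt g 0 y) 0) by (eapply continuous_of_derive, is_derive_RInt_upper, Hg).
  apply (continuous_at_right (fun y => RInt g 0 y)) in Hc.
  assert (Hc' := proj1 (filterlim_locally _ _) Hc (mkposreal _ He)).
  destruct (filter_ex _ (filter_and _ _ HQ Hc')) as [a [Qa Ba]]; simpl in *.
  destruct HP as [M HM]. exists M. intros b Hb. assert (Pb := HM b Hb).
  destruct (H a b Qa Pb) as [_ B]. unball. cbv beta in *.
  rewrite <- (RInt_Chasles g 0 a b) by (apply (ex_RInt_continuous (V := R_CompleteNormedModule)); intros; apply Hg).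
  rewrite RInt_point in Ba. unfold zero, plus in *; simpl in *.
  apply Rabs_def2 in Ba. apply Rabs_def2 in B. apply Rabs_def1; lra.
Qed.

Lemma ex_RInt_cont (f : R -> R) (a b : R) : (forall x, continuous f x) -> ex_RInt f a b.
Proof. intros H. apply (ex_RInt_continuous (V := R_CompleteNormedModule)). intros; apply H. Qed.

Section BetaFubini.
Variables p q : R.
Hypotheses (Hp : 0 < p) (Hq : 0 < q).

(** The Gamma integrand written with [rpow]: for 0 < r it is continuous on the whole line, so the
    convolution below consists of proper integrals. *)
Let gk (r s : R) : R := rpow s r * exp (- s).

Local Lemma gk_cont r s : 0 < r -> continuous (gk r) s.
Proof.
  intros Hr. apply (continuous_mult (fun s => rpow s r) (fun s => exp (- s))).
  - apply continuous_rpow, Hr.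
  - apply (ex_derive_continuous (fun s => exp (- s))). auto_derive. exact I.
Qed.

Local Lemma gk_ex r a b : 0 < r -> ex_RInt (gk r) a b.
Proof. intros Hr. apply ex_RInt_cont. intros; apply gk_cont, Hr. Qed.

Local Lemma gk_ge0 r s : 0 <= gk r s.
Proof. apply Rmult_le_pos; [apply rpow_ge_0|apply Rlt_le, exp_pos]. Qed.

Local Lemma gk_int_lim r : 0 < r -> filterlim (fun x => RInt (gk r) 0 x) (Rbar_locally p_infty) (locally (Gamma (r + 1))).
Proof.
  intros Hr. apply filterlim_RInt_gen_infty with (gamma_kernel r).
  - intros; apply gk_cont, Hr.
  - intros; unfold gk, gamma_kernel. rewrite rpow_pos by assumption. reflexivity.
  - replace r with (r + 1 - 1) at 1 by ring. apply is_RInt_gen_Gamma; lra.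
Qed.

Let B (t : R) : R := RInt (fun s => rpow (t - s) p * rpow s q) 0 t.

(** The two exponentials multiply to exp (- t), and the substitution s -> t s pulls out the power
    t^(p + q + 1). *)
Local Lemma beta_scale t : 0 <= t -> RInt (fun s => gk q s * gk p (t - s)) 0 t = B 1 * gk (p + q + 1) t.
Proof.
  intros [Ht|<-].
  2:{ rewrite RInt_point. unfold gk at 1. rewrite rpow_neg by lra. unfold zero; simpl; ring. }
  replace (RInt (fun s => gk q s * gk p (t - s)) 0 t) with
    (RInt (fun s => scal t (gk q (t * s + 0) * gk p (t - (t * s + 0)))) 0 1).
  2:{ assert (E : RInt (fun s => gk q s * gk p (t - s)) 0 t = RInt (fun s => gk q s * gk p (t - s)) (t * 0 + 0) (t * 1 + 0)) by (f_equal; ring).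
      rewrite E. apply (RInt_comp_lin (V := R_CompleteNormedModule) (fun s => gk q s * gk p (t - s)) t 0 0 1).
      apply ex_RInt_cont. intros x. apply (continuous_mult (gk q) (fun s => gk p (t - s))).
      - apply gk_cont, Hq.
      - apply (continuous_comp (fun s => t - s) (gk p)).
        + apply (continuous_minus (fun _ => t) (fun s => s)); [apply continuous_const|apply continuous_id].
        + apply gk_cont, Hp. }
  unfold B. rewrite Rmult_comm.
  change (RInt (fun s => scal t (gk q (t * s + 0) * gk p (t - (t * s + 0)))) 0 1 =
    scal (gk (p + q + 1) t) (RInt (fun s => rpow (1 - s) p * rpow s q) 0 1)).
  rewrite <- (RInt_scal (fun s => rpow (1 - s) p * rpow s q)).
  2:{ apply ex_RInt_cont. intros x. apply (continuous_mult (fun s => rpow (1 - s) p) (fun s => rpow s q)).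
      - apply (continuous_comp (fun s => 1 - s) (fun s => rpow s p)).
        + apply (continuous_minus (fun _ => 1) (fun s => s)); [apply continuous_const|apply continuous_id].
        + apply continuous_rpow, Hp.
      - apply continuous_rpow, Hq. }
  apply RInt_ext. rewrite Rmin_left, Rmax_right by lra. intros s Hs.
  Rsimp. rewrite Rplus_0_r. unfold gk.
  rewrite !rpow_pos by (try nra; lra).
  replace (t - t * s) with (t * (1 - s)) by ring.
  rewrite <- !Rpower_mult_distr by lra.
  replace (exp (- t)) with (exp (- (t * s)) * exp (- (t * (1 - s)))).
  2:{ rewrite <- exp_plus. f_equal. ring. }
  rewrite !Rpower_plus, Rpower_1 by lra. ring.
Qed.

(** [L x] is the integral of the product of two Gamma integrands over the triangle with legs x. Its
    derivative is a convolution, evaluated by [beta_scale], which gives the limit on the left. The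
    triangle lies between the squares of sides x / 2 and x, which gives the product of Gammas. *)
Lemma Beta_Gamma_cont : B 1 * Gamma (p + q + 2) = Gamma (p + 1) * Gamma (q + 1).
Proof.
  set (L := fun x => RInt (fun t => gk q t * RInt (gk p) 0 (x - t)) 0 x).
  assert (Hpq : 0 < p + q + 1) by lra.
  assert (HL : forall x, 0 <= x -> L x = B 1 * RInt (gk (p + q + 1)) 0 x).
  { intros x Hx.
    assert (H := is_RInt_derive L (fun x => RInt (fun t => gk q t * gk p (x - t)) 0 x) 0 x).
    assert (H0 : is_RInt (fun y => B 1 * gk (p + q + 1) y) 0 x (minus (L x) (L 0))).
    { apply (is_RInt_derive (V := R_CompleteNormedModule) L (fun y => B 1 * gk (p + q + 1) y) 0 x);
      rewrite Rmin_left, Rmax_right by lra; intros y Hy.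
      - rewrite <- beta_scale by lra. apply (is_derive_convolution (gk p) (gk q) y); intros; apply gk_cont; assumption.
      - apply (continuous_scal_r (B 1) (gk (p + q + 1))), gk_cont, Hpq. }
    apply (is_RInt_unique (V := R_CompleteNormedModule)) in H0.
    change (RInt (fun y => scal (B 1) (gk (p + q + 1) y)) 0 x = L x - L 0) in H0.
    rewrite (RInt_scal (gk (p + q + 1))) in H0.
    2:{ apply gk_ex, Hpq. }
    assert (L0 : L 0 = 0) by (unfold L; rewrite RInt_point; reflexivity).
    rewrite L0, Rminus_0_r in H0. rewrite <- H0. reflexivity. }
  assert (Hmono : forall r a b, 0 < r -> a <= b -> RInt (gk r) 0 a <= RInt (gk r) 0 b).
  { intros r a b Hr Hab. rewrite <- (RInt_Chasles (gk r) 0 a b) by (apply gk_ex, Hr).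
    assert (0 <= RInt (gk r) a b).
    { apply RInt_ge_0; [lra|apply gk_ex, Hr|intros; apply gk_ge0]. }
    unfold plus; simpl; lra. }
  assert (HcL : forall z t, continuous (fun t => gk q t * RInt (gk p) 0 (z - t)) t).
  { intros z t. apply (continuous_mult (gk q) (fun t => RInt (gk p) 0 (z - t))); [apply gk_cont, Hq|].
    apply (continuous_comp (fun t => z - t) (fun y => RInt (gk p) 0 y)).
    - apply (continuous_minus (fun _ => z) (fun t => t)); [apply continuous_const|apply continuous_id].
    - eapply continuous_of_derive, is_derive_RInt_upper. intros; apply gk_cont, Hp. }
  assert (Hub : forall x, 0 <= x -> L x <= RInt (gk p) 0 x * RInt (gk q) 0 x).
  { intros x Hx. unfold L.
    change (RInt (gk p) 0 x * RInt (gk q) 0 x) with (scal (RInt (gk p) 0 x) (RInt (gk q) 0 x)).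
    rewrite <- (RInt_scal (gk q)) by (apply gk_ex, Hq).
    apply RInt_le; [lra|apply ex_RInt_cont; intros; apply HcL| |].
    - apply ex_RInt_cont; intros. apply (continuous_scal_r (RInt (gk p) 0 x) (gk q)), gk_cont, Hq.
    - intros t Ht. Rsimp. rewrite Rmult_comm.
      apply Rmult_le_compat_r; [apply gk_ge0|]. apply Hmono; lra. }
  assert (Hlb : forall x, 0 <= x -> RInt (gk p) 0 (x / 2) * RInt (gk q) 0 (x / 2) <= L x).
  { intros x Hx. unfold L.
    rewrite <- (RInt_Chasles (fun t => gk q t * RInt (gk p) 0 (x - t)) 0 (x / 2) x) by (apply ex_RInt_cont; intros; apply HcL).
    assert (0 <= RInt (fun t => gk q t * RInt (gk p) 0 (x - t)) (x / 2) x).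
    { apply RInt_ge_0; [lra|apply ex_RInt_cont; intros; apply HcL|].
      intros t Ht. apply Rmult_le_pos; [apply gk_ge0|].
      apply RInt_ge_0; [lra|apply gk_ex, Hp|intros; apply gk_ge0]. }
    assert (RInt (gk p) 0 (x / 2) * RInt (gk q) 0 (x / 2) <= RInt (fun t => gk q t * RInt (gk p) 0 (x - t)) 0 (x / 2)).
    { change (RInt (gk p) 0 (x / 2) * RInt (gk q) 0 (x / 2)) with (scal (RInt (gk p) 0 (x / 2)) (RInt (gk q) 0 (x / 2))).
      rewrite <- (RInt_scal (gk q)) by (apply gk_ex, Hq).
      apply RInt_le; [lra| |apply ex_RInt_cont; intros; apply HcL|].
      - apply ex_RInt_cont; intros. apply (continuous_scal_r (RInt (gk p) 0 (x / 2)) (gk q)), gk_cont, Hq.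
      - intros t Ht. Rsimp. rewrite Rmult_comm.
        apply Rmult_le_compat_l; [apply gk_ge0|]. apply Hmono; lra. }
    unfold plus; simpl; lra. }
  assert (Lim1 : filterlim L (Rbar_locally p_infty) (locally (B 1 * Gamma (p + q + 2)))).
  { apply filterlim_ext_loc with (fun x => B 1 * RInt (gk (p + q + 1)) 0 x).
    - exists 0. intros; symmetry; apply HL; lra.
    - apply (filterlim_comp _ _ _ (fun x => RInt (gk (p + q + 1)) 0 x) (fun y => B 1 * y) _ (locally (Gamma (p + q + 2)))).
      + replace (p + q + 2) with (p + q + 1 + 1) by ring. apply gk_int_lim, Hpq.
      + apply (continuous_scal_r (B 1) (fun y : R => y)), continuous_id. }
  assert (Hprod : filterlim (fun x => RInt (gk p) 0 x * RInt (gk q) 0 x) (Rbar_locally p_infty) (locally (Gamma (p + 1) * Gamma (q + 1)))).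
  { apply (filterlim_Rmult (Rbar_locally p_infty)).
    - apply gk_int_lim, Hp.
    - apply gk_int_lim, Hq. }
  assert (Lim2 : filterlim L (Rbar_locally p_infty) (locally (Gamma (p + 1) * Gamma (q + 1)))).
  { apply (filterlim_le_le (fun x => RInt (gk p) 0 (x / 2) * RInt (gk q) 0 (x / 2)) L
      (fun x => RInt (gk p) 0 x * RInt (gk q) 0 x) (F := Rbar_locally p_infty) (Gamma (p + 1) * Gamma (q + 1))).
    - exists 0. intros x Hx. split; [apply Hlb|apply Hub]; lra.
    - apply (filterlim_comp _ _ _ (fun x => x / 2) (fun x => RInt (gk p) 0 x * RInt (gk q) 0 x) _ (Rbar_locally p_infty)).
      + intros P [M HM]. exists (2 * M). intros x Hx. apply HM. lra.
      + exact Hprod.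
    - exact Hprod. }
  exact (filterlim_locally_unique (V := R_NormedModule) L _ _ Lim1 Lim2).
Qed.

Lemma beta_integral_cont (t : R) : 0 < t ->
  is_RInt_gen (fun s => Rpower (t - s) p * Rpower s q) (at_right 0) (at_left t)
    (Rpower t (p + q + 1) * (Gamma (p + 1) * Gamma (q + 1) / Gamma (p + q + 2))).
Proof.
  intros Ht.
  assert (Hc : forall x, continuous (fun s => rpow (t - s) p * rpow s q) x).
  { intros x. apply (continuous_mult (fun s => rpow (t - s) p) (fun s => rpow s q)).
    - apply (continuous_comp (fun s => t - s) (fun s => rpow s p)).
      + apply (continuous_minus (fun _ => t) (fun s => s)); [apply continuous_const|apply continuous_id].
      + apply continuous_rpow, Hp.
    - apply continuous_rpow, Hq. }
  replace (Rpower t (p + q + 1) * (Gamma (p + 1) * Gamma (q + 1) / Gamma (p + q + 2))) with (B t).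
  { apply (is_RInt_gen_continuous_ext _ (fun s => rpow (t - s) p * rpow s q) t Ht Hc).
    intros s Hs. rewrite !rpow_pos by lra. reflexivity. }
  assert (HG : 0 < Gamma (p + q + 2)) by (apply Gamma_pos; lra).
  rewrite <- Beta_Gamma_cont.
  replace (B 1 * Gamma (p + q + 2) / Gamma (p + q + 2)) with (B 1) by (field; lra).
  assert (H := beta_scale t (Rlt_le _ _ Ht)).
  apply Rmult_eq_reg_l with (exp (- t)); [|apply Rgt_not_eq, exp_pos].
  replace (exp (- t) * (Rpower t (p + q + 1) * B 1)) with (B 1 * gk (p + q + 1) t).
  2:{ unfold gk. rewrite rpow_pos by lra. ring. }
  rewrite <- H. change (scal (exp (- t)) (RInt (fun s => rpow (t - s) p * rpow s q) 0 t) = RInt (fun s => gk q s * gk p (t - s)) 0 t).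
  rewrite <- (RInt_scal (fun s => rpow (t - s) p * rpow s q)) by (apply ex_RInt_cont, Hc).
  apply RInt_ext. intros s _. Rsimp. unfold gk.
  replace (- t) with (- s + - (t - s)) by ring. rewrite exp_plus. ring.
Qed.

End BetaFubini.

Definition beta_kernel (t y x s : R) : R := Rpower (t - s) y * Rpower s x.

Lemma beta_kernel_pos t y x s : 0 < beta_kernel t y x s.
Proof. apply Rmult_lt_0_compat; apply exp_pos. Qed.

Lemma is_derive_Rpower_minus (t y s : R) : s < t ->
  is_derive (fun s => Rpower (t - s) y) s (- (y * Rpower (t - s) (y - 1))).
Proof.
  intros Hs.
  replace (- (y * Rpower (t - s) (y - 1))) with (scal (-1) (y * Rpower (t - s) (y - 1)))
    by (Rsimp; ring).
  apply (is_derive_comp (fun z => Rpower z y) (fun s => t - s)).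
  - apply is_derive_Rpower; lra.
  - auto_derive; [exact I|ring].
Qed.

Lemma is_derive_beta_kernel (t y x s : R) : 0 < s < t ->
  is_derive (beta_kernel t y x) s (x * beta_kernel t y (x - 1) s - y * beta_kernel t (y - 1) x s).
Proof.
  intros Hs. unfold beta_kernel.
  assert (H := is_derive_mult (fun s => Rpower (t - s) y) (fun s => Rpower s x) s _ _
    (is_derive_Rpower_minus t y s (proj2 Hs)) (is_derive_Rpower s x (proj1 Hs)) Rmult_comm).
  unfold plus, mult in H; simpl in H.
  replace (x * (Rpower (t - s) y * Rpower s (x - 1)) - y * (Rpower (t - s) (y - 1) * Rpower s x))
    with (- (y * Rpower (t - s) (y - 1)) * Rpower s x + Rpower (t - s) y * (x * Rpower s (x - 1))) by ring.
  exact H.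
Qed.

Lemma continuous_beta_kernel (t y x s : R) : 0 < s < t -> continuous (beta_kernel t y x) s.
Proof. intros Hs. eapply continuous_of_derive, is_derive_beta_kernel, Hs. Qed.

Lemma filterlim_Rpower_left (t p : R) : 0 < p -> filterlim (fun s => Rpower (t - s) p) (at_left t) (locally 0).
Proof.
  intros Hp. apply (filterlim_comp _ _ _ (fun s => t - s) (fun s => Rpower s p) _ (at_right 0)).
  - intros P [e He]. exists e. intros y Hy Hyt. apply He; [|lra].
    unball. replace (t - y + - 0) with (- (y + - t)) by ring. rewrite Rabs_Ropp; exact Hy.
  - apply filterlim_Rpower_0, Hp.
Qed.

Lemma beta_kernel_lim_0 (t y x : R) : 0 < t -> 0 < x -> filterlim (beta_kernel t y x) (at_right 0) (locally 0).
Proof.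
  intros Ht Hx. unfold beta_kernel. replace 0 with (Rpower (t - 0) y * 0) at 2 by ring.
  apply (filterlim_Rmult (at_right 0)).
  - apply (continuous_at_right (fun s => Rpower (t - s) y)).
    eapply continuous_of_derive, is_derive_Rpower_minus, Ht.
  - apply filterlim_Rpower_0, Hx.
Qed.

Lemma beta_kernel_lim_t (t y x : R) : 0 < t -> 0 < y -> filterlim (beta_kernel t y x) (at_left t) (locally 0).
Proof.
  intros Ht Hy. unfold beta_kernel. replace 0 with (0 * Rpower t x) by ring.
  apply (filterlim_Rmult (at_left t)).
  - apply filterlim_Rpower_left, Hy.
  - apply (continuous_at_left (fun s => Rpower s x)), continuous_Rpower, Ht.
Qed.

Lemma beta_kernel_parts (t y x : R) : 0 < t -> 0 < y -> 0 < x ->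
  is_RInt_gen (fun s => x * beta_kernel t y (x - 1) s - y * beta_kernel t (y - 1) x s) (at_right 0) (at_left t) 0.
Proof.
  intros Ht Hy Hx. replace 0 with (0 - 0) at 2 by ring.
  apply (is_RInt_gen_FTC (at_right 0) (at_left t) (fun s => 0 < s < t) (beta_kernel t y x)).
  - apply ends_in_interval, Ht.
  - intros; apply is_derive_beta_kernel; assumption.
  - intros s Hs. apply (continuous_minus (fun s => x * beta_kernel t y (x - 1) s)).
    + apply (continuous_scal_r x (beta_kernel t y (x - 1))), continuous_beta_kernel, Hs.
    + apply (continuous_scal_r y (beta_kernel t (y - 1) x)), continuous_beta_kernel, Hs.
  - apply beta_kernel_lim_0; assumption.
  - apply beta_kernel_lim_t; assumption.
Qed.

Lemma beta_kernel_split (t y x s : R) : 0 < s < t ->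
  beta_kernel t y (x - 1) s + beta_kernel t (y - 1) x s = t * beta_kernel t (y - 1) (x - 1) s.
Proof.
  intros Hs. unfold beta_kernel.
  replace (Rpower (t - s) y) with (Rpower (t - s) (y - 1) * (t - s)).
  2:{ rewrite <- (Rpower_1 (t - s)) at 2 by lra. rewrite <- Rpower_plus. f_equal; ring. }
  replace (Rpower s x) with (Rpower s (x - 1) * s).
  2:{ rewrite <- (Rpower_1 s) at 2 by lra. rewrite <- Rpower_plus. f_equal; ring. }
  ring.
Qed.

(** [beta_kernel_parts] and (t - s) + s = t are two linear relations between the integrals with
    exponents (y, x - 1), (y - 1, x) and (y - 1, x - 1). Eliminating the second integral lowers the
    exponent of t - s. *)
Lemma beta_kernel_step_y (t y x l : R) : 0 < t -> 0 < y -> 0 < x ->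
  is_RInt_gen (beta_kernel t y (x - 1)) (at_right 0) (at_left t) l ->
  is_RInt_gen (beta_kernel t (y - 1) (x - 1)) (at_right 0) (at_left t) (l * (x + y) / (y * t)).
Proof.
  intros Ht Hy Hx Hl.
  assert (H0 := beta_kernel_parts t y x Ht Hy Hx).
  assert (H1 := is_RInt_gen_minus _ _ _ _ (is_RInt_gen_scal _ ((x + y) / (y * t)) _ Hl)
     (is_RInt_gen_scal _ (/ (y * t)) _ H0)).
  replace (l * (x + y) / (y * t)) with (minus (scal ((x + y) / (y * t)) l) (scal (/ (y * t)) 0)).
  2:{ Rsimp. field; lra. }
  refine (is_RInt_gen_ext_interval _ _ _ _ Ht _ H1).
  intros s Hs. assert (E := beta_kernel_split t y x s Hs).
  apply Rmult_eq_reg_l with t; [|lra]. rewrite <- E.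
  Rsimp. field; lra.
Qed.

Lemma beta_kernel_step_x (t y x l : R) : 0 < t -> 0 < y -> 0 < x ->
  is_RInt_gen (beta_kernel t (y - 1) x) (at_right 0) (at_left t) l ->
  is_RInt_gen (beta_kernel t (y - 1) (x - 1)) (at_right 0) (at_left t) (l * (x + y) / (x * t)).
Proof.
  intros Ht Hy Hx Hl.
  assert (H0 := beta_kernel_parts t y x Ht Hy Hx).
  assert (H1 := is_RInt_gen_plus _ _ _ _ (is_RInt_gen_scal _ ((x + y) / (x * t)) _ Hl)
     (is_RInt_gen_scal _ (/ (x * t)) _ H0)).
  replace (l * (x + y) / (x * t)) with (plus (scal ((x + y) / (x * t)) l) (scal (/ (x * t)) 0)).
  2:{ Rsimp. field; lra. }
  refine (is_RInt_gen_ext_interval _ _ _ _ Ht _ H1).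
  intros s Hs. assert (E := beta_kernel_split t y x s Hs).
  apply Rmult_eq_reg_l with t; [|lra]. rewrite <- E.
  Rsimp. field; lra.
Qed.

Lemma beta_integral (t y x : R) : 0 < t -> 0 < y -> 0 < x ->
  is_RInt_gen (beta_kernel t (y - 1) (x - 1)) (at_right 0) (at_left t)
    (Rpower t (x + y - 1) * (Gamma y * Gamma x / Gamma (x + y))).
Proof.
  intros Ht Hy Hx.
  assert (H := beta_integral_cont y x Hy Hx t Ht).
  change (fun s : R => Rpower (t - s) y * Rpower s x) with (beta_kernel t y x) in H.
  (* The known case has the positive exponents y and x; each is lowered by one, which reaches
     exponents down to -1, where the integral is improper. *)
  replace x with (x + 1 - 1) in H at 1 by ring.
  apply beta_kernel_step_y in H; [|lra..].
  replace (x + 1 - 1) with x in H by ring.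
  apply beta_kernel_step_x in H; [|lra..].
  replace (Rpower t (x + y - 1) * (Gamma y * Gamma x / Gamma (x + y))) with
   (Rpower t (y + x + 1) * (Gamma (y + 1) * Gamma (x + 1) / Gamma (y + x + 2)) *
       (x + 1 + y) / (y * t) * (x + y) / (x * t)); [exact H|].
  replace (y + x + 2) with (x + y + 1 + 1) by ring.
  rewrite !Gamma_succ by lra.
  replace (y + x + 1) with (x + y - 1 + 1 + 1) by ring.
  rewrite (Rpower_plus _ 1), (Rpower_plus _ 1), Rpower_1 by lra.
  assert (0 < Gamma (x + y)) by (apply Gamma_pos; lra).
  field. repeat split; lra.
Qed.

(** * Generalized power series and Mittag-Leffler kernels *)

Lemma ex_series_ext_R (a b : nat -> R) : (forall n, a n = b n) -> ex_series a -> ex_series b.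
Proof. intros H. apply ex_series_ext, H. Qed.

Definition entire (a : nat -> R) : Prop := CV_radius a = p_infty.

Lemma entire_lt (a : nat -> R) (x : R) : entire a -> Rbar_lt (Rabs x) (CV_radius a).
Proof. intros ->. exact I. Qed.

Lemma entire_of_ex (a : nat -> R) :
  (forall x, 0 < x -> ex_series (fun n => a n * x ^ n)) -> entire a.
Proof.
  intros H. unfold entire.
  assert (H0 := CV_radius_ge_0 a).
  destruct (CV_radius a) as [r| |] eqn:E; [exfalso|reflexivity|destruct H0].
  simpl in H0.
  apply (CV_disk_outside a (r + 1)).
  - rewrite E; simpl. rewrite Rabs_pos_eq; lra.
  - apply ex_series_lim_0, H. lra.
Qed.

Lemma entire_ex_abs (a : nat -> R) (x : R) : entire a -> ex_series (fun n => Rabs (a n * x ^ n)).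
Proof. intros H. apply CV_disk_inside, entire_lt, H. Qed.

Lemma entire_ex (a : nat -> R) (x : R) : entire a -> ex_series (fun n => a n * x ^ n).
Proof. intros H. apply ex_series_Rabs, entire_ex_abs, H. Qed.

Lemma entire_derive (a : nat -> R) : entire a -> entire (PS_derive a).
Proof. unfold entire; intros H. rewrite CV_radius_derive; exact H. Qed.

Lemma entire_mult (a b : nat -> R) : entire a -> entire b -> entire (PS_mult a b).
Proof.
  intros Ha Hb. apply entire_of_ex. intros x _. apply (proj1 (ex_pseries_R (PS_mult a b) x)).
  apply (ex_pseries_mult a b x); apply entire_lt; assumption.
Qed.

Lemma entire_pow (c : R) (a : nat -> R) : entire a -> entire (fun n => c ^ n * a n).
Proof.
  intros Ha. apply entire_of_ex. intros x _.
  apply (ex_series_ext_R (fun n => a n * (c * x) ^ n)); [intros n; rewrite Rpow_mult_distr; ring|].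
  apply entire_ex, Ha.
Qed.

Lemma PSeries_pow (c : R) (a : nat -> R) (x : R) : PSeries (fun n => c ^ n * a n) x = PSeries a (c * x).
Proof. apply Series_ext. intros n. rewrite Rpow_mult_distr. ring. Qed.

Lemma is_derive_entire (a : nat -> R) (x : R) : entire a -> is_derive (PSeries a) x (PSeries (PS_derive a) x).
Proof. intros Ha. apply is_derive_PSeries, entire_lt, Ha. Qed.

Lemma continuous_entire (a : nat -> R) (x : R) : entire a -> continuous (PSeries a) x.
Proof. intros Ha. eapply continuous_of_derive, is_derive_entire, Ha. Qed.

(** Coefficients of d x P'(x) + q P(x), where P has coefficients a. Differentiating t^q P(t^d) gives
    t^(q - 1) times this series at t^d. *)
Definition PS_shift (d q : R) (a : nat -> R) (n : nat) : R := (d * INR n + q) * a n.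

Lemma PS_shift_eq (d q : R) (a : nat -> R) (n : nat) :
  PS_shift d q a n = PS_plus (PS_scal d (PS_incr_1 (PS_derive a))) (PS_scal q a) n.
Proof.
  unfold PS_shift, PS_plus, PS_scal, PS_incr_1, PS_derive, plus, scal; simpl; unfold mult; simpl.
  destruct n; simpl; unfold zero; simpl; ring.
Qed.

Lemma PSeries_shift (d q : R) (a : nat -> R) (x : R) : entire a ->
  PSeries (PS_shift d q a) x = d * (x * PSeries (PS_derive a) x) + q * PSeries a x.
Proof.
  intros Ha. rewrite (PSeries_ext _ _ x (PS_shift_eq d q a)).
  rewrite PSeries_plus.
  - rewrite !PSeries_scal, PSeries_incr_1. reflexivity.
  - apply ex_pseries_scal; [apply Rmult_comm|].
    apply (ex_pseries_incr_1 (PS_derive a)), ex_pseries_R, entire_ex, entire_derive, Ha.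
  - apply ex_pseries_scal; [apply Rmult_comm|]. apply ex_pseries_R, entire_ex, Ha.
Qed.

Lemma entire_shift (d q : R) (a : nat -> R) : entire a -> entire (PS_shift d q a).
Proof.
  intros Ha. apply entire_of_ex. intros x _. apply (proj1 (ex_pseries_R (PS_shift d q a) x)).
  apply ex_pseries_ext with (PS_plus (PS_scal d (PS_incr_1 (PS_derive a))) (PS_scal q a)).
  - intros n; symmetry; apply PS_shift_eq.
  - apply ex_pseries_plus; (apply ex_pseries_scal; [apply Rmult_comm|]).
    + apply (ex_pseries_incr_1 (PS_derive a)), ex_pseries_R, entire_ex, entire_derive, Ha.
    + apply ex_pseries_R, entire_ex, Ha.
Qed.

(** Weierstrass test: the absolute series at X majorizes all others on [0, X], and its remainders
    serve as e. *)
Lemma PSeries_tail_bound (a : nat -> R) (X : R) : entire a -> 0 <= X ->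
  exists e : nat -> R, is_lim_seq e 0 /\
    forall N x, 0 <= x <= X -> Rabs (sum_n (fun n => a n * x ^ n) N - PSeries a x) <= e N.
Proof.
  intros Ha HX.
  set (b := fun n => Rabs (a n * X ^ n)).
  assert (Hb : ex_series b) by (apply entire_ex_abs, Ha).
  exists (fun N => Series b - sum_n b N). split.
  - replace (Finite 0) with (Finite (Series b - Series b)) by (f_equal; ring).
    apply is_lim_seq_minus'; [apply is_lim_seq_const|]. apply (Series_correct b), Hb.
  - intros N x Hx.
    assert (Hbd : forall n, Rabs (a n * x ^ n) <= b n).
    { intros n. unfold b. rewrite !Rabs_mult. apply Rmult_le_compat_l; [apply Rabs_pos|].
      rewrite <- !RPow_abs, !Rabs_pos_eq by lra. apply pow_incr; lra. }
    unfold PSeries. rewrite (Series_incr_n (fun n => a n * x ^ n) (S N)), (Series_incr_n b (S N)); try lia; auto.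
    2:{ apply entire_ex, Ha. }
    rewrite !sum_n_Reals. simpl Init.Nat.pred.
    match goal with |- Rabs (?s - (?s + ?t)) <= ?s' + ?u - ?s' =>
      replace (s - (s + t)) with (- t) by ring; replace (s' + u - s') with u by ring end.
    rewrite Rabs_Ropp.
    assert (Hex : ex_series (fun k => b (S N + k)%nat)) by (apply (ex_series_incr_n b (S N)), Hb).
    eapply Rle_trans; [apply Series_Rabs|].
    + apply (ex_series_le (V := R_CompleteNormedModule)) with (2 := Hex). intros n.
      unfold norm; simpl; unfold abs; simpl. rewrite Rabs_Rabsolu. apply Hbd.
    + apply Series_le; [|exact Hex]. intros n; split; [apply Rabs_pos|apply Hbd].
Qed.

(** * Series in fractional powers and their fractional integrals *)

Section Gps.
Variable alpha : R.
Hypothesis Halpha : 1 < alpha.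

Definition gps (a : nat -> R) (p t : R) : R := Rpower t p * PSeries a (Rpower t alpha).

Lemma is_derive_gps (a : nat -> R) (p t : R) : entire a -> 0 < t ->
  is_derive (gps a p) t (gps (PS_shift alpha p a) (p - 1) t).
Proof.
  intros Ha Ht. unfold gps.
  assert (H1 : is_derive (fun t => PSeries a (Rpower t alpha)) t
     (scal (alpha * Rpower t (alpha - 1)) (PSeries (PS_derive a) (Rpower t alpha)))).
  { apply (is_derive_comp (PSeries a) (fun t => Rpower t alpha)).
    - apply is_derive_entire, Ha.
    - apply is_derive_Rpower, Ht. }
  assert (H := is_derive_mult (fun t => Rpower t p) _ t _ _ (is_derive_Rpower t p Ht) H1 Rmult_comm).
  unfold plus, scal, mult in H; simpl in H; unfold mult in H; simpl in H.
  rewrite PSeries_shift by exact Ha.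
  replace (Rpower t (p - 1) * (alpha * (Rpower t alpha * PSeries (PS_derive a) (Rpower t alpha)) + p * PSeries a (Rpower t alpha)))
    with (p * Rpower t (p - 1) * PSeries a (Rpower t alpha) + Rpower t p * (alpha * Rpower t (alpha - 1) * PSeries (PS_derive a) (Rpower t alpha))).
  exact H.
  set (P := PSeries a _). set (Q := PSeries (PS_derive a) _).
  assert (E : forall q, Rpower t q = Rpower t (q - 1) * t).
  { intros q. rewrite <- (Rpower_1 t) at 3 by lra. rewrite <- Rpower_plus. f_equal; ring. }
  rewrite (E p), (E alpha). ring.
Qed.

Lemma continuous_gps (a : nat -> R) (p t : R) : entire a -> 0 < t -> continuous (gps a p) t.
Proof. intros Ha Ht. eapply continuous_of_derive, is_derive_gps; assumption. Qed.

(** What the Beta integral does to each term: the coefficients of the integral of (t - s)^(r - 1)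
    against [gps a p], that is, of Gamma(r) times the Riemann-Liouville integral of order r. *)
Definition PS_frac (r p : R) (a : nat -> R) (n : nat) : R :=
  a n * (Gamma r * Gamma (alpha * INR n + p + 1) / Gamma (alpha * INR n + p + 1 + r)).

Lemma Rpower_pow_mult (s : R) (n : nat) : 0 < s -> Rpower s alpha ^ n = Rpower s (alpha * INR n).
Proof. intros Hs. rewrite <- Rpower_pow by apply Rpower_pos. apply Rpower_mult. Qed.

(** Convergence of the series with coefficients [PS_frac] is part of the conclusion: it comes from
    the uniform convergence of the partial sums on (0, t), so no asymptotics of quotients of Gamma
    values are involved. *)
Lemma gps_frac_integral_series (a : nat -> R) (p r t : R) : entire a -> -1 < p -> 0 < r -> 0 < t ->
  exists I, is_RInt_gen (fun s => Rpower (t - s) (r - 1) * gps a p s) (at_right 0) (at_left t) I /\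
    is_series (fun n => Rpower t (p + r) * (PS_frac r p a n * Rpower t alpha ^ n)) I.
Proof.
  intros Ha Hp Hr Ht.
  assert (HX : 0 <= Rpower t alpha) by apply Rlt_le, Rpower_pos.
  destruct (PSeries_tail_bound a (Rpower t alpha) Ha HX) as [e [He1 He2]].
  set (b := fun n => Rpower t (p + r) * (PS_frac r p a n * Rpower t alpha ^ n)).
  assert (Hs : forall s, 0 < s < t -> 0 <= Rpower s alpha <= Rpower t alpha).
  { intros s Hs. split; [apply Rlt_le, Rpower_pos|]. apply Rle_Rpower_l; lra. }
  destruct (is_RInt_gen_uniform_limit (at_right 0) (at_left t) _ _ (fun s => 0 < s < t)
    (beta_kernel t (r - 1) p) (fun s => PSeries a (Rpower s alpha))
    (fun N s => sum_n (fun n => a n * Rpower s alpha ^ n) N) e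
    (Rpower t (p + 1 + r - 1) * (Gamma r * Gamma (p + 1) / Gamma (p + 1 + r)))
    (Series (fun n => Rabs (a n * Rpower t alpha ^ n))) (fun N => sum_n b N)) as [I [HI1 HI2]].
  - apply ends_in_interval, Ht.
  - intros; apply Rlt_le, beta_kernel_pos.
  - intros; apply continuous_beta_kernel; assumption.
  - intros s Ds. apply (continuous_comp (fun s => Rpower s alpha) (PSeries a)).
    + apply continuous_Rpower; lra.
    + apply continuous_entire, Ha.
  - intros s Ds. unfold PSeries.
    assert (Hex := entire_ex_abs a (Rpower s alpha) Ha).
    eapply Rle_trans; [apply Series_Rabs, Hex|].
    apply Series_le; [|apply entire_ex_abs, Ha].
    intros n; split; [apply Rabs_pos|]. rewrite !Rabs_mult. apply Rmult_le_compat_l; [apply Rabs_pos|].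
    destruct (Hs s Ds). rewrite <- !RPow_abs, !Rabs_pos_eq by lra. apply pow_incr; lra.
  - replace p with (p + 1 - 1) at 1 by ring. apply beta_integral; lra.
  - induction N as [|N IH].
    + rewrite sum_O. unfold b, PS_frac. simpl INR.
      assert (H := beta_integral t r (p + 1) Ht Hr ltac:(lra)).
      apply (is_RInt_gen_scal _ (a 0%nat)) in H.
      replace (Rpower t (p + r) * (a 0%nat * (Gamma r * Gamma (alpha * 0 + p + 1) / Gamma (alpha * 0 + p + 1 + r)) * Rpower t alpha ^ 0))
        with (scal (a 0%nat) (Rpower t (p + 1 + r - 1) * (Gamma r * Gamma (p + 1) / Gamma (p + 1 + r)))).
      2:{ Rsimp. rewrite Rmult_0_r, Rplus_0_l.
          replace (p + 1 + r - 1) with (p + r) by ring. ring. }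
      refine (is_RInt_gen_ext_interval _ _ _ _ Ht _ H).
      intros s Ds. rewrite sum_O. Rsimp.
      replace (p + 1 - 1) with p by ring. ring.
    + rewrite sum_Sn.
      assert (Hn : 0 < alpha * INR (S N)) by (apply Rmult_lt_0_compat; [lra|apply lt_0_INR; lia]).
      assert (H := beta_integral t r (alpha * INR (S N) + p + 1) Ht Hr ltac:(lra)).
      apply (is_RInt_gen_scal _ (a (S N))) in H.
      assert (H' := is_RInt_gen_plus _ _ _ _ IH H).
      replace (b (S N)) with (scal (a (S N)) (Rpower t (alpha * INR (S N) + p + 1 + r - 1) *
          (Gamma r * Gamma (alpha * INR (S N) + p + 1) / Gamma (alpha * INR (S N) + p + 1 + r)))).
      2:{ unfold b, PS_frac. rewrite Rpower_pow_mult by exact Ht. Rsimp.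
          replace (alpha * match N with 0%nat => 1 | S _ => INR N + 1 end + p + 1 + r - 1) with (p + r + alpha * INR (S N)) by (simpl; ring).
          rewrite (Rpower_plus (p + r)). simpl. ring. }
      refine (is_RInt_gen_ext_interval _ _ _ _ Ht _ H').
      intros s Ds. rewrite sum_Sn. unfold plus; simpl. Rsimp.
      rewrite Rmult_plus_distr_l. f_equal.
      change (Rpower s alpha * Rpower s alpha ^ N) with (Rpower s alpha ^ S N).
      rewrite Rpower_pow_mult by apply Ds. unfold beta_kernel.
      replace (alpha * match N with 0%nat => 1 | S _ => INR N + 1 end + p + 1 - 1) with (p + alpha * INR (S N)) by (simpl; ring).
      rewrite (Rpower_plus p). ring.
  - intros N s Ds. apply He2, Hs, Ds.
  - exact He1.
  - exists I; split; [|exact HI2].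
    refine (is_RInt_gen_ext_interval _ _ _ _ Ht _ HI1).
    intros s Ds. unfold beta_kernel, gps. ring.
Qed.

(** At a given x, the termwise integration at the time t with t^alpha = x already provides the
    convergence. *)
Lemma entire_frac (a : nat -> R) (p r : R) : entire a -> -1 < p -> 0 < r -> entire (PS_frac r p a).
Proof.
  intros Ha Hp Hr. apply entire_of_ex. intros x Hx.
  set (t := Rpower x (/ alpha)).
  assert (Ht : 0 < t) by apply Rpower_pos.
  assert (Hxt : Rpower t alpha = x).
  { unfold t. rewrite Rpower_mult, Rinv_l by lra. apply Rpower_1, Hx. }
  destruct (gps_frac_integral_series a p r t Ha Hp Hr Ht) as [I [_ HI]].
  rewrite Hxt in HI.
  assert (He : ex_series (fun n => scal (/ Rpower t (p + r)) (Rpower t (p + r) * (PS_frac r p a n * x ^ n)))).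
  { apply (ex_series_scal (V := R_NormedModule)). exists I; exact HI. }
  revert He. apply ex_series_ext_R. intros n. Rsimp.
  assert (0 < Rpower t (p + r)) by apply Rpower_pos. field. lra.
Qed.

Lemma gps_frac_integral (a : nat -> R) (p r t : R) : entire a -> -1 < p -> 0 < r -> 0 < t ->
  is_RInt_gen (fun s => Rpower (t - s) (r - 1) * gps a p s) (at_right 0) (at_left t)
    (gps (PS_frac r p a) (p + r) t).
Proof.
  intros Ha Hp Hr Ht. destruct (gps_frac_integral_series a p r t Ha Hp Hr Ht) as [I [HI1 HI2]].
  replace (gps (PS_frac r p a) (p + r) t) with I; [exact HI1|].
  unfold gps, PSeries. rewrite <- Series_scal_l. symmetry. apply is_series_unique, HI2.
Qed.

(** * Mittag-Leffler kernels *)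

Definition ml_coef (mu : R) (n : nat) : R := / Gamma (alpha * INR n + mu).

Lemma ml_arg_pos (mu : R) (n : nat) : 0 < mu -> 0 < alpha * INR n + mu.
Proof. intros. assert (0 <= INR n) by apply pos_INR. assert (0 <= alpha * INR n) by (apply Rmult_le_pos; lra). lra. Qed.

Lemma entire_ml (mu : R) : 0 < mu -> entire (ml_coef mu).
Proof.
  intros Hmu. apply entire_of_ex. intros x Hx.
  (* With M^alpha = 2 x, [Gamma_ge] yields Gamma(alpha n + mu) >= C (2 x)^n, so the terms at x are
     at most C^(-1) 2^(-n). *)
  set (M := Rpower (2 * x) (/ alpha)).
  assert (HM : 0 < M) by apply Rpower_pos.
  assert (HMa : Rpower M alpha = 2 * x).
  { unfold M. rewrite Rpower_mult, Rinv_l by lra. apply Rpower_1; lra. }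
  set (C := Rpower M (mu - 1) * exp (- (M + 1))).
  assert (HC : 0 < C) by (apply Rmult_lt_0_compat; apply exp_pos).
  (* The term n = 0 is set aside because [Gamma_ge] needs an argument of at least 1, which holds for
     alpha n + mu from n = 1 on. *)
  apply (proj2 (ex_series_incr_1 (fun n => ml_coef mu n * x ^ n))).
  assert (Hg : ex_series (fun n => (/ 2) ^ S n)).
  { apply (proj1 (ex_series_incr_1 (fun n => (/ 2) ^ n))), ex_series_geom. rewrite Rabs_pos_eq; lra. }
  apply (ex_series_scal (V := R_NormedModule) (/ C)) in Hg.
  apply (ex_series_le (V := R_CompleteNormedModule)) with (2 := Hg). intros n.
  unfold norm; simpl norm. unfold abs; simpl abs. unfold scal; simpl scal; unfold mult; simpl mult.
  assert (Hpos := ml_arg_pos mu (S n) Hmu).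
  assert (HG := Gamma_pos _ Hpos).
  assert (Hx' : 0 < x ^ S n) by (apply pow_lt, Hx).
  unfold ml_coef. rewrite Rabs_pos_eq.
  2:{ apply Rmult_le_pos; [apply Rlt_le, Rinv_0_lt_compat, HG|lra]. }
  assert (HN : 1 <= INR (S n)) by (rewrite S_INR; assert (H := pos_INR n); lra).
  assert (Hge := Gamma_ge M (alpha * INR (S n) + mu) HM ltac:(nra)).
  replace (alpha * INR (S n) + mu - 1) with (alpha * INR (S n) + (mu - 1)) in Hge by ring.
  rewrite Rpower_plus, <- Rpower_pow_mult, HMa, Rmult_assoc in Hge by exact HM. fold C in Hge.
  apply Rmult_le_reg_l with (Gamma (alpha * INR (S n) + mu)); [exact HG|].
  rewrite <- Rmult_assoc, Rinv_r, Rmult_1_l by lra.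
  apply Rle_trans with ((2 * x) ^ S n * C * (/ C * (/ 2) ^ S n)).
  - right. rewrite Rpow_mult_distr. rewrite pow_inv. field. split; [apply pow_nonzero; lra|lra].
  - apply Rmult_le_compat_r; [|exact Hge].
    apply Rmult_le_pos; [apply Rlt_le, Rinv_0_lt_compat, HC|apply pow_le; lra].
Qed.

Lemma Mittag_Leffler_PSeries (mu z : R) : Mittag_Leffler alpha mu z = PSeries (ml_coef mu) z.
Proof. apply Series_ext. intros n. unfold ml_coef, Rdiv. ring. Qed.

(* [t^(mu-1) E_{alpha,mu}(c t^alpha)] for [0 < t]. *)
Definition mlk (mu c t : R) : R := gps (fun n => c ^ n * ml_coef mu n) (mu - 1) t.

Lemma gps_ext (a b : nat -> R) (p t : R) : (forall n, a n = b n) -> gps a p t = gps b p t.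
Proof. intros H. unfold gps. f_equal. apply PSeries_ext, H. Qed.

Lemma is_derive_mlk (mu c t : R) : 1 < mu -> 0 < t -> is_derive (mlk mu c) t (mlk (mu - 1) c t).
Proof.
  intros Hmu Ht. unfold mlk.
  assert (H := is_derive_gps (fun n => c ^ n * ml_coef mu n) (mu - 1) t
     (entire_pow _ _ (entire_ml mu ltac:(lra))) Ht).
  erewrite gps_ext; [exact H|]. intros n. unfold PS_shift, ml_coef.
  assert (Hpos := ml_arg_pos (mu - 1) n ltac:(lra)).
  replace (alpha * INR n + mu) with (alpha * INR n + (mu - 1) + 1) by ring.
  rewrite Gamma_succ by exact Hpos. assert (HG := Gamma_pos _ Hpos). field. split; lra.
Qed.

Lemma continuous_mlk (mu c t : R) : 0 < mu -> 0 < t -> continuous (mlk mu c) t.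
Proof. intros Hmu Ht. apply continuous_gps; [apply entire_pow, entire_ml, Hmu|exact Ht]. Qed.

Lemma mlk_frac_integral (mu r c t : R) : 0 < mu -> 0 < r -> 0 < t ->
  is_RInt_gen (fun s => Rpower (t - s) (r - 1) * mlk mu c s) (at_right 0) (at_left t)
    (Gamma r * mlk (mu + r) c t).
Proof.
  intros Hmu Hr Ht. unfold mlk.
  assert (H := gps_frac_integral _ (mu - 1) r t (entire_pow c _ (entire_ml mu Hmu)) ltac:(lra) Hr Ht).
  replace (Gamma r * gps (fun n => c ^ n * ml_coef (mu + r) n) (mu + r - 1) t) with
    (gps (PS_frac r (mu - 1) (fun n => c ^ n * ml_coef mu n)) (mu - 1 + r) t); [exact H|].
  replace (mu + r - 1) with (mu - 1 + r) by ring.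
  unfold gps. rewrite (Rmult_comm (Gamma r)), Rmult_assoc. f_equal.
  rewrite Rmult_comm, <- PSeries_scal. apply PSeries_ext. intros n.
  unfold PS_frac, ml_coef, PS_scal, scal; simpl; unfold mult; simpl.
  replace (alpha * INR n + (mu - 1) + 1) with (alpha * INR n + mu) by ring.
  replace (alpha * INR n + (mu + r)) with (alpha * INR n + mu + r) by ring.
  assert (H1 := Gamma_pos _ (ml_arg_pos mu n Hmu)).
  assert (H2 : 0 < alpha * INR n + mu + r) by (assert (Hm := ml_arg_pos mu n Hmu); lra).
  apply Gamma_pos in H2. field. split; lra.
Qed.

Lemma Gamma_1 : Gamma 1 = 1.
Proof.
  assert (H := is_RInt_gen_Gamma 1 Rlt_0_1).
  assert (E : 1 = 0 - - exp (- 0)) by (rewrite Ropp_0, exp_0; ring).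
  rewrite E at 2.
  refine (is_RInt_gen_uniq _ _ _ _ _ _ _ H _).
  apply (is_RInt_gen_FTC (at_right 0) (Rbar_locally p_infty) (fun x => 0 < x) (fun s => - exp (- s))).
  - apply ends_in_half_line.
  - intros x Hx. unfold gamma_kernel. replace (1 - 1) with 0 by ring. rewrite Rpower_O, Rmult_1_l by exact Hx.
    auto_derive; [exact I|ring].
  - intros; apply continuous_gamma_kernel; assumption.
  - apply (continuous_at_right (fun s => - exp (- s))), (ex_derive_continuous (fun s => - exp (- s))).
    auto_derive. exact I.
  - intros P [e He]. exists (- ln e). intros x Hx. apply He. unball.
    rewrite Ropp_0, Rplus_0_r, Rabs_Ropp, Rabs_pos_eq by apply Rlt_le, exp_pos.
    rewrite <- (exp_ln e) by apply cond_pos. apply exp_increasing. lra.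
Qed.

(** The term n = 0 split off. It stands in for the rule [is_derive_mlk] at mu = 1, where lowering
    the index would lead to 1 / Gamma(0): here the constant disappears and the rest has index alpha
    + 1. *)
Lemma mlk_1 (c t : R) : 0 < t -> mlk 1 c t = 1 + c * mlk (alpha + 1) c t.
Proof.
  intros Ht. unfold mlk, gps.
  rewrite PSeries_decr_1 by (apply ex_pseries_R, entire_ex, entire_pow, entire_ml; lra).
  replace (1 - 1) with 0 by ring. replace (alpha + 1 - 1) with alpha by ring.
  rewrite Rpower_O, Rmult_1_l by exact Ht. unfold ml_coef at 1. simpl INR.
  rewrite Rmult_0_r, Rplus_0_l, Gamma_1, pow_O, Rinv_1, Rmult_1_l. f_equal.
  rewrite <- Rmult_assoc, (Rmult_comm c), Rmult_assoc. f_equal.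
  rewrite <- PSeries_scal. apply PSeries_ext. intros n.
  unfold PS_decr_1, ml_coef, PS_scal, scal; simpl pow. simpl; unfold mult; simpl.
  change (match n with 0%nat => 1 | S _ => INR n + 1 end) with (INR (S n)). rewrite S_INR.
  replace (alpha * (INR n + 1) + 1) with (alpha * INR n + (alpha + 1)) by ring. ring.
Qed.

Lemma is_derive_mlk_1 (c t : R) : 0 < t -> is_derive (mlk 1 c) t (c * mlk alpha c t).
Proof.
  intros Ht. apply is_derive_ext_loc with (fun t => 1 + c * mlk (alpha + 1) c t).
  - exists (mkposreal t Ht). intros y Hy. unball. apply Rabs_def2 in Hy. symmetry. apply mlk_1. lra.
  - assert (H := is_derive_mlk (alpha + 1) c t ltac:(lra) Ht).
    replace (alpha + 1 - 1) with alpha in H by ring.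
    replace (c * mlk alpha c t) with (plus 0 (c * mlk alpha c t)) by (unfold plus; simpl; ring).
    apply (is_derive_plus (fun _ => 1)); [exact (is_derive_const (V := R_NormedModule) 1 t)|].
    apply (is_derive_scal (mlk (alpha + 1) c)), H.
Qed.

End Gps.

(** * The energy inequality *)

Lemma is_derive_locally_lipschitz (f : R -> R) (x l : R) : is_derive f x l ->
  locally x (fun y => Rabs (f y - f x) <= (Rabs l + 1) * Rabs (y - x)).
Proof.
  intros H. apply is_derive_Reals in H. destruct (H 1 Rlt_0_1) as [d Hd].
  exists d. intros y Hy. unball.
  destruct (Req_dec y x) as [->|Hne].
  { replace (f x - f x) with 0 by ring. replace (x - x) with 0 by ring. rewrite Rabs_R0. lra. }
  specialize (Hd (y - x) ltac:(lra) Hy). replace (x + (y - x)) with y in Hd by ring.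
  replace (f y - f x) with (((f y - f x) / (y - x) - l) * (y - x) + l * (y - x)) by (field; lra).
  eapply Rle_trans; [apply Rabs_triang|]. rewrite !Rabs_mult.
  assert (0 <= Rabs (y - x)) by apply Rabs_pos. nra.
Qed.

(** Boundary terms are separated into a function of each end, so that their limits can be taken
    independently. *)
Lemma is_RInt_gen_ge (Fa Fb : (R -> Prop) -> Prop)
  (PFa : ProperFilter Fa) (PFb : ProperFilter Fb) (D : R -> Prop) (f h k : R -> R) (l h0 k0 : R) :
  ends_in Fa Fb D ->
  (forall a b v, a <= b -> (forall x, a <= x <= b -> D x) -> is_RInt f a b v -> h a + k b <= v) ->
  filterlim h Fa (locally h0) -> filterlim k Fb (locally k0) ->
  is_RInt_gen f Fa Fb l -> h0 + k0 <= l.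
Proof.
  intros HD Hle Hh Hk Hl. apply Rnot_lt_le; intros Hlt.
  assert (He : 0 < (h0 + k0 - l) / 3) by lra. set (e := mkposreal _ He).
  assert (H1 := is_RInt_gen_RInt_dist (V := R_CompleteNormedModule) Fa Fb f l e _ _ Hl).
  assert (H2 := proj1 (filterlim_locally _ _) Hh e).
  assert (H3 := proj1 (filterlim_locally _ _) Hk e).
  unfold ends_in in HD.
  assert (H4 : filter_prod Fa Fb (fun ab => ball h0 e (h (fst ab)) /\ ball k0 e (k (snd ab)))).
  { eexists; [exact H2|exact H3|]. simpl; auto. }
  destruct (filter_ex _ (filter_and _ _ (filter_and _ _ HD H4) H1)) as [[a b] [[[L Dl] [Ba Bb]] [E B]]].
  simpl in *. specialize (Hle a b _ L Dl (RInt_correct f a b E)).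
  unball. apply Rabs_def2 in Ba. apply Rabs_def2 in Bb. apply Rabs_def2 in B. lra.
Qed.

(* Integrating by parts against [- d (G t - G s)^2 / 2] leaves boundary terms of
   the right sign or tending to 0, and the integral of a square. *)
Lemma alikhanov_inequality (G g : R -> R) (r t I : R) : 0 < t -> 0 < r < 1 ->
  (forall s, 0 < s <= t -> is_derive G s (g s)) -> (forall s, 0 < s <= t -> continuous g s) ->
  is_RInt_gen (fun s => Rpower (t - s) (r - 1) * (g s * (G t - G s))) (at_right 0) (at_left t) I -> 0 <= I.
Proof.
  intros Ht Hr HG Hg HI.
  set (Phi := fun s => / 2 * (Rpower (t - s) (r - 1) * (G t - G s) ^ 2)).
  set (dPhi := fun s => / 2 * ((1 - r) * Rpower (t - s) (r - 2) * (G t - G s) ^ 2)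
                 - Rpower (t - s) (r - 1) * (g s * (G t - G s))).
  assert (HGc : forall s, 0 < s <= t -> continuous G s).
  { intros s Hs. eapply continuous_of_derive, HG, Hs. }
  assert (Hsub : forall s, 0 < s <= t -> continuous (fun s => G t - G s) s).
  { intros s Hs. apply (continuous_minus (fun _ => G t) G); [apply continuous_const|apply HGc, Hs]. }
  assert (HR : forall q s, 0 < s < t -> continuous (fun s => Rpower (t - s) q) s).
  { intros q s Hs. eapply continuous_of_derive, is_derive_Rpower_minus, Hs. }
  assert (HdPhi : forall s, 0 < s < t -> is_derive Phi s (dPhi s)).
  { intros s Hs. unfold Phi, dPhi.
    assert (H1 := is_derive_Rpower_minus t (r - 1) s (proj2 Hs)).
    assert (H2 : is_derive (fun s => (G t - G s) ^ 2) s (- (2 * g s * (G t - G s)))).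
    { replace (- (2 * g s * (G t - G s))) with (INR 2 * (0 - g s) * (G t - G s) ^ 1) by (simpl; ring).
      apply (is_derive_pow (fun s => G t - G s) 2).
      apply (is_derive_minus (fun _ => G t) G); [exact (is_derive_const (V := R_NormedModule) (G t) s)|].
      apply HG; lra. }
    assert (H := is_derive_scal _ s (/ 2) _ (is_derive_mult _ _ s _ _ H1 H2 Rmult_comm)).
    unfold plus, mult in H; simpl in H.
    replace (/ 2 * ((1 - r) * Rpower (t - s) (r - 2) * (G t - G s) ^ 2) - Rpower (t - s) (r - 1) * (g s * (G t - G s))) with
     (/ 2 * (- ((r - 1) * Rpower (t - s) (r - 1 - 1)) * ((G t - G s) * ((G t - G s) * 1)) + Rpower (t - s) (r - 1) * - (2 * g s * (G t - G s)))); [exact H|].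
    replace (r - 1 - 1) with (r - 2) by ring. field. }
  assert (HcdPhi : forall s, 0 < s < t -> continuous dPhi s).
  { intros s Hs. unfold dPhi.
    apply (continuous_minus (fun s => / 2 * ((1 - r) * Rpower (t - s) (r - 2) * (G t - G s) ^ 2))).
    - apply (continuous_scal_r (/ 2) (fun s => (1 - r) * Rpower (t - s) (r - 2) * (G t - G s) ^ 2)).
      apply (continuous_mult (fun s => (1 - r) * Rpower (t - s) (r - 2)) (fun s => (G t - G s) ^ 2)).
      + apply (continuous_scal_r (1 - r) (fun s => Rpower (t - s) (r - 2))), HR, Hs.
      + simpl. apply (continuous_mult (fun s => G t - G s) (fun s => (G t - G s) * 1)); [apply Hsub; lra|].
        apply (continuous_mult (fun s => G t - G s) (fun s => 1)); [apply Hsub; lra|apply continuous_const].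
    - apply (continuous_mult (fun s => Rpower (t - s) (r - 1))); [apply HR, Hs|].
      apply (continuous_mult g); [apply Hg; lra|apply Hsub; lra]. }
  (* As G is differentiable at t, G t - G b is O(t - b), hence Phi b is O((t - b)^(r + 1)) despite
     the negative exponent r - 1 in its weight. *)
  assert (HPhi0 : filterlim (fun b => - Phi b) (at_left t) (locally 0)).
  { destruct (is_derive_locally_lipschitz G t _ (HG t ltac:(lra))) as [d Hd].
    set (M := Rabs (g t) + 1) in Hd.
    apply (filterlim_le_le (fun b => - (/ 2 * M ^ 2 * Rpower (t - b) (r + 1))) (fun b => - Phi b) (fun _ => 0) (F := at_left t) 0).
    - exists d. intros b Hb Hbt. specialize (Hd b Hb). unfold Phi.
      assert (Hp := Rpower_pos (t - b) (r - 1)).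
      rewrite (Rabs_left (b - t)) in Hd by lra.
      split.
      + replace (r + 1) with (r - 1 + 1 + 1) by ring. rewrite (Rpower_plus _ 1), (Rpower_plus _ 1), Rpower_1 by lra.
        apply Ropp_le_contravar. rewrite Rmult_assoc. apply Rmult_le_compat_l; [lra|].
        replace (M ^ 2 * (Rpower (t - b) (r - 1) * (t - b) * (t - b))) with (Rpower (t - b) (r - 1) * (M * - (b - t)) ^ 2) by ring.
        apply Rmult_le_compat_l; [lra|]. rewrite <- (pow2_abs (G t - G b)).
        rewrite Rabs_minus_sym. apply pow_incr. split; [apply Rabs_pos|exact Hd].
      + assert (0 <= (G t - G b) ^ 2) by apply pow2_ge_0. nra.
    - replace (Finite 0) with (Finite (- (/ 2 * M ^ 2 * 0))) by (f_equal; ring).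
      apply (filterlim_Ropp (at_left t)), (filterlim_Rscal (at_left t)), filterlim_Rpower_left; lra.
    - apply filterlim_const. }
  replace 0 with (0 + 0) by ring.
  refine (is_RInt_gen_ge (at_right 0) (at_left t) _ _ (fun s => 0 < s < t) _ (fun _ => 0) (fun b => - Phi b) I 0 0
    (ends_in_interval t Ht) _ _ HPhi0 HI).
  2:{ apply filterlim_const. }
  intros a b v Hab HD Hv.
  assert (Hv' : is_RInt (fun s => - dPhi s) a b (- (Phi b - Phi a))).
  { apply (is_RInt_opp dPhi), (is_RInt_derive (V := R_CompleteNormedModule) Phi dPhi); rewrite Rmin_left, Rmax_right by lra; intros; auto. }
  assert (Hle : - (Phi b - Phi a) <= v).
  { apply (is_RInt_le _ _ a b _ _ Hab Hv' Hv). intros s Hs. unfold dPhi.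
    assert (0 < Rpower (t - s) (r - 2)) by apply Rpower_pos.
    assert (0 <= (1 - r) * Rpower (t - s) (r - 2) * (G t - G s) ^ 2).
    { apply Rmult_le_pos; [apply Rmult_le_pos; lra|apply pow2_ge_0]. }
    lra. }
  assert (0 <= Phi a).
  { unfold Phi. apply Rmult_le_pos; [lra|]. apply Rmult_le_pos; [apply Rlt_le, Rpower_pos|apply pow2_ge_0]. }
  lra.
Qed.

Lemma nondecreasing_from_limit (F f : R -> R) (T l : R) : 0 < T ->
  (forall t, 0 < t <= T -> is_derive F t (f t)) -> (forall t, 0 < t <= T -> 0 <= f t) ->
  filterlim F (at_right 0) (locally l) -> l <= F T.
Proof.
  intros HT HF Hf Hl.
  apply (filterlim_le (F := at_right 0) F (fun _ => F T) l (F T)); [|exact Hl|apply filterlim_const].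
  exists (mkposreal T HT). intros a Ha Ha0. unball. apply Rabs_def2 in Ha.
  destruct (MVT_gen F a T f) as [c [Hc1 Hc2]]; rewrite ?Rmin_left, ?Rmax_right in * by lra.
  - intros; apply HF; lra.
  - intros x Hx. apply continuity_pt_filterlim. eapply continuous_of_derive, HF; lra.
  - assert (0 <= f c) by (apply Hf; lra). nra.
Qed.

Section Energy.
Variable alpha : R.
Hypothesis Halpha : 1 < alpha < 2.

Let Ha : 1 < alpha := proj1 Halpha.

Notation m := (mlk alpha).
Notation r := (2 - alpha).

Lemma gps_lim_0 (a : nat -> R) (p : R) : entire a -> 0 < p -> filterlim (gps alpha a p) (at_right 0) (locally 0).
Proof.
  intros Hent Hp. unfold gps. replace 0 with (0 * PSeries a 0) at 2 by ring.
  apply (filterlim_Rmult (at_right 0)).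
  - apply filterlim_Rpower_0, Hp.
  - apply (filterlim_comp _ _ _ (fun t => Rpower t alpha) (PSeries a) _ (locally 0)).
    + apply filterlim_Rpower_0; lra.
    + apply (continuous_entire a 0 Hent).
Qed.

Lemma mlk_lim_0 (mu c : R) : 1 < mu -> filterlim (m mu c) (at_right 0) (locally 0).
Proof. intros Hmu. apply gps_lim_0; [apply entire_pow, entire_ml|]; lra. Qed.

Lemma mlk_1_lim_0 (c : R) : filterlim (m 1 c) (at_right 0) (locally 1).
Proof.
  apply filterlim_ext_loc with (fun t => 1 + c * m (alpha + 1) c t).
  - exists (mkposreal 1 Rlt_0_1). intros t _ Ht. symmetry. apply mlk_1; [lra|exact Ht].
  - assert (Hl : filterlim (fun t => 1 + c * m (alpha + 1) c t) (at_right 0) (locally (1 + c * 0))).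
    { apply (filterlim_Rplus (at_right 0)); [apply filterlim_const|].
      apply (filterlim_Rscal (at_right 0)), mlk_lim_0; lra. }
    replace (1 + c * 0) with 1 in Hl by ring. exact Hl.
Qed.

Section Square.
Variables (mu c : R).
Hypothesis Hmu : 1 < mu.

Let e (n : nat) : R := c ^ n * ml_coef alpha mu n.
Let ee : nat -> R := PS_mult e e.

Local Lemma entire_e : entire e.
Proof. apply entire_pow, entire_ml; lra. Qed.

Local Lemma entire_ee : entire ee.
Proof. apply entire_mult; apply entire_e. Qed.

Local Lemma mlk_square (t : R) : gps alpha ee (2 * mu - 2) t = m mu c t ^ 2.
Proof.
  unfold mlk, gps, ee. fold e. rewrite PSeries_mult by (apply entire_lt, entire_e).
  replace (2 * mu - 2) with (mu - 1 + (mu - 1)) by ring. rewrite Rpower_plus. ring.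
Qed.

(** Two expressions of the derivative of the square are compared, one termwise and one by the
    product rule; the Cauchy product is never expanded. *)
Local Lemma mlk_square_derive (t : R) : 0 < t ->
  gps alpha (PS_shift alpha (2 * mu - 2) ee) (2 * mu - 3) t = 2 * (m mu c t * m (mu - 1) c t).
Proof.
  intros Ht.
  assert (H1 := is_derive_gps alpha ee (2 * mu - 2) t entire_ee Ht).
  assert (H2 := is_derive_mlk alpha Ha mu c t Hmu Ht).
  assert (H3 : is_derive (gps alpha ee (2 * mu - 2)) t (2 * (m mu c t * m (mu - 1) c t))).
  { apply is_derive_ext with (fun t => m mu c t ^ 2); [intros; symmetry; apply mlk_square|].
    replace (2 * (m mu c t * m (mu - 1) c t)) with (INR 2 * m (mu - 1) c t * m mu c t ^ 1) by (simpl; ring).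
    apply (is_derive_pow (m mu c) 2), H2. }
  replace (2 * mu - 3) with (2 * mu - 2 - 1) by ring.
  rewrite <- (is_derive_unique _ _ _ H1). apply (is_derive_unique _ _ _ H3).
Qed.

(** The integral of (t - s)^(r - 1) against the square of [m mu c], by [energy_integral]. Being
    given by its series, it is differentiable by [is_derive_gps]. *)
Definition energy : R -> R := gps alpha (PS_frac alpha r (2 * mu - 2) ee) (2 * mu - alpha).

Local Lemma energy_integral (t : R) : 0 < t ->
  is_RInt_gen (fun s => Rpower (t - s) (r - 1) * m mu c s ^ 2) (at_right 0) (at_left t) (energy t).
Proof.
  intros Ht.
  assert (H := gps_frac_integral alpha Ha ee (2 * mu - 2) r t entire_ee ltac:(lra) ltac:(lra) Ht).
  replace (2 * mu - 2 + r) with (2 * mu - alpha) in H by ring.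
  refine (is_RInt_gen_ext_interval _ _ _ _ Ht _ H).
  intros s Hs. rewrite mlk_square. reflexivity.
Qed.

(** The integrand is a positive weight times a square, and near 0 the square does not vanish, as the
    constant coefficient of e is 1 / Gamma(mu). This is the source of all strict inequalities
    below. *)
Lemma energy_pos (t : R) : 0 < t -> 0 < energy t.
Proof.
  intros Ht.
  assert (He0 : 0 < PSeries e 0).
  { rewrite PSeries_0. unfold e, ml_coef. simpl. rewrite Rmult_0_r, Rplus_0_l, Rmult_1_l.
    apply Rinv_0_lt_compat, Gamma_pos; lra. }
  destruct (proj1 (filterlim_locally _ _) (continuous_entire e 0 entire_e) (mkposreal _ He0)) as [d Hd].
  (* For s below b, s^alpha stays within d of 0, where the series of e is positive. *)
  set (b := Rmin (t / 2) (Rpower (d / 2) (/ alpha))).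
  assert (Hb : 0 < b) by (apply Rmin_pos; [lra|apply Rpower_pos]).
  assert (Hbt : b <= t / 2) by apply Rmin_l.
  assert (Hbd : Rpower b alpha < d).
  { apply Rle_lt_trans with (d / 2); [|destruct d; simpl; lra].
    replace (d / 2) with (Rpower (Rpower (d / 2) (/ alpha)) alpha).
    - apply Rle_Rpower_l; [lra|]. split; [exact Hb|apply Rmin_r].
    - rewrite Rpower_mult, Rinv_l by lra. apply Rpower_1. destruct d; simpl; lra. }
  assert (Hpos : forall s, b / 2 < s < b -> 0 < m mu c s).
  { intros s Hs. unfold mlk, gps. apply Rmult_lt_0_compat; [apply Rpower_pos|].
    fold e. specialize (Hd (Rpower s alpha)). unball.
    assert (Hs' : Rpower s alpha <= Rpower b alpha) by (apply Rle_Rpower_l; lra).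
    assert (Hs0 := Rpower_pos s alpha).
    assert (H : Rabs (PSeries e (Rpower s alpha) + - PSeries e 0) < PSeries e 0).
    { apply Hd. rewrite Ropp_0, Rplus_0_r, Rabs_pos_eq; lra. }
    apply Rabs_def2 in H. lra. }
  assert (Hc : forall s, 0 < s < t -> continuous (fun s => Rpower (t - s) (r - 1) * m mu c s ^ 2) s).
  { intros s Hs. apply (continuous_mult (fun s => Rpower (t - s) (r - 1)) (fun s => m mu c s ^ 2)).
    - eapply continuous_of_derive, is_derive_Rpower_minus, Hs.
    - assert (H := is_derive_mlk alpha Ha mu c s Hmu (proj1 Hs)).
      apply (ex_derive_continuous (fun s => m mu c s ^ 2)). auto_derive. eexists; exact H. }
  eapply Rlt_le_trans; [|apply (RInt_le_is_RInt_gen (at_right 0) (at_left t) _ _ (fun s => 0 < s < t)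
      (fun s => Rpower (t - s) (r - 1) * m mu c s ^ 2) (energy t) (b / 2) b)].
  - apply RInt_gt_0; [lra| |intros; apply Hc; lra].
    intros s Hs. apply Rmult_lt_0_compat; [apply Rpower_pos|apply pow_lt, Hpos, Hs].
  - apply ends_in_interval, Ht.
  - intros s Hs. apply Rmult_le_pos; [apply Rlt_le, Rpower_pos|apply pow2_ge_0].
  - exact Hc.
  - apply at_right_le; lra.
  - apply at_left_ge; lra.
  - lra.
  - apply energy_integral, Ht.
Qed.

Lemma energy_lim_0 : filterlim energy (at_right 0) (locally 0).
Proof. apply gps_lim_0; [apply entire_frac; [exact Ha|apply entire_ee|lra|lra]|lra]. Qed.

(** The derivative is the fractional integral of the derivative 2 m m' of the square. By
    [alikhanov_inequality] it is at most 2 m(t) times the fractional integral of m', and the latter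
    is a kernel again, with index mu - 1 + r = mu + 1 - alpha. *)
Lemma energy_derive (t : R) : 0 < t ->
  exists d, is_derive energy t d /\ d <= Gamma r * (2 * (m mu c t * m (mu + 1 - alpha) c t)).
Proof.
  intros Ht.
  assert (H1 := is_derive_gps alpha _ (2 * mu - alpha) t
    (entire_frac alpha Ha ee (2 * mu - 2) r entire_ee ltac:(lra) ltac:(lra)) Ht).
  eexists; split; [exact H1|].
  assert (H2 := gps_frac_integral alpha Ha _ (2 * mu - 3) r t
    (entire_shift alpha (2 * mu - 2) ee entire_ee) ltac:(lra) ltac:(lra) Ht).
  replace (2 * mu - alpha - 1) with (2 * mu - 3 + r) by ring.
  (* Differentiation and fractional integration commute on coefficients, by Gamma(x + 1) = x
     Gamma(x) used at x and at x + r. *)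
  rewrite (gps_ext alpha _ (PS_frac alpha r (2 * mu - 3) (PS_shift alpha (2 * mu - 2) ee))).
  2:{ intros n. unfold PS_shift, PS_frac.
      set (x := alpha * INR n + (2 * mu - 2)).
      assert (Hx : 0 < x).
      { unfold x. apply (ml_arg_pos alpha Ha). lra. }
      replace (alpha * INR n + (2 * mu - alpha)) with (x + r) by (unfold x; ring).
      replace (alpha * INR n + (2 * mu - 2) + 1) with (x + 1) by (unfold x; ring).
      replace (alpha * INR n + (2 * mu - 3) + 1) with x by (unfold x; ring).
      replace (x + 1 + r) with (x + r + 1) by ring.
      rewrite !Gamma_succ by lra.
      assert (0 < Gamma (x + r)) by (apply Gamma_pos; lra).
      field. lra. }
  set (Q := gps alpha (PS_frac alpha r (2 * mu - 3) (PS_shift alpha (2 * mu - 2) ee)) (2 * mu - 3 + r) t) in *.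
  assert (H3 := mlk_frac_integral alpha Ha (mu - 1) r c t ltac:(lra) ltac:(lra) Ht).
  replace (mu - 1 + r) with (mu + 1 - alpha) in H3 by ring.
  apply (is_RInt_gen_scal _ (m mu c t)) in H3.
  apply (is_RInt_gen_scal _ (/ 2)) in H2.
  assert (H4 := is_RInt_gen_minus _ _ _ _ H3 H2).
  assert (H5 : 0 <= minus (scal (m mu c t) (Gamma r * m (mu + 1 - alpha) c t)) (scal (/ 2) Q)).
  { apply (alikhanov_inequality (m mu c) (m (mu - 1) c) r t _ Ht ltac:(lra)).
    - intros; apply is_derive_mlk; lra.
    - intros; apply continuous_mlk; lra.
    - refine (is_RInt_gen_ext_interval _ _ _ _ Ht _ H4).
      intros s Hs. rewrite mlk_square_derive by lra.
      Rsimp. field. }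
  unfold minus, scal, plus, opp in H5; simpl in H5; unfold mult in H5; simpl in H5. lra.
Qed.

End Square.

Variables (c T : R).
Hypotheses (Hc : c < 0) (HT : 0 < T).

(** [Gamma r * N t - energy mu c t] is nondecreasing by [energy_derive] and tends to [Gamma r * l]
    at 0. *)
Lemma energy_le (mu l : R) (N : R -> R) : 1 < mu ->
  (forall t, 0 < t <= T -> is_derive N t (2 * (m mu c t * m (mu + 1 - alpha) c t))) ->
  filterlim N (at_right 0) (locally l) -> energy mu c T <= Gamma r * (N T - l).
Proof.
  intros Hmu HN Hl.
  assert (Hle : Gamma r * l - 0 <= Gamma r * N T - energy mu c T).
  { apply (nondecreasing_from_limit (fun t => Gamma r * N t - energy mu c t)
      (fun t => Gamma r * (2 * (m mu c t * m (mu + 1 - alpha) c t)) - Derive (energy mu c) t) T _ HT).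
    - intros t Ht. destruct (energy_derive mu c Hmu t ltac:(lra)) as [d [Hd _]].
      apply (is_derive_minus (fun t => Gamma r * N t) (energy mu c)).
      + apply (is_derive_scal N), HN, Ht.
      + apply Derive_correct. exists d; exact Hd.
    - intros t Ht. destruct (energy_derive mu c Hmu t ltac:(lra)) as [d [Hd1 Hd2]].
      rewrite (is_derive_unique _ _ _ Hd1). lra.
    - apply (filterlim_Rminus (at_right 0)); [apply (filterlim_Rscal (at_right 0)), Hl|].
      apply energy_lim_0, Hmu. }
  lra.
Qed.

Lemma neg_of_energy (mu x : R) : 1 < mu -> energy mu c T <= Gamma r * (/ c * x) -> x < 0.
Proof.
  intros Hmu Hle. assert (Hpos := energy_pos mu c Hmu T HT).
  assert (HG : 0 < Gamma r) by (apply Gamma_pos; lra).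
  assert (Hc' : / c < 0) by (apply Rinv_lt_0_compat, Hc).
  assert (H : 0 < / c * x) by (apply Rmult_lt_reg_l with (Gamma r); lra). nra.
Qed.

(** The case mu = alpha: since m_1' = c m_alpha, the bound 2 m_alpha m_1 is the derivative of m_1^2
    / c, whose limit at 0 is 1 / c. As c < 0 and the energy is positive, m_1^2 - 1 is negative. *)
Lemma mlk_1_lt_1 : m 1 c T < 1.
Proof.
  assert (Hlt : m 1 c T ^ 2 - 1 ^ 2 < 0); [|nra].
  apply (neg_of_energy alpha); [exact Ha|]. rewrite Rmult_minus_distr_l.
  apply (energy_le alpha _ (fun t => / c * m 1 c t ^ 2)); [exact Ha| |].
  - intros t Ht. replace (alpha + 1 - alpha) with 1 by ring.
    replace (2 * (m alpha c t * m 1 c t)) with (/ c * (INR 2 * (c * m alpha c t) * m 1 c t ^ 1)) by (simpl; field; lra).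
    apply (is_derive_scal (fun t => m 1 c t ^ 2)), (is_derive_pow (m 1 c) 2), is_derive_mlk_1; lra.
  - apply (filterlim_Rscal (at_right 0)).
    apply (filterlim_comp _ _ _ (m 1 c) (fun x => x ^ 2) _ (locally 1)); [apply mlk_1_lim_0|].
    apply (ex_derive_continuous (fun x => x ^ 2)). auto_derive. exact I.
Qed.

(** The case mu = alpha + 1: since c m_(alpha + 1) = m_1 - 1, the bound 2 m_(alpha + 1) m_2 is the
    derivative of (m_2^2 - 2 m_3) / c, which vanishes at 0. *)
Lemma mlk_2_3 : m 2 c T ^ 2 < 2 * m 3 c T.
Proof.
  assert (Hlt : m 2 c T ^ 2 - 2 * m 3 c T < 0); [|lra].
  apply (neg_of_energy (alpha + 1)); [lra|].
  replace (/ c * (m 2 c T ^ 2 - 2 * m 3 c T)) with (/ c * (m 2 c T ^ 2 - 2 * m 3 c T) - / c * (0 ^ 2 - 2 * 0)) by ring.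
  apply (energy_le (alpha + 1) _ (fun t => / c * (m 2 c t ^ 2 - 2 * m 3 c t))); [lra| |].
  - intros t Ht. replace (alpha + 1 + 1 - alpha) with 2 by ring.
    assert (H2 := is_derive_mlk alpha Ha 2 c t ltac:(lra) ltac:(lra)).
    assert (H3 := is_derive_mlk alpha Ha 3 c t ltac:(lra) ltac:(lra)).
    replace (2 - 1) with 1 in H2 by ring. replace (3 - 1) with 2 in H3 by ring.
    replace (2 * (m (alpha + 1) c t * m 2 c t)) with (/ c * (INR 2 * m 1 c t * m 2 c t ^ 1 - 2 * m 2 c t)).
    2:{ rewrite (mlk_1 alpha Ha c t) by lra. simpl. field; lra. }
    apply (is_derive_scal (fun t => m 2 c t ^ 2 - 2 * m 3 c t)).
    apply (is_derive_minus (fun t => m 2 c t ^ 2) (fun t => 2 * m 3 c t)).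
    + apply (is_derive_pow (m 2 c) 2), H2.
    + apply (is_derive_scal (m 3 c)), H3.
  - apply (filterlim_Rscal (at_right 0)), (filterlim_Rminus (at_right 0)).
    + apply (filterlim_comp _ _ _ (m 2 c) (fun x => x ^ 2) _ (locally 0)); [apply mlk_lim_0; lra|].
      apply (ex_derive_continuous (fun x => x ^ 2)). auto_derive. exact I.
    + apply (filterlim_Rscal (at_right 0)), mlk_lim_0; lra.
Qed.

Lemma mlk_determinant_pos : 0 < m 2 c T ^ 2 + m 3 c T * (1 - m 1 c T).
Proof.
  assert (H1 := mlk_1_lt_1). assert (H2 := mlk_2_3). assert (H3 := pow2_ge_0 (m 2 c T)). nra.
Qed.

End Energy.

(** * Uniqueness for the scalar problem *)

Lemma is_derive_RInt_in (g : R -> R) (l u a x : R) :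
  (forall y, l < y < u -> continuous g y) -> l < a < u -> l < x < u ->
  is_derive (fun y => RInt g a y) x (g x).
Proof.
  intros Hg Ha Hx. apply (is_derive_RInt g (fun y => RInt g a y) a x); [|apply Hg, Hx].
  assert (Hd : 0 < Rmin (x - l) (u - x)) by (apply Rmin_pos; lra).
  exists (mkposreal _ Hd). intros y Hy. unball. apply Rabs_def2 in Hy.
  assert (H1 := Rmin_l (x - l) (u - x)). assert (H2 := Rmin_r (x - l) (u - x)).
  apply (RInt_correct g), (ex_RInt_continuous (V := R_CompleteNormedModule)). intros z Hz. apply Hg.
  assert (Hay : l < y < u) by lra. destruct (Rle_dec a y).
  - rewrite Rmin_left, Rmax_right in Hz by lra. lra.
  - rewrite Rmin_right, Rmax_left in Hz by lra. lra.
Qed.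

(* Abel's test: the weight [(t - s)^p] is monotone and bounded near [0], so
   convergence of the weighted integral of [f'] at [0] carries over to [f']. *)
Lemma ex_limit_of_weighted_integral (f f2 : R -> R) (p t I : R) : 0 < t -> 0 < p ->
  (forall s, 0 < s < t -> is_derive f s (f2 s)) ->
  is_RInt_gen (fun s => Rpower (t - s) (- p) * f2 s) (at_right 0) (at_left t) I ->
  exists b : R, filterlim f (at_right 0) (locally b).
Proof.
  intros Ht Hp Hf HI.
  set (q := fun s => Rpower (t - s) (- p) * f2 s) in *.
  apply (filterlim_locally_cauchy (U := R_CompleteNormedModule)). intros eps.
  (* Below, an increment of f is at most C (2 e): the derivative of V contributes 2 p t^p and the
     boundary term t^p. The 3 in e makes the total 2 eps / 3. *)
  set (C := Rpower t p * (2 * p + 1)).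
  assert (HC : 0 < C) by (apply Rmult_lt_0_compat; [apply Rpower_pos|lra]).
  assert (He : 0 < eps / (3 * C)) by (apply Rdiv_lt_0_compat; [apply cond_pos|lra]).
  set (e := eps / (3 * C)) in *.
  assert (H1 := is_RInt_gen_RInt_dist (V := R_CompleteNormedModule) _ _ q I (mkposreal _ He) _ _ HI).
  destruct H1 as [Qf P [d Hd] HP HQ]; simpl in HQ.
  destruct (filter_ex _ HP) as [b0 Pb0].
  set (dl := Rmin d (t / 2)).
  assert (Hdl : 0 < dl) by (apply Rmin_pos; [apply cond_pos|lra]).
  assert (Hdl1 : dl <= d) by apply Rmin_l. assert (Hdl2 : dl <= t / 2) by apply Rmin_r.
  assert (HQd : forall a, 0 < a < dl -> Qf a).
  { intros a Ha. apply Hd; [|lra]. unball. rewrite Ropp_0, Rplus_0_r, Rabs_pos_eq; lra. }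
  assert (Hex : forall a x, 0 < a < dl -> 0 < x < dl -> ex_RInt q a x /\ Rabs (RInt q a x) <= 2 * e).
  { intros a x Ha Hx. destruct (HQ a b0 (HQd a Ha) Pb0) as [E1 B1]. destruct (HQ x b0 (HQd x Hx) Pb0) as [E2 B2].
    assert (Eax : ex_RInt q a x).
    { apply ex_RInt_Chasles with b0; [exact E1|apply ex_RInt_swap, E2]. }
    split; [exact Eax|]. rewrite <- (RInt_Chasles q a x b0 Eax E2) in B1.
    unball. apply Rabs_def2 in B1. apply Rabs_def2 in B2. apply Rabs_le; lra. }
  assert (Key : forall a a', 0 < a -> a <= a' -> a' < dl -> Rabs (f a' - f a) < eps).
  { intros a a' Ha Haa Ha'.
    set (rho := fun s => p * Rpower (t - s) (- p - 1) * f s).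
    assert (Hrho : forall s, 0 < s < t -> continuous rho s).
    { intros s Hs. apply (continuous_mult (fun s => p * Rpower (t - s) (- p - 1)) f).
      - apply (continuous_scal_r p (fun s => Rpower (t - s) (- p - 1))).
        eapply continuous_of_derive, is_derive_Rpower_minus, Hs.
      - eapply continuous_of_derive, Hf, Hs. }
    (* A primitive of q obtained by parts, in which only the continuous f is integrated. By
       [RInt_derivative] its increments are the integrals of q, already known to be small. *)
    set (Q := fun x => Rpower (t - x) (- p) * f x - RInt rho a x).
    assert (HdQ : forall x, 0 < x < t -> is_derive Q x (q x)).
    { intros x Hx. unfold Q.
      assert (G1 := is_derive_mult _ _ x _ _ (is_derive_Rpower_minus t (- p) x (proj2 Hx)) (Hf x Hx) Rmult_comm).
      assert (G2 := is_derive_RInt_in rho 0 t a x Hrho ltac:(lra) Hx).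
      assert (G := is_derive_minus _ _ x _ _ G1 G2).
      unfold minus, plus, opp, mult in G; simpl in G.
      replace (q x) with (- (- p * Rpower (t - x) (- p - 1)) * f x + Rpower (t - x) (- p) * f2 x + - rho x); [exact G|].
      unfold q, rho. ring. }
    assert (HQx : forall x, a <= x <= a' -> Rabs (Q x - Q a) <= 2 * e).
    { intros x Hx. destruct (Hex a x ltac:(lra) ltac:(lra)) as [E B].
      rewrite (RInt_derivative Q q a x (RInt q a x)) in B; [exact B|lra| |apply (RInt_correct q), E].
      intros y Hy. apply HdQ; lra. }
    (* The weight is undone: multiplying q by (t - x)^p returns f2, so f2 cancels in the derivative
       of V and only the small quantity Q x - Q a remains. *)
    set (V := fun x => f x - Rpower (t - x) p * (Q x - Q a)).
    assert (HdV : forall x, 0 < x < t -> is_derive V x (p * Rpower (t - x) (p - 1) * (Q x - Q a))).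
    { intros x Hx. unfold V.
      assert (G0 : is_derive (fun x => Q x - Q a) x (q x - 0)).
      { apply (is_derive_minus Q (fun _ => Q a)); [apply HdQ, Hx|exact (is_derive_const (V := R_NormedModule) (Q a) x)]. }
      assert (G1 := is_derive_mult _ _ x _ _ (is_derive_Rpower_minus t p x (proj2 Hx)) G0 Rmult_comm).
      assert (G := is_derive_minus _ _ x _ _ (Hf x Hx) G1).
      unfold minus, plus, opp, mult in G; simpl in G.
      replace (p * Rpower (t - x) (p - 1) * (Q x - Q a)) with
        (f2 x + - (- (p * Rpower (t - x) (p - 1)) * (Q x - Q a) + Rpower (t - x) p * (q x - 0))); [exact G|].
      unfold q. rewrite Rpower_Ropp. field. apply Rgt_not_eq, Rpower_pos. }
    destruct (MVT_gen V a a' (fun x => p * Rpower (t - x) (p - 1) * (Q x - Q a))) as [c [Hc1 Hc2]];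
      rewrite ?Rmin_left, ?Rmax_right in * by lra.
    { intros; apply HdV; lra. }
    { intros; apply continuity_pt_filterlim. eapply continuous_of_derive, HdV; lra. }
    assert (E : f a' - f a = p * Rpower (t - c) (p - 1) * (Q c - Q a) * (a' - a) + Rpower (t - a') p * (Q a' - Q a)).
    { rewrite <- Hc2. unfold V. ring. }
    assert (Bc : Rabs (p * Rpower (t - c) (p - 1) * (Q c - Q a) * (a' - a)) <= 2 * p * Rpower t p * (2 * e)).
    { rewrite !Rabs_mult. rewrite (Rabs_pos_eq p), (Rabs_pos_eq (Rpower _ _)), (Rabs_pos_eq (a' - a)); try lra;
        [|apply Rlt_le, Rpower_pos].
      assert (B := HQx c ltac:(lra)).
      assert (Hpw : Rpower (t - c) (p - 1) * (a' - a) <= 2 * Rpower t p).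
      { assert (Hpp : Rpower (t - c) p = Rpower (t - c) (p - 1) * (t - c)).
        { rewrite <- (Rpower_1 (t - c)) at 3 by lra. rewrite <- Rpower_plus. f_equal; ring. }
        assert (Hle : Rpower (t - c) p <= Rpower t p) by (apply Rle_Rpower_l; lra).
        assert (0 < Rpower (t - c) (p - 1)) by apply Rpower_pos.
        apply Rle_trans with (Rpower (t - c) (p - 1) * (2 * (t - c))); [apply Rmult_le_compat_l; lra|]. lra. }
      replace (p * Rpower (t - c) (p - 1) * Rabs (Q c - Q a) * (a' - a)) with
        (p * ((Rpower (t - c) (p - 1) * (a' - a)) * Rabs (Q c - Q a))) by ring.
      replace (2 * p * Rpower t p * (2 * e)) with (p * ((2 * Rpower t p) * (2 * e))) by ring.
      apply Rmult_le_compat_l; [lra|]. apply Rmult_le_compat; [|apply Rabs_pos|exact Hpw|exact B].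
      apply Rmult_le_pos; [apply Rlt_le, Rpower_pos|lra]. }
    assert (Ba : Rabs (Rpower (t - a') p * (Q a' - Q a)) <= Rpower t p * (2 * e)).
    { rewrite Rabs_mult, (Rabs_pos_eq (Rpower _ _)) by apply Rlt_le, Rpower_pos.
      apply Rmult_le_compat; [apply Rlt_le, Rpower_pos|apply Rabs_pos| |apply HQx; lra].
      apply Rle_Rpower_l; lra. }
    rewrite E. eapply Rle_lt_trans; [apply Rabs_triang|].
    apply Rle_lt_trans with (C * (2 * e)); [unfold C; lra|].
    unfold e. replace (C * (2 * (eps / (3 * C)))) with (2 * eps / 3) by (field; lra).
    destruct eps as [ep Hep]; simpl; lra. }
  exists (fun a => 0 < a < dl). split.
  - exists (mkposreal dl Hdl). intros a Ha Ha0. unball. apply Rabs_def2 in Ha. lra.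
  - intros a a' Ha Ha'. change (Rabs (f a' - f a) < eps).
    destruct (Rle_dec a a'); [apply Key; lra|]. rewrite Rabs_minus_sym. apply Key; lra.
Qed.

(* Maximum principle for [D^p f] (0 < p < 1): [f] is compared with its majorant
   [m exp (K s)], which it touches at [t]. *)
Lemma caputo_at_maximum (f f2 : R -> R) (p t T m K I : R) : 0 < t -> t < T -> 0 < p < 1 -> 0 < m -> 0 < K ->
  (forall s, 0 < s < T -> is_derive f s (f2 s)) ->
  filterlim f (at_right 0) (locally 0) ->
  (forall s, 0 < s <= t -> f s <= m * exp (K * s)) -> f t = m * exp (K * t) ->
  is_RInt_gen (fun s => Rpower (t - s) (- p) * f2 s) (at_right 0) (at_left t) I ->
  Rpower T (- p) * f t <= I.
Proof.
  intros Ht HtT Hp Hm HK Hf Hf0 Hle Heq HI.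
  set (psi := fun s => m * exp (K * s)) in *.
  assert (Hpsi : forall s, is_derive psi s (K * psi s)).
  { intros s. unfold psi. auto_derive; [exact Logic.I|ring]. }
  assert (Hpsi0 : psi 0 = m) by (unfold psi; rewrite Rmult_0_r, exp_0; ring).
  assert (Hcpsi : forall s, continuous psi s) by (intros s; eapply continuous_of_derive, Hpsi).
  set (w := Rpower T (- p)).
  assert (Hw : forall x, 0 < x < t -> w <= Rpower (t - x) (- p)).
  { intros x Hx. unfold w. rewrite !Rpower_Ropp. apply Rinv_le_contravar; [apply Rpower_pos|].
    apply Rle_Rpower_l; lra. }
  assert (Hwt : w <= Rpower t (- p)).
  { unfold w. rewrite !Rpower_Ropp. apply Rinv_le_contravar; [apply Rpower_pos|]. apply Rle_Rpower_l; lra. }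
  (* [h a + k b] is the increment over [a, b] of the function [Th] introduced below, split according
     to its two ends. *)
  set (h := fun a => Rpower (t - a) (- p) * (psi a - f a) - w * psi a).
  set (k := fun b => w * psi b + Rpower (t - b) (- p) * (f b - psi b)).
  assert (Hh : filterlim h (at_right 0) (locally (Rpower t (- p) * (m - 0) - w * m))).
  { apply (filterlim_Rminus (at_right 0)).
    - apply (filterlim_Rmult (at_right 0)).
      + assert (G := continuous_at_right (fun a => Rpower (t - a) (- p)) 0
          (continuous_of_derive _ _ _ (is_derive_Rpower_minus t (- p) 0 Ht))).
        cbv beta in G. rewrite Rminus_0_r in G. exact G.
      + apply (filterlim_Rminus (at_right 0)); [|exact Hf0].
        rewrite <- Hpsi0. apply (continuous_at_right psi), Hcpsi.
    - rewrite <- Hpsi0. apply (continuous_at_right (fun a => w * psi a)).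
      apply (continuous_scal_r w psi), Hcpsi. }
  assert (Hk : filterlim k (at_left t) (locally (w * psi t + 0))).
  { apply (filterlim_Rplus (at_left t)).
    - apply (continuous_at_left (fun b => w * psi b)), (continuous_scal_r w psi), Hcpsi.
    (* f and psi touch at t, so their difference is O(t - b) and compensates the singular factor (t
       - b)^(- p). *)
    - assert (Hd : is_derive (fun s => f s - psi s) t (f2 t - K * psi t)).
      { apply (is_derive_minus f psi); [apply Hf; lra|apply Hpsi]. }
      destruct (is_derive_locally_lipschitz _ _ _ Hd) as [d Hd'].
      set (M := Rabs (f2 t - K * psi t) + 1) in Hd'.
      apply (filterlim_le_le (fun b => (- M) * Rpower (t - b) (1 - p)) (fun b => Rpower (t - b) (- p) * (f b - psi b))
         (fun b => M * Rpower (t - b) (1 - p)) (F := at_left t) 0).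
      + exists d. intros b Hb Hbt. specialize (Hd' b Hb). cbv beta in Hd'.
        replace (f t - psi t) with 0 in Hd' by (rewrite Heq; unfold psi; ring).
        rewrite (Rabs_left (b - t)), Rminus_0_r in Hd' by lra.
        assert (HP := Rpower_pos (t - b) (- p)).
        replace (1 - p) with (- p + 1) by ring. rewrite Rpower_plus, Rpower_1 by lra.
        apply Rabs_le_between in Hd'. nra.
      + replace (Finite 0) with (Finite (- M * 0)) by (f_equal; ring).
        apply (filterlim_Rscal (at_left t)), filterlim_Rpower_left; lra.
      + replace (Finite 0) with (Finite (M * 0)) by (f_equal; ring).
        apply (filterlim_Rscal (at_left t)), filterlim_Rpower_left; lra. }
  assert (Hge : Rpower t (- p) * (m - 0) - w * m + (w * psi t + 0) <= I).
  { refine (is_RInt_gen_ge (at_right 0) (at_left t) _ _ (fun s => 0 < s < t) _ h k I _ _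
      (ends_in_interval t Ht) _ Hh Hk HI).
    intros a b v Hab HD Hv.
    set (Th := fun x => Rpower (t - x) (- p) * (f x - psi x) + w * psi x).
    set (dTh := fun x => - (- p * Rpower (t - x) (- p - 1)) * (f x - psi x)
      + Rpower (t - x) (- p) * (f2 x - K * psi x) + w * (K * psi x)).
    assert (HdTh : forall x, 0 < x < t -> is_derive Th x (dTh x)).
    { intros x Hx. unfold Th, dTh.
      apply (is_derive_plus (fun x => Rpower (t - x) (- p) * (f x - psi x)) (fun x => w * psi x)).
      - apply (is_derive_mult (fun x => Rpower (t - x) (- p)) (fun x => f x - psi x)); [| |exact Rmult_comm].
        + apply is_derive_Rpower_minus, Hx.
        + apply (is_derive_minus f psi); [apply Hf; lra|apply Hpsi].
      - apply (is_derive_scal psi), Hpsi. }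
    apply Rle_trans with (Th b - Th a); [unfold Th, h, k; right; ring|].
    apply (RInt_ge_increment Th dTh (fun s => Rpower (t - s) (- p) * f2 s) a b v Hab); [| |exact Hv].
    { intros x Hx. apply HdTh, HD, Hx. }
    (* The derivative of the kernel is positive and multiplies f - psi <= 0; in front of psi' > 0
       the kernel has been replaced by its lower bound w. *)
    intros x Hx. unfold dTh. assert (Dx := HD x Hx).
    assert (H1 : 0 < p * Rpower (t - x) (- p - 1)) by (apply Rmult_lt_0_compat; [lra|apply Rpower_pos]).
    assert (H2 : f x - psi x <= 0) by (specialize (Hle x ltac:(lra)); unfold psi; lra).
    assert (H3 := Hw x Dx).
    assert (H4 : 0 < K * psi x) by (unfold psi; repeat apply Rmult_lt_0_compat; try lra; apply exp_pos).
    nra. }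
  (* The left end contributes (t^(- p) - w) m, which is nonnegative. *)
  change (f t = psi t) in Heq. rewrite Heq. nra.
Qed.

(** Integrating the exponential gains the factor 1 / K, which is what makes a large K absorb the
    constant of the equation. *)
Lemma le_of_derive_le_exp (w f : R -> R) (t m K : R) : 0 < t -> 0 < m -> 0 < K ->
  (forall s, 0 < s <= t -> is_derive w s (f s)) -> filterlim w (at_right 0) (locally 0) ->
  (forall s, 0 < s <= t -> f s <= m * exp (K * s)) -> w t <= m * exp (K * t) / K.
Proof.
  intros Ht Hm HK Hw Hw0 Hf.
  set (F := fun s => m / K * exp (K * s) - w s).
  assert (H : m / K - 0 <= F t).
  { apply (nondecreasing_from_limit F (fun s => m * exp (K * s) - f s) t _ Ht).
    - intros s Hs. apply (is_derive_minus (fun s => m / K * exp (K * s)) w); [|apply Hw, Hs].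
      auto_derive; [exact I|]. field. lra.
    - intros s Hs. specialize (Hf s Hs). lra.
    - apply (filterlim_Rminus (at_right 0)); [|exact Hw0].
      assert (G := continuous_at_right (fun s => m / K * exp (K * s)) 0).
      cbv beta in G. rewrite Rmult_0_r, exp_0, Rmult_1_r in G. apply G.
      apply (ex_derive_continuous (fun s => m / K * exp (K * s))). auto_derive. exact I. }
  assert (0 < m / K) by (apply Rdiv_lt_0_compat; lra).
  unfold F in H. replace (m * exp (K * t) / K) with (m / K * exp (K * t)) by (field; lra). lra.
Qed.

Lemma caputo_zero_data (w f f2 : R -> R) (p T kap : R) : 0 < T -> 0 < p < 1 ->
  (forall s, 0 < s < T -> is_derive w s (f s)) ->
  (forall s, 0 < s < T -> is_derive f s (f2 s)) ->
  filterlim w (at_right 0) (locally 0) -> filterlim f (at_right 0) (locally 0) ->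
  (forall t, 0 < t < T -> is_RInt_gen (fun s => Rpower (t - s) (- p) * f2 s) (at_right 0) (at_left t) (kap * w t)) ->
  forall t, 0 < t < T -> w t = 0.
Proof.
  (* At a contact point, T^(- p) f <= |kap| f / K, that is K <= |kap| T^p; the added 1 excludes
     this. *)
  intros HT Hp. set (K := Rabs kap * Rpower T p + 1).
  assert (HK : 0 < K).
  { unfold K. assert (0 <= Rabs kap * Rpower T p) by (apply Rmult_le_pos; [apply Rabs_pos|apply Rlt_le, Rpower_pos]). lra. }
  (* Quantified over the functions because f may touch the majorant from below or - f may; both
     signs are needed. *)
  assert (Core : forall w f f2 : R -> R,
    (forall s, 0 < s < T -> is_derive w s (f s)) ->
    (forall s, 0 < s < T -> is_derive f s (f2 s)) ->
    filterlim w (at_right 0) (locally 0) -> filterlim f (at_right 0) (locally 0) ->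
    (forall t, 0 < t < T -> is_RInt_gen (fun s => Rpower (t - s) (- p) * f2 s) (at_right 0) (at_left t) (kap * w t)) ->
    forall t m, 0 < t < T -> 0 < m -> (forall s, 0 < s <= t -> Rabs (f s) <= m * exp (K * s)) ->
      f t <> m * exp (K * t)).
  { clear w f f2. intros w f f2 Hw Hf Hw0 Hf0 HI t m Ht Hm Hle Heq.
    assert (Hlow := caputo_at_maximum f f2 p t T m K _ ltac:(lra) ltac:(lra) Hp Hm HK Hf Hf0
      (fun s Hs => Rle_trans _ _ _ (Rle_abs _) (Hle s Hs)) Heq (HI t Ht)).
    assert (W1 : w t <= m * exp (K * t) / K).
    { apply (le_of_derive_le_exp w f); auto; try lra.
      - intros; apply Hw; lra.
      - intros s Hs. eapply Rle_trans; [apply Rle_abs|apply Hle, Hs]. }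
    assert (W2 : - w t <= m * exp (K * t) / K).
    { apply (le_of_derive_le_exp (fun s => - w s) (fun s => - f s)); auto; try lra.
      - intros s Hs. apply (is_derive_opp w), Hw; lra.
      - assert (L := filterlim_Ropp (at_right 0) _ _ Hw0). rewrite Ropp_0 in L. exact L.
      - intros s Hs. eapply Rle_trans; [|apply Hle, Hs]. rewrite <- Rabs_Ropp. apply Rle_abs. }
    rewrite <- Heq in W1, W2.
    assert (Hft : 0 < f t) by (rewrite Heq; apply Rmult_lt_0_compat; [exact Hm|apply exp_pos]).
    assert (W : Rabs (w t) <= f t / K) by (apply Rabs_le; lra).
    assert (H1 : kap * w t <= Rabs kap * (f t / K)).
    { eapply Rle_trans; [apply Rle_abs|]. rewrite Rabs_mult. apply Rmult_le_compat_l; [apply Rabs_pos|exact W]. }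
    assert (H2 : Rpower T (- p) * f t <= Rabs kap * (f t / K)) by lra.
    assert (HTp := Rpower_pos T p). rewrite Rpower_Ropp in H2.
    apply Rmult_le_compat_l with (r := Rpower T p * K / f t) in H2.
    2:{ apply Rlt_le, Rdiv_lt_0_compat; [apply Rmult_lt_0_compat|]; assumption. }
    replace (Rpower T p * K / f t * (/ Rpower T p * f t)) with K in H2 by (field; lra).
    replace (Rpower T p * K / f t * (Rabs kap * (f t / K))) with (Rabs kap * Rpower T p) in H2 by (field; lra).
    unfold K in H2. lra. }
  intros Hw Hf Hw0 Hf0 HI.
  assert (Hneg := Core (fun s => - w s) (fun s => - f s) (fun s => - f2 s)).
  assert (Hpos := Core w f f2 Hw Hf Hw0 Hf0 HI). clear Core.
  assert (Hopp : forall g : R -> R, filterlim g (at_right 0) (locally 0) -> filterlim (fun s => - g s) (at_right 0) (locally 0)).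
  { intros g Hg. assert (L := filterlim_Ropp (at_right 0) _ _ Hg). rewrite Ropp_0 in L. exact L. }
  assert (Hneg' : forall t m, 0 < t < T -> 0 < m -> (forall s, 0 < s <= t -> Rabs (- f s) <= m * exp (K * s)) ->
      - f t <> m * exp (K * t)).
  { apply Hneg.
    - intros s Hs. apply (is_derive_opp w), Hw, Hs.
    - intros s Hs. apply (is_derive_opp f), Hf, Hs.
    - apply Hopp, Hw0.
    - apply Hopp, Hf0.
    - intros t Ht. assert (H := is_RInt_gen_opp _ _ (HI t Ht)).
      replace (kap * - w t) with (opp (kap * w t)) by (unfold opp; simpl; ring).
      refine (is_RInt_gen_ext_interval _ _ _ _ (proj1 Ht) _ H).
      intros s Hs. Rsimp. ring. }
  clear Hneg.
  assert (Hf_zero : forall t, 0 < t < T -> f t = 0).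
  { intros t Ht.
    (* Extended by 0 to the left, f is continuous at 0, so g attains its maximum on [0, t]. A
       positive maximum is attained away from 0, which is a contact point for f or - f. *)
    set (g := fun s => Rabs (if Rle_dec s 0 then 0 else f s) * exp (- (K * s))).
    assert (Hg : forall s, 0 <= s <= t -> continuity_pt g s).
    { intros s Hs. apply continuity_pt_filterlim.
      apply (continuous_mult (fun s => Rabs (if Rle_dec s 0 then 0 else f s)) (fun s => exp (- (K * s)))).
      2:{ apply (ex_derive_continuous (fun s => exp (- (K * s)))). auto_derive. exact I. }
      apply (continuous_comp (fun s => if Rle_dec s 0 then 0 else f s) Rabs); [|apply (continuous_Rabs)].
      destruct Hs as [[Hs|<-] Hs'].
      - apply (continuous_ext_loc _ f).
        + exists (mkposreal s Hs). intros y Hy. unball. apply Rabs_def2 in Hy.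
          destruct (Rle_dec y 0); [lra|reflexivity].
        + eapply continuous_of_derive, Hf; lra.
      - apply filterlim_locally. intros eps.
        destruct (proj1 (filterlim_locally _ _) Hf0 eps) as [d Hd]. exists d. intros y Hy.
        destruct (Rle_dec 0 0) as [_|]; [|lra].
        destruct (Rle_dec y 0); [apply ball_center|]. apply Hd; [exact Hy|lra]. }
    destruct (continuity_ab_maj g 0 t ltac:(lra) Hg) as [x [Hx1 Hx2]].
    assert (Hgf : forall s, 0 < s -> Rabs (f s) = g s * exp (K * s)).
    { intros s Hs. unfold g. destruct (Rle_dec s 0); [lra|].
      rewrite Rmult_assoc, <- exp_plus. replace (- (K * s) + K * s) with 0 by ring. rewrite exp_0; ring. }
    destruct (Rle_lt_dec (g x) 0) as [Hle|Hlt].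
    { assert (H := Hx1 t ltac:(lra)). assert (Habs := Hgf t ltac:(lra)). assert (0 <= Rabs (f t)) by apply Rabs_pos.
      assert (0 < exp (K * t)) by apply exp_pos.
      assert (Rabs (f t) = 0) by nra. destruct (Req_dec (f t) 0); [assumption|]. exfalso. apply (Rabs_no_R0 (f t)); assumption. }
    exfalso.
    assert (Hx0 : 0 < x).
    { destruct (Req_dec x 0) as [->|]; [|lra]. unfold g in Hlt. destruct (Rle_dec 0 0); [|lra].
      rewrite Rabs_R0 in Hlt. lra. }
    assert (Hb : forall s, 0 < s <= x -> Rabs (f s) <= g x * exp (K * s)).
    { intros s Hs. rewrite Hgf by lra. apply Rmult_le_compat_r; [apply Rlt_le, exp_pos|]. apply Hx1; lra. }
    assert (Hxe := Hgf x Hx0). unfold Rabs in Hxe at 1. destruct (Rcase_abs (f x)).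
    - apply (Hneg' x (g x) ltac:(lra) Hlt); [|exact Hxe]. intros s Hs. rewrite Rabs_Ropp. apply Hb, Hs.
    - apply (Hpos x (g x) ltac:(lra) Hlt); [exact Hb|exact Hxe]. }
  intros t Ht. apply Rle_antisym.
  - assert (H := nondecreasing_from_limit (fun s => - w s) (fun s => - f s) t 0 ltac:(lra)).
    assert (0 <= - w t); [|lra]. apply H.
    + intros s Hs. apply (is_derive_opp w), Hw; lra.
    + intros s Hs. rewrite Hf_zero by lra. lra.
    + apply Hopp, Hw0.
  - apply (nondecreasing_from_limit w f t 0 ltac:(lra)); [| |exact Hw0].
    + intros s Hs. apply Hw; lra.
    + intros s Hs. rewrite Hf_zero by lra. lra.
Qed.

(** * The scalar problem with both side conditions *)

Section Nonlocal.
Variables (alpha c T : R).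
Hypotheses (Halpha : 1 < alpha < 2) (Hc : c < 0) (HT : 0 < T).

Let Ha : 1 < alpha := proj1 Halpha.

Notation m := (mlk alpha).

(* [E_{alpha,1}(c t^alpha)] and [t E_{alpha,2}(c t^alpha)], which extend
   [mlk alpha 1 c] and [mlk alpha 2 c] continuously to [t <= 0]. *)
Definition ml1 (t : R) : R := PSeries (ml_coef alpha 1) (c * rpow t alpha).
Definition ml2 (t : R) : R := t * PSeries (ml_coef alpha 2) (c * rpow t alpha).

Lemma continuous_ml_rpow (mu t : R) : 0 < mu ->
  continuous (fun t => PSeries (ml_coef alpha mu) (c * rpow t alpha)) t.
Proof.
  intros Hmu. apply (continuous_comp (fun t => c * rpow t alpha) (PSeries (ml_coef alpha mu))).
  - apply (continuous_scal_r c (fun t => rpow t alpha)), continuous_rpow. lra.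
  - apply continuous_entire, entire_ml; assumption.
Qed.

Lemma continuous_ml1 (t : R) : continuous ml1 t.
Proof. apply (continuous_ml_rpow 1 t). lra. Qed.

Lemma continuous_ml2 (t : R) : continuous ml2 t.
Proof.
  apply (continuous_mult (fun t => t) (fun t => PSeries (ml_coef alpha 2) (c * rpow t alpha)));
    [apply continuous_id|apply (continuous_ml_rpow 2 t); lra].
Qed.

Lemma ml1_eq (t : R) : 0 < t -> ml1 t = m 1 c t.
Proof.
  intros Ht. unfold ml1, mlk, gps. rewrite PSeries_pow, rpow_pos by exact Ht.
  replace (1 - 1) with 0 by ring. rewrite Rpower_O by exact Ht. ring.
Qed.

Lemma ml2_eq (t : R) : 0 < t -> ml2 t = m 2 c t.
Proof.
  intros Ht. unfold ml2, mlk, gps. rewrite PSeries_pow, rpow_pos by exact Ht.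
  replace (2 - 1) with 1 by ring. rewrite Rpower_1 by exact Ht. ring.
Qed.

Lemma ml1_0 : ml1 0 = 1.
Proof.
  unfold ml1. rewrite rpow_neg, Rmult_0_r, PSeries_0 by lra. unfold ml_coef. simpl.
  rewrite Rmult_0_r, Rplus_0_l, Gamma_1. apply Rinv_1.
Qed.

Lemma ml2_0 : ml2 0 = 0.
Proof. unfold ml2. ring. Qed.

Lemma is_derive_ext_pos (f g : R -> R) (t l : R) : 0 < t -> (forall s, 0 < s -> f s = g s) ->
  is_derive f t l -> is_derive g t l.
Proof.
  intros Ht Hfg. apply is_derive_ext_loc. exists (mkposreal t Ht). intros y Hy. unball.
  apply Rabs_def2 in Hy. apply Hfg. lra.
Qed.

Lemma is_derive_ml1 (t : R) : 0 < t -> is_derive ml1 t (c * m alpha c t).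
Proof.
  intros Ht. apply (is_derive_ext_pos (m 1 c)); [exact Ht|intros; symmetry; apply ml1_eq; assumption|].
  apply is_derive_mlk_1; assumption.
Qed.

Lemma is_derive_ml2 (t : R) : 0 < t -> is_derive ml2 t (ml1 t).
Proof.
  intros Ht. apply (is_derive_ext_pos (m 2 c)); [exact Ht|intros; symmetry; apply ml2_eq; assumption|].
  rewrite ml1_eq by exact Ht. replace (m 1 c t) with (m (2 - 1) c t) by (f_equal; ring).
  apply is_derive_mlk; lra.
Qed.

(** F is a primitive of g only on (0, T]. Its difference with the integral of g has derivative 0
    there and known limits at 0; monotonicity in both directions makes it constant. *)
Lemma RInt_from_limit (g F : R -> R) (l : R) : (forall t, continuous g t) ->
  (forall t, 0 < t <= T -> is_derive F t (g t)) -> filterlim F (at_right 0) (locally l) ->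
  is_RInt g 0 T (F T - l).
Proof.
  intros Hg HF Hl.
  assert (HdG : forall t, is_derive (fun t => RInt g 0 t) t (g t)) by (intros; apply is_derive_RInt_upper, Hg).
  assert (HlG : filterlim (fun t => RInt g 0 t) (at_right 0) (locally 0)).
  { assert (G := continuous_at_right (fun t => RInt g 0 t) 0 (continuous_of_derive _ _ _ (HdG 0))).
    cbv beta in G. rewrite RInt_point in G. exact G. }
  assert (L1 : filterlim (fun t => RInt g 0 t - F t) (at_right 0) (locally (0 - l))).
  { apply (filterlim_Rminus (at_right 0)); assumption. }
  assert (L2 : filterlim (fun t => F t - RInt g 0 t) (at_right 0) (locally (l - 0))).
  { apply (filterlim_Rminus (at_right 0)); assumption. }
  apply (nondecreasing_from_limit _ (fun t => g t - g t) T _ HT) in L1.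
  2:{ intros t Ht. apply (is_derive_minus (fun t => RInt g 0 t) F); [apply HdG|apply HF, Ht]. }
  2:{ intros; lra. }
  apply (nondecreasing_from_limit _ (fun t => g t - g t) T _ HT) in L2.
  2:{ intros t Ht. apply (is_derive_minus F (fun t => RInt g 0 t)); [apply HF, Ht|apply HdG]. }
  2:{ intros; lra. }
  replace (F T - l) with (RInt g 0 T) by lra.
  apply (RInt_correct g), ex_RInt_cont, Hg.
Qed.

Lemma is_RInt_ml1 : is_RInt ml1 0 T (m 2 c T).
Proof.
  replace (m 2 c T) with (m 2 c T - 0) by ring.
  apply (RInt_from_limit ml1 (m 2 c)).
  - apply continuous_ml1.
  - intros t Ht. rewrite ml1_eq by lra. replace (m 1 c t) with (m (2 - 1) c t) by (f_equal; ring).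
    apply is_derive_mlk; lra.
  - apply mlk_lim_0; lra.
Qed.

Lemma is_RInt_ml2 : is_RInt ml2 0 T (m 3 c T).
Proof.
  replace (m 3 c T) with (m 3 c T - 0) by ring.
  apply (RInt_from_limit ml2 (m 3 c)).
  - apply continuous_ml2.
  - intros t Ht. rewrite ml2_eq by lra. replace (m 2 c t) with (m (3 - 1) c t) by (f_equal; ring).
    apply is_derive_mlk; lra.
  - apply mlk_lim_0; lra.
Qed.

(** [c * m (alpha - 1) c] is the second derivative of [ml1], so this is D^alpha ml1 = c ml1
    multiplied by Gamma(2 - alpha). The indices fit because (alpha - 1) + (2 - alpha) = 1. *)
Lemma caputo_ml1 (t : R) : 0 < t ->
  is_RInt_gen (fun s => Rpower (t - s) (- (alpha - 1)) * (c * m (alpha - 1) c s)) (at_right 0) (at_left t)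
    (c * Gamma (2 - alpha) * ml1 t).
Proof.
  intros Ht. assert (H := mlk_frac_integral alpha Ha (alpha - 1) (2 - alpha) c t ltac:(lra) ltac:(lra) Ht).
  replace (alpha - 1 + (2 - alpha)) with 1 in H by ring.
  apply (is_RInt_gen_scal _ c) in H. rewrite ml1_eq by exact Ht.
  replace (c * Gamma (2 - alpha) * m 1 c t) with (scal c (Gamma (2 - alpha) * m 1 c t)) by (Rsimp; ring).
  refine (is_RInt_gen_ext_interval _ _ _ _ Ht _ H).
  intros s Hs. Rsimp. Req.
  replace (- (alpha - 1)) with (2 - alpha - 1) by ring. ring.
Qed.

Lemma caputo_ml2 (t : R) : 0 < t ->
  is_RInt_gen (fun s => Rpower (t - s) (- (alpha - 1)) * (c * m alpha c s)) (at_right 0) (at_left t)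
    (c * Gamma (2 - alpha) * ml2 t).
Proof.
  intros Ht. assert (H := mlk_frac_integral alpha Ha alpha (2 - alpha) c t ltac:(lra) ltac:(lra) Ht).
  replace (alpha + (2 - alpha)) with 2 in H by ring.
  apply (is_RInt_gen_scal _ c) in H. rewrite ml2_eq by exact Ht.
  replace (c * Gamma (2 - alpha) * m 2 c t) with (scal c (Gamma (2 - alpha) * m 2 c t)) by (Rsimp; ring).
  refine (is_RInt_gen_ext_interval _ _ _ _ Ht _ H).
  intros s Hs. Rsimp. Req.
  replace (- (alpha - 1)) with (2 - alpha - 1) by ring. ring.
Qed.

(** With a = w(0) and b the limit of w' at 0, the function w - a m_1 - b m_2 has zero initial data
    and solves the same equation, so it vanishes. The two side conditions then form a homogeneous
    system for (a, b) with positive determinant. *)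
Lemma scalar_nonlocal_unique (w f f2 : R -> R) :
  (forall t, 0 <= t <= T -> filterlim w (within (fun s => 0 <= s <= T) (locally t)) (locally (w t))) ->
  (forall s, 0 < s < T -> is_derive w s (f s)) ->
  (forall s, 0 < s < T -> is_derive f s (f2 s)) ->
  (forall t, 0 < t < T -> is_RInt_gen (fun s => Rpower (t - s) (- (alpha - 1)) * f2 s) (at_right 0) (at_left t)
     (c * Gamma (2 - alpha) * w t)) ->
  w 0 = w T -> is_RInt w 0 T 0 -> forall t, 0 <= t <= T -> w t = 0.
Proof.
  intros Hcont Hw Hf HI HwT Hint.
  (* The Caputo integral at a single time gives the limit of w' at 0; T / 2 is an arbitrary choice
     in (0, T). *)
  destruct (ex_limit_of_weighted_integral f f2 (alpha - 1) (T / 2) _ ltac:(lra) ltac:(lra)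
    (fun s Hs => Hf s ltac:(lra)) (HI (T / 2) ltac:(lra))) as [b Hb].
  set (a := w 0) in *.
  assert (Hzero : forall t, 0 < t < T -> w t - (a * ml1 t + b * ml2 t) = 0).
  { apply (caputo_zero_data (fun t => w t - (a * ml1 t + b * ml2 t))
       (fun t => f t - (a * (c * m alpha c t) + b * m 1 c t))
       (fun t => f2 t - (a * (c * m (alpha - 1) c t) + b * (c * m alpha c t))) (alpha - 1) T (c * Gamma (2 - alpha)) HT ltac:(lra)).
    - intros s Hs. apply (is_derive_minus w (fun t => a * ml1 t + b * ml2 t)); [apply Hw, Hs|].
      apply (is_derive_plus (fun t => a * ml1 t) (fun t => b * ml2 t)); apply is_derive_scal.
      + apply is_derive_ml1; lra.
      + rewrite <- ml1_eq by lra. apply is_derive_ml2; lra.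
    - intros s Hs. apply (is_derive_minus f (fun t => a * (c * m alpha c t) + b * m 1 c t)); [apply Hf, Hs|].
      apply (is_derive_plus (fun t => a * (c * m alpha c t)) (fun t => b * m 1 c t)); apply is_derive_scal.
      + apply is_derive_scal. apply is_derive_mlk; lra.
      + apply is_derive_mlk_1; lra.
    - replace 0 with (a - (a * ml1 0 + b * ml2 0)) at 2 by (rewrite ml1_0, ml2_0; ring).
      apply (filterlim_Rminus (at_right 0)).
      + eapply filterlim_filter_le_1; [|apply (Hcont 0); lra].
        intros P [d Hd]. exists (mkposreal (Rmin d T) ltac:(apply Rmin_pos; [apply cond_pos|exact HT])).
        intros y Hy Hy0. assert (M1 := Rmin_l d T). assert (M2 := Rmin_r d T). unball. apply Hd; [lra|].
        apply Rabs_def2 in Hy. lra.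
      + apply (continuous_at_right (fun t => a * ml1 t + b * ml2 t)).
        apply (continuous_plus (fun t => a * ml1 t) (fun t => b * ml2 t)).
        * apply (continuous_scal_r a ml1), continuous_ml1.
        * apply (continuous_scal_r b ml2), continuous_ml2.
    - replace 0 with (b - (a * (c * 0) + b * 1)) at 2 by ring.
      apply (filterlim_Rminus (at_right 0)); [exact Hb|].
      apply (filterlim_Rplus (at_right 0)); repeat apply (filterlim_Rscal (at_right 0)).
      + apply mlk_lim_0; lra.
      + apply mlk_1_lim_0; lra.
    - intros t Ht.
      assert (H := is_RInt_gen_minus _ _ _ _ (HI t Ht) (is_RInt_gen_plus _ _ _ _
        (is_RInt_gen_scal _ a _ (caputo_ml1 t (proj1 Ht))) (is_RInt_gen_scal _ b _ (caputo_ml2 t (proj1 Ht))))).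
      replace (c * Gamma (2 - alpha) * (w t - (a * ml1 t + b * ml2 t))) with
        (minus (c * Gamma (2 - alpha) * w t) (plus (scal a (c * Gamma (2 - alpha) * ml1 t)) (scal b (c * Gamma (2 - alpha) * ml2 t)))).
      2:{ Rsimp. ring. }
      refine (is_RInt_gen_ext_interval _ _ _ _ (proj1 Ht) _ H).
      intros s Hs. Rsimp. ring. }
  assert (HwE : forall t, 0 <= t <= T -> w t = a * ml1 t + b * ml2 t).
  { intros t Ht. destruct (Req_dec t 0) as [->|]; [rewrite ml1_0, ml2_0; fold a; ring|].
    destruct (Req_dec t T) as [->|]; [|specialize (Hzero t ltac:(lra)); lra].
    assert (HL : filterlim w (at_left T) (locally (w T))).
    { eapply filterlim_filter_le_1; [|apply (Hcont T); lra].
      intros P [d Hd]. exists (mkposreal (Rmin d T) ltac:(apply Rmin_pos; [apply cond_pos|exact HT])).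
      intros y Hy Hy0. assert (M1 := Rmin_l d T). assert (M2 := Rmin_r d T). unball. apply Hd; [lra|].
      apply Rabs_def2 in Hy. lra. }
    refine (filterlim_locally_unique (V := R_NormedModule) (F := at_left T) w _ _ HL _).
    apply (filterlim_ext_loc (fun t => a * ml1 t + b * ml2 t)).
    - exists (mkposreal T HT). intros y Hy Hy0. unball. apply Rabs_def2 in Hy. specialize (Hzero y ltac:(lra)). lra.
    - apply (continuous_at_left (fun t => a * ml1 t + b * ml2 t)).
      apply (continuous_plus (fun t => a * ml1 t) (fun t => b * ml2 t)).
      + apply (continuous_scal_r a ml1), continuous_ml1.
      + apply (continuous_scal_r b ml2), continuous_ml2. }
  assert (Eq1 : a = a * m 1 c T + b * m 2 c T).
  { transitivity (w T); [exact HwT|]. rewrite HwE, ml1_eq, ml2_eq by lra. reflexivity. }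
  assert (Eq2 : 0 = a * m 2 c T + b * m 3 c T).
  { assert (H : is_RInt w 0 T (plus (scal a (m 2 c T)) (scal b (m 3 c T)))).
    { apply (is_RInt_ext (fun t => plus (scal a (ml1 t)) (scal b (ml2 t)))).
      - rewrite Rmin_left, Rmax_right by lra. intros t Ht. rewrite HwE by lra. reflexivity.
      - apply (is_RInt_plus (fun t => scal a (ml1 t)) (fun t => scal b (ml2 t))).
        + exact (is_RInt_scal (V := R_NormedModule) ml1 0 T a _ is_RInt_ml1).
        + exact (is_RInt_scal (V := R_NormedModule) ml2 0 T b _ is_RInt_ml2). }
    rewrite <- (is_RInt_unique (V := R_CompleteNormedModule) _ _ _ _ Hint).
    apply (is_RInt_unique (V := R_CompleteNormedModule)), H. }
  assert (Hdet := mlk_determinant_pos alpha Halpha c T Hc HT).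
  set (M1 := m 1 c T) in *. set (M2 := m 2 c T) in *. set (M3 := m 3 c T) in *.
  (* Cramer's rule: the two equations are combined with the cofactors, so that the determinant
     multiplies a, and next b. *)
  assert (Ha0 : a = 0).
  { apply Rmult_eq_reg_r with (M2 ^ 2 + M3 * (1 - M1)); [|lra].
    replace (a * (M2 ^ 2 + M3 * (1 - M1))) with (M2 * (a * M2 + b * M3) + M3 * (a - (a * M1 + b * M2))) by ring.
    rewrite <- Eq1, <- Eq2. ring. }
  assert (Hb0 : b = 0).
  { apply Rmult_eq_reg_r with (M2 ^ 2 + M3 * (1 - M1)); [|lra].
    replace (b * (M2 ^ 2 + M3 * (1 - M1))) with ((1 - M1) * (a * M2 + b * M3) - M2 * (a - (a * M1 + b * M2))) by ring.
    rewrite <- Eq1, <- Eq2. ring. }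
  intros t Ht. rewrite HwE, Ha0, Hb0 by exact Ht. ring.
Qed.

End Nonlocal.

(** * Diagonal operators in Hilbert space *)

(* Used with [rip] the real part of a possibly complex inner product and
   [pr k x = (x, v_k) v_k], so that one argument covers both scalar fields. *)
Record orthogonal_resolution (V : NormedModule R_AbsRing) (rip : V -> V -> R) (pr : nat -> V -> V) : Prop := {
  rip_plus_l : forall x y z, rip (plus x y) z = rip x z + rip y z;
  rip_scal_l : forall (a : R) x y, rip (scal a x) y = a * rip x y;
  rip_sym : forall x y, rip x y = rip y x;
  rip_norm : forall x, rip x x = norm x ^ 2;
  pr_sym : forall k x y, rip (pr k x) y = rip x (pr k y);
  pr_idem : forall k x, pr k (pr k x) = pr k x;
  pr_orth : forall j k x y, j <> k -> rip (pr j x) (pr k y) = 0;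
  pr_total : forall x, (forall k, pr k x = zero) -> x = zero;
  cauchy_series_converges : forall a : nat -> V, Cauchy_series a -> ex_series a
}.

Arguments rip_plus_l {V rip pr}.
Arguments rip_scal_l {V rip pr}.
Arguments rip_sym {V rip pr}.
Arguments rip_norm {V rip pr}.
Arguments pr_sym {V rip pr}.
Arguments pr_idem {V rip pr}.
Arguments pr_orth {V rip pr}.
Arguments pr_total {V rip pr}.
Arguments cauchy_series_converges {V rip pr}.

(** The operator acting as multiplication by [g k] on the range of [pr k]. It is made total by
    choice; for bounded g, [is_series_diag] shows that the chosen vector is the sum of the
    series. *)
Definition diag {V : NormedModule R_AbsRing} (pr : nat -> V -> V) (g : nat -> R) (x : V) : V :=
  epsilon (inhabits zero) (is_series (fun k => scal (g k) (pr k x))).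

Section Resolution.
Context {V : NormedModule R_AbsRing} {rip : V -> V -> R} {pr : nat -> V -> V}.
Hypothesis HV : orthogonal_resolution V rip pr.

Lemma rip_zero_l (y : V) : rip zero y = 0.
Proof.
  assert (H := rip_plus_l HV zero zero y). rewrite plus_zero_l in H. lra.
Qed.

Lemma rip_opp_l (x y : V) : rip (opp x) y = - rip x y.
Proof.
  assert (H := rip_plus_l HV x (opp x) y). rewrite (plus_opp_r (G := V)), rip_zero_l in H. lra.
Qed.

Lemma rip_minus_l (x y z : V) : rip (minus x y) z = rip x z - rip y z.
Proof.
  change (minus x y) with (plus x (opp y)). rewrite (rip_plus_l HV), rip_opp_l. ring.
Qed.

Lemma rip_plus_r (x y z : V) : rip x (plus y z) = rip x y + rip x z.
Proof. rewrite (rip_sym HV), (rip_plus_l HV), !(rip_sym HV x). reflexivity. Qed.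

Lemma rip_scal_r (a : R) (x y : V) : rip x (scal a y) = a * rip x y.
Proof. rewrite (rip_sym HV), (rip_scal_l HV), (rip_sym HV x). reflexivity. Qed.

Lemma rip_self_zero (x : V) : rip x x = 0 -> x = zero.
Proof.
  intros H. apply (norm_eq_zero (V := V)). rewrite (rip_norm HV) in H.
  assert (0 <= norm x) by apply norm_ge_0. nra.
Qed.

Lemma rip_le (x y : V) : Rabs (rip x y) <= norm x * norm y.
Proof.
  assert (Hx : 0 <= norm x) by apply norm_ge_0. assert (Hy : 0 <= norm y) by apply norm_ge_0.
  destruct Hy as [Hy|Hy].
  2:{ symmetry in Hy. apply (norm_eq_zero (V := V)) in Hy. subst y.
      rewrite (rip_sym HV), rip_zero_l, Rabs_R0. apply Rmult_le_pos; [exact Hx|apply norm_ge_0]. }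
  set (b := rip x y). set (n := norm y) in *.
  (* The vector is n^2 times the component of x orthogonal to y, which avoids dividing by n^2. *)
  assert (H : 0 <= rip (minus (scal (n ^ 2) x) (scal b y)) (minus (scal (n ^ 2) x) (scal b y))).
  { rewrite (rip_norm HV). apply pow2_ge_0. }
  rewrite rip_minus_l, !(rip_scal_l HV) in H.
  rewrite (rip_sym HV x), (rip_sym HV y) in H.
  rewrite !rip_minus_l, !(rip_scal_l HV), (rip_sym HV y x) in H.
  rewrite !(rip_norm HV) in H. fold b n in H.
  assert (H2 : 0 <= n ^ 2 * (n ^ 2 * norm x ^ 2 - b ^ 2)) by lra.
  assert (Hn2 : 0 < n ^ 2) by (apply pow_lt, Hy).
  assert (H3 : b ^ 2 <= (norm x * n) ^ 2).
  { rewrite Rpow_mult_distr. nra. }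
  apply Rsqr_incr_0; [|apply Rabs_pos|nra].
  rewrite <- Rsqr_abs, !Rsqr_pow2. exact H3.
Qed.

Lemma is_linear_rip (y : V) : is_linear (V := R_NormedModule) (fun x => rip x y).
Proof.
  apply Build_is_linear.
  - intros a b. apply (rip_plus_l HV).
  - intros k x. apply (rip_scal_l HV).
  - exists (norm y + 1). assert (Hy : 0 <= norm y) by apply norm_ge_0. split; [lra|].
    intros x. assert (Hx : 0 <= norm x) by apply norm_ge_0.
    change (Rabs (rip x y) <= (norm y + 1) * norm x). assert (H := rip_le x y). nra.
Qed.

(** Each projection of x - y has inner product 0 with itself, and the projections are total. Every
    vector identity below is reduced to its coordinates in this way. *)
Lemma rip_ext (x y : V) : (forall k z, rip x (pr k z) = rip y (pr k z)) -> x = y.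
Proof.
  intros H. assert (E : minus x y = zero).
  { apply (pr_total HV). intros k. apply rip_self_zero.
    rewrite (pr_sym HV), (pr_idem HV), rip_minus_l, H. ring. }
  apply (plus_reg_r (G := V) (opp y)). rewrite (plus_opp_r (G := V)). exact E.
Qed.

Lemma rip_sum_l (a : nat -> V) (y : V) (n : nat) : rip (sum_n a n) y = sum_n (fun k => rip (a k) y) n.
Proof.
  induction n as [|n IH]; [rewrite !sum_O; reflexivity|].
  rewrite !sum_Sn, (rip_plus_l HV), IH. reflexivity.
Qed.

Lemma sum_n_zero_R (u : nat -> R) (n : nat) : (forall k, (k <= n)%nat -> u k = 0) -> sum_n u n = 0.
Proof.
  induction n as [|n IH]; intros H; [rewrite sum_O; apply H; lia|].
  rewrite sum_Sn, IH, H; [unfold plus; simpl; ring|lia|]. intros; apply H; lia.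
Qed.

(** Pythagoras. The second conjunct, orthogonality of the sum to all later projections, is what the
    induction needs to drop the cross terms. *)
Lemma norm_sum_n_m_sq (g : nat -> R) (x : V) (n m : nat) :
  norm (sum_n_m (fun k => scal (g k) (pr k x)) n m) ^ 2 = sum_n_m (fun k => g k ^ 2 * norm (pr k x) ^ 2) n m /\
  (forall j, (m < j)%nat -> rip (sum_n_m (fun k => scal (g k) (pr k x)) n m) (pr j x) = 0).
Proof.
  destruct (Nat.lt_ge_cases m n) as [Hmn|Hnm].
  { rewrite !sum_n_m_zero by exact Hmn. split.
    { assert (Hz := norm_zero (V := V)). transitivity (0 ^ 2); [rewrite <- Hz; reflexivity|simpl; Req; unfold zero; simpl; ring]. }
    intros; apply rip_zero_l. }
  induction m as [|m IH].
  - assert (n = 0)%nat by lia. subst n. rewrite !sum_n_n. split.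
    + rewrite <- !(rip_norm HV), (rip_scal_l HV), rip_scal_r. ring.
    + intros j Hj. rewrite (rip_scal_l HV), (pr_orth HV) by lia. ring.
  - destruct (Nat.eq_dec n (S m)) as [->|Hne].
    + rewrite !sum_n_n. split.
      * rewrite <- !(rip_norm HV), (rip_scal_l HV), rip_scal_r. ring.
      * intros j Hj. rewrite (rip_scal_l HV), (pr_orth HV) by lia. ring.
    + destruct (IH ltac:(lia)) as [IH1 IH2]. rewrite !sum_n_Sm by lia.
      set (S := sum_n_m _ n m) in *. split.
      * rewrite <- (rip_norm HV), (rip_plus_l HV), !rip_plus_r.
        rewrite !(rip_scal_l HV), !rip_scal_r, (rip_sym HV (pr _ _) S), IH2, !(rip_norm HV), IH1 by lia.
        unfold plus; simpl. ring.
      * intros j Hj. rewrite (rip_plus_l HV), IH2, (rip_scal_l HV), (pr_orth HV) by lia. ring.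
Qed.

(** The partial sum S satisfies (S, x) = |S|^2, and Cauchy-Schwarz bounds this by |S| |x|. *)
Lemma bessel (x : V) (n : nat) : sum_n (fun k => norm (pr k x) ^ 2) n <= norm x ^ 2.
Proof.
  set (S := sum_n (fun k => scal 1 (pr k x)) n).
  assert (HS : norm S ^ 2 = sum_n (fun k => norm (pr k x) ^ 2) n).
  { unfold S, sum_n. rewrite (proj1 (norm_sum_n_m_sq (fun _ => 1) x 0 n)).
    apply sum_n_m_ext. intros; simpl; ring. }
  assert (HxS : rip S x = norm S ^ 2).
  { rewrite HS. unfold S. rewrite rip_sum_l. apply sum_n_ext. intros k.
    rewrite (rip_scal_l HV), Rmult_1_l, <- (rip_norm HV), (pr_sym HV k x (pr k x)), (pr_idem HV).
    apply (rip_sym HV). }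
  assert (HCS := rip_le S x). rewrite HxS, Rabs_pos_eq in HCS by apply pow2_ge_0.
  assert (H0 : 0 <= norm S) by apply norm_ge_0. assert (H1 : 0 <= norm x) by apply norm_ge_0.
  rewrite <- HS. destruct H0 as [H0|H0]; [nra|rewrite <- H0; nra].
Qed.

Definition bounded_seq (g : nat -> R) : Prop := exists M, forall k, Rabs (g k) <= M.

Lemma sum_n_m_le_R (u w : nat -> R) (n m : nat) : (forall k, u k <= w k) -> sum_n_m u n m <= sum_n_m w n m.
Proof. intros H. apply (sum_n_m_le u w n m H). Qed.

Lemma norm_sum_diag_le (g : nat -> R) (M : R) (x : V) (n : nat) : (forall k, Rabs (g k) <= M) ->
  norm (sum_n (fun k => scal (g k) (pr k x)) n) <= M * norm x.
Proof.
  intros HM. assert (HM0 : 0 <= M) by (eapply Rle_trans; [apply Rabs_pos|apply (HM 0%nat)]).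
  assert (Hx : 0 <= norm x) by apply norm_ge_0.
  apply Rsqr_incr_0; [|apply norm_ge_0|apply Rmult_le_pos; assumption].
  rewrite !Rsqr_pow2, Rpow_mult_distr. unfold sum_n. rewrite (proj1 (norm_sum_n_m_sq g x 0 n)).
  apply Rle_trans with (sum_n_m (fun k => M ^ 2 * norm (pr k x) ^ 2) 0 n).
  - apply sum_n_m_le_R. intros k. apply Rmult_le_compat_r; [apply pow2_ge_0|].
    rewrite <- pow2_abs. apply pow_incr. split; [apply Rabs_pos|apply HM].
  - rewrite (sum_n_m_mult_l (K := R_Ring) (M ^ 2)). apply Rmult_le_compat_l; [apply pow2_ge_0|apply bessel].
Qed.

Lemma ex_series_diag (g : nat -> R) (x : V) : bounded_seq g -> ex_series (fun k => scal (g k) (pr k x)).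
Proof.
  intros [M HM]. apply (cauchy_series_converges HV). intros eps.
  assert (HM0 : 0 <= M) by (eapply Rle_trans; [apply Rabs_pos|apply (HM 0%nat)]).
  assert (Hex : ex_series (fun k => norm (pr k x) ^ 2)).
  { destruct (ex_finite_lim_seq_incr (sum_n (fun k => norm (pr k x) ^ 2)) (norm x ^ 2)) as [l Hl].
    - intros n. rewrite sum_Sn. assert (0 <= norm (pr (S n) x) ^ 2) by apply pow2_ge_0.
      set (sn := sum_n _ n). change (sn <= sn + norm (pr (S n) x) ^ 2). lra.
    - apply bessel.
    - exists l. exact Hl. }
  assert (HC := Cauchy_ex_series (V := R_CompleteNormedModule) _ Hex).
  (* A block of the series has squared norm at most M^2 times the corresponding block of the Bessel
     sum; the added 1 covers M = 0. *)
  assert (He : 0 < eps ^ 2 / (M ^ 2 + 1)).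
  { apply Rdiv_lt_0_compat; [apply pow_lt, cond_pos|]. assert (0 <= M ^ 2) by apply pow2_ge_0. lra. }
  destruct (HC (mkposreal _ He)) as [N HN]. exists N. intros n m Hn Hm. specialize (HN n m Hn Hm). simpl in HN.
  change (Rabs (sum_n_m (fun k => norm (pr k x) ^ 2) n m) < eps ^ 2 / (M ^ 2 + 1)) in HN.
  apply (Rle_lt_trans _ _ _ (Rle_abs _)) in HN.
  set (s := sum_n_m (fun k => norm (pr k x) ^ 2) n m) in *.
  assert (HM2 : 0 <= M ^ 2) by apply pow2_ge_0.
  assert (Hs0 : 0 <= s).
  { unfold s. destruct (Nat.lt_ge_cases m n); [rewrite sum_n_m_zero by assumption; right; reflexivity|].
    assert (H1 := proj1 (norm_sum_n_m_sq (fun _ => 1) x n m)).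
    rewrite (sum_n_m_ext _ (fun k => norm (pr k x) ^ 2)) in H1 by (intros; simpl; ring).
    rewrite <- H1. apply pow2_ge_0. }
  change (norm (sum_n_m (fun k => scal (g k) (pr k x)) n m) < eps).
  apply Rsqr_incrst_0; [|apply norm_ge_0|apply Rlt_le, cond_pos].
  rewrite !Rsqr_pow2, (proj1 (norm_sum_n_m_sq g x n m)).
  apply Rle_lt_trans with (M ^ 2 * s).
  - unfold s. rewrite <- (sum_n_m_mult_l (K := R_Ring) (M ^ 2) (fun k => norm (pr k x) ^ 2)).
    apply sum_n_m_le_R. intros k. change (g k ^ 2 * norm (pr k x) ^ 2 <= M ^ 2 * norm (pr k x) ^ 2).
    apply Rmult_le_compat_r; [apply pow2_ge_0|].
    rewrite <- pow2_abs. apply pow_incr. split; [apply Rabs_pos|apply HM].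
  - apply Rmult_lt_compat_r with (r := M ^ 2 + 1) in HN; [|lra].
    unfold Rdiv in HN. rewrite Rmult_assoc, Rinv_l, Rmult_1_r in HN by lra. nra.
Qed.

Lemma is_series_diag (g : nat -> R) (x : V) : bounded_seq g ->
  is_series (fun k => scal (g k) (pr k x)) (diag pr g x).
Proof. intros Hg. unfold diag. apply epsilon_spec. exact (ex_series_diag g x Hg). Qed.

(** The k-th coordinate of the partial sums is stationary from n = k on, and the inner product is
    continuous. *)
Lemma rip_diag (g : nat -> R) (x : V) (k : nat) (z : V) : bounded_seq g ->
  rip (diag pr g x) (pr k z) = g k * rip x (pr k z).
Proof.
  intros Hg. assert (H := is_series_diag g x Hg).
  assert (H1 : filterlim (fun n => rip (sum_n (fun k => scal (g k) (pr k x)) n) (pr k z)) eventually (locally (rip (diag pr g x) (pr k z)))).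
  { apply (filterlim_comp _ _ _ _ (fun y => rip y (pr k z)) _ _ _ H).
    apply (linear_cont (V := R_NormedModule) (fun y => rip y (pr k z))), is_linear_rip. }
  refine (filterlim_locally_unique (V := R_NormedModule) (F := eventually) _ _ _ H1 _).
  apply (filterlim_ext_loc (fun _ => g k * rip x (pr k z))); [|apply filterlim_const].
  exists k. intros n Hn. rewrite rip_sum_l.
  assert (Hk : rip (scal (g k) (pr k x)) (pr k z) = g k * rip x (pr k z)).
  { rewrite (rip_scal_l HV), (pr_sym HV), (pr_idem HV). reflexivity. }
  assert (Hj : forall j, j <> k -> rip (scal (g j) (pr j x)) (pr k z) = 0).
  { intros j Hjk. rewrite (rip_scal_l HV), (pr_orth HV) by exact Hjk. ring. }
  induction n as [|n IH].
  - assert (k = 0)%nat by lia. subst k. rewrite sum_O. symmetry; exact Hk.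
  - rewrite sum_Sn. destruct (Nat.eq_dec k (S n)) as [->|Hne].
    + rewrite sum_n_zero_R by (intros; apply Hj; lia). rewrite Hk. unfold plus; simpl. ring.
    + rewrite <- IH, (Hj (S n)) by lia. unfold plus; simpl. ring.
Qed.

Lemma norm_diag_le (g : nat -> R) (M : R) (x : V) : (forall k, Rabs (g k) <= M) -> norm (diag pr g x) <= M * norm x.
Proof.
  intros HM. assert (H := is_series_diag g x (ex_intro _ M HM)).
  assert (H1 : filterlim (fun n => norm (sum_n (fun k => scal (g k) (pr k x)) n)) eventually (locally (norm (diag pr g x)))).
  { apply (filterlim_comp _ _ _ _ norm _ _ _ H). apply filterlim_norm. }
  apply (filterlim_le (F := eventually) (fun n => norm (sum_n (fun k => scal (g k) (pr k x)) n)) (fun _ => M * norm x)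
    (norm (diag pr g x)) (M * norm x)).
  - exists 0%nat. intros n _. apply norm_sum_diag_le, HM.
  - exact H1.
  - apply filterlim_const.
Qed.

Lemma bounded_lin (a b : R) (g h : nat -> R) : bounded_seq g -> bounded_seq h -> bounded_seq (fun k => a * g k + b * h k).
Proof.
  intros [M HM] [N HN]. exists (Rabs a * M + Rabs b * N). intros k.
  eapply Rle_trans; [apply Rabs_triang|]. rewrite !Rabs_mult.
  apply Rplus_le_compat; apply Rmult_le_compat_l; auto; apply Rabs_pos.
Qed.

(** Continuity uniform in k, that is, of t -> g t in the sup norm. By [norm_diag_le] it amounts to
    continuity of the diagonal operators in operator norm. *)
Definition equicont_at (g : R -> nat -> R) (t0 : R) : Prop :=
  forall eps : posreal, locally t0 (fun t => forall k, Rabs (g t k - g t0 k) <= eps).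

Lemma diag_minus (g h : nat -> R) (x : V) : bounded_seq g -> bounded_seq h ->
  minus (diag pr g x) (diag pr h x) = diag pr (fun k => 1 * g k + -1 * h k) x.
Proof.
  intros Hg Hh. apply rip_ext. intros k z. rewrite rip_minus_l, !rip_diag; auto; [ring|].
  apply bounded_lin; assumption.
Qed.

Lemma continuous_diag (g : R -> nat -> R) (x : V) (t0 : R) :
  (forall t, bounded_seq (g t)) -> equicont_at g t0 -> continuous (fun t => diag pr (g t) x) t0.
Proof.
  intros Hb He. apply filterlim_locally. intros eps.
  assert (Hx : 0 <= norm x) by apply norm_ge_0.
  assert (Hp : 0 < eps / (norm x + 1)) by (apply Rdiv_lt_0_compat; [apply cond_pos|lra]).
  generalize (He (mkposreal _ Hp)). apply filter_imp. intros t Ht.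
  apply (norm_compat1 (V := V)). rewrite diag_minus by apply Hb.
  eapply Rle_lt_trans; [apply (norm_diag_le _ (eps / (norm x + 1)))|].
  - intros k. replace (1 * g t k + -1 * g t0 k) with (g t k - g t0 k) by ring. apply Ht.
  - apply Rmult_lt_reg_r with (norm x + 1); [lra|].
    unfold Rdiv. replace (eps * / (norm x + 1) * norm x * (norm x + 1)) with (eps * norm x) by (field; lra).
    destruct eps as [e Hep]; simpl. nra.
Qed.

(** In each coordinate the mean value theorem expresses the error as (dg c k - dg t0 k) (t - t0).
    The point c depends on k, but equicontinuity bounds the error by the same e for all k. *)
Lemma is_derive_diag (g dg : R -> nat -> R) (x : V) (t0 : R) :
  (forall t, bounded_seq (g t)) -> (forall t, bounded_seq (dg t)) ->
  locally t0 (fun t => forall k, is_derive (fun s => g s k) t (dg t k)) -> equicont_at dg t0 ->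
  is_derive (fun t => diag pr (g t) x) t0 (diag pr (dg t0) x).
Proof.
  intros Hb Hdb Hd He. split; [apply (is_linear_scal_l (V := V))|].
  intros y Hy. apply (is_filter_lim_locally_unique (V := R_NormedModule)) in Hy. subst y. intros eps.
  assert (Hx : 0 <= norm x) by apply norm_ge_0.
  assert (Hp : 0 < eps / (norm x + 1)) by (apply Rdiv_lt_0_compat; [apply cond_pos|lra]).
  set (e := eps / (norm x + 1)) in *.
  destruct (filter_and _ _ Hd (He (mkposreal _ Hp))) as [d Hdd]. exists d. intros t Ht.
  assert (Hbd : forall k, Rabs (1 * (1 * g t k + -1 * g t0 k) + - (t - t0) * dg t0 k) <= e * Rabs (t - t0)).
  { intros k.
    destruct (MVT_gen (fun s => g s k) t0 t (fun s => dg s k)) as [c [Hc1 Hc2]].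
    - intros s Hs. apply (Hdd s). unball. eapply Rle_lt_trans; [|exact Ht].
      unfold Rmin, Rmax in Hs. destruct (Rle_dec t0 t); unfold Rabs; repeat destruct Rcase_abs; lra.
    - intros s Hs. apply continuity_pt_filterlim. eapply continuous_of_derive. apply (Hdd s). unball. eapply Rle_lt_trans; [|exact Ht].
      unfold Rmin, Rmax in Hs. destruct (Rle_dec t0 t); unfold Rabs; repeat destruct Rcase_abs; lra.
    - replace (1 * (1 * g t k + -1 * g t0 k) + - (t - t0) * dg t0 k) with ((dg c k - dg t0 k) * (t - t0)).
      2:{ replace (1 * (1 * g t k + -1 * g t0 k)) with (g t k - g t0 k) by ring. rewrite Hc2. ring. }
      rewrite Rabs_mult. apply Rmult_le_compat_r; [apply Rabs_pos|].
      apply (Hdd c). unball. eapply Rle_lt_trans; [|exact Ht].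
      unfold Rmin, Rmax in Hc1. destruct (Rle_dec t0 t); unfold Rabs; repeat destruct Rcase_abs; lra. }
  assert (E : minus (minus (diag pr (g t) x) (diag pr (g t0) x)) (scal (minus t t0) (diag pr (dg t0) x)) =
     diag pr (fun k => 1 * (1 * g t k + -1 * g t0 k) + - (t - t0) * dg t0 k) x).
  { apply rip_ext. intros k z. rewrite !rip_minus_l, (rip_scal_l HV), !rip_diag; auto.
    - unfold minus, plus, opp; simpl. ring.
    - apply bounded_lin; [apply bounded_lin; apply Hb|apply Hdb]. }
  eapply Rle_trans; [right; exact (f_equal norm E)|].
  eapply Rle_trans; [apply (norm_diag_le _ _ x Hbd)|].
  change (norm (minus t t0)) with (Rabs (t - t0)).
  assert (Ha : 0 <= Rabs (t - t0)) by apply Rabs_pos.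
  replace (e * Rabs (t - t0) * norm x) with ((e * norm x) * Rabs (t - t0)) by ring.
  apply Rmult_le_compat_r; [exact Ha|]. unfold e.
  apply Rmult_le_reg_r with (norm x + 1); [lra|].
  replace (eps / (norm x + 1) * norm x * (norm x + 1)) with (eps * norm x) by (field; lra).
  destruct eps as [ep Hep]; simpl; nra.
Qed.

(** A pair whose coordinates satisfy z_k = lam_k y_k passes the adjoint test, since (L x, y) and (x,
    z) have the same expansion term by term. Maximality of the graph then provides membership in the
    domain. *)
Lemma graph_by_coordinates (dm : V -> Prop) (L : V -> V) (lam : nat -> R) :
  (forall x k z, dm x -> rip (L x) (pr k z) = lam k * rip x (pr k z)) ->
  (forall y z, (forall x, dm x -> rip (L x) y = rip x z) -> dm y /\ L y = z) ->
  forall y z, (forall k w, rip z (pr k w) = lam k * rip y (pr k w)) -> dm y /\ L y = z.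
Proof.
  intros HL Hadj y z Hyz. apply Hadj. intros x Hx.
  (* The multiplier 1 gives the identity, so that [Lim] below is Parseval's formula. *)
  assert (Hb : bounded_seq (fun _ => 1)) by (exists 1; intros; rewrite Rabs_R1; lra).
  assert (Hone : forall w, diag pr (fun _ => 1) w = w).
  { intros w. apply rip_ext. intros k v. rewrite rip_diag by exact Hb. ring. }
  assert (Lim : forall w v, filterlim (fun n => sum_n (fun k => rip w (pr k v)) n) eventually (locally (rip w v))).
  { intros w v. assert (H := is_series_diag (fun _ => 1) v Hb). rewrite Hone in H.
    rewrite (rip_sym HV).
    assert (H1 : filterlim (fun n => rip (sum_n (fun k => scal 1 (pr k v)) n) w) eventually (locally (rip v w))).
    { apply (filterlim_comp _ _ _ _ (fun u => rip u w) _ _ _ H).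
      apply (linear_cont (V := R_NormedModule) (fun u => rip u w)), is_linear_rip. }
    revert H1. apply filterlim_ext. intros n. rewrite rip_sum_l. apply sum_n_ext. intros k.
    rewrite (rip_scal_l HV), Rmult_1_l. apply (rip_sym HV). }
  refine (filterlim_locally_unique (V := R_NormedModule) (F := eventually) _ _ _ (Lim (L x) y) _).
  generalize (Lim x z). apply filterlim_ext. intros n. apply sum_n_ext. intros k. Req.
  rewrite HL by exact Hx.
  rewrite <- (pr_sym HV), (rip_sym HV (pr k x)), Hyz.
  rewrite (rip_sym HV y), (pr_sym HV). reflexivity.
Qed.

Lemma is_RInt_rip (f : R -> V) (a b : R) (l y : V) :
  is_RInt f a b l -> is_RInt (fun t => rip (f t) y) a b (rip l y).
Proof.
  intros H. unfold is_RInt in *.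
  assert (H1 := filterlim_comp _ _ _ _ (fun x => rip x y) _ _ _ H (linear_cont (V := R_NormedModule) (fun x => rip x y) l (is_linear_rip y))).
  revert H1. apply filterlim_ext. intros ptd.
  rewrite (rip_scal_l HV). change (@eq R (sign (b - a) * rip (Riemann_sum f ptd) y) (sign (b - a) * Riemann_sum (V := R_ModuleSpace) (fun t => rip (f t) y) ptd)).
  f_equal. apply SF_cons_ind with (s := ptd).
  - intros x0. unfold Riemann_sum; simpl. apply rip_zero_l.
  - intros h s IH. rewrite !Riemann_sum_cons, (rip_plus_l HV), (rip_scal_l HV), IH. reflexivity.
Qed.

Lemma is_RInt_gen_rip (f : R -> V) (Fa Fb : (R -> Prop) -> Prop) (l y : V) :
  Filter Fa -> Filter Fb ->
  is_RInt_gen f Fa Fb l -> is_RInt_gen (fun t => rip (f t) y) Fa Fb (rip l y).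
Proof.
  intros FFa FFb H P HP.
  assert (H1 := linear_cont (V := R_NormedModule) (fun x => rip x y) l (is_linear_rip y) P HP).
  specialize (H _ H1). unfold filtermapi in *. revert H. apply filter_imp.
  intros [a b] [z [Hz1 Hz2]]. exists (rip z y). split; [apply is_RInt_rip, Hz1|exact Hz2].
Qed.

Lemma is_derive_rip (f : R -> V) (t : R) (l y : V) :
  is_derive f t l -> is_derive (fun s => rip (f s) y) t (rip l y).
Proof.
  intros H.
  assert (H1 := filterdiff_comp f (fun x => rip x y) _ (fun x => rip x y) H
     (filterdiff_linear (V := R_NormedModule) (fun x => rip x y) (is_linear_rip y))).
  unfold is_derive. eapply filterdiff_ext_lin; [exact H1|].
  intros s. simpl. apply (rip_scal_l HV).
Qed.

End Resolution.

(** * Families of Mittag-Leffler functions *)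

Lemma entire_bounded (a : nat -> R) (X : R) : entire a ->
  exists M, 0 <= M /\ forall x, Rabs x <= X -> Rabs (PSeries a x) <= M.
Proof.
  intros Ha. exists (Series (fun n => Rabs (a n * X ^ n))).
  assert (Hex := entire_ex_abs a X Ha). split.
  - apply Rle_trans with (Rabs (PSeries a X)); [apply Rabs_pos|apply Series_Rabs, Hex].
  - intros x Hx. assert (Hx0 := Rabs_pos x).
    eapply Rle_trans; [apply Series_Rabs, entire_ex_abs, Ha|].
    apply Series_le; [|exact Hex]. intros n; split; [apply Rabs_pos|].
    rewrite !Rabs_mult. apply Rmult_le_compat_l; [apply Rabs_pos|].
    rewrite <- !RPow_abs, (Rabs_pos_eq X) by lra. apply pow_incr; lra.
Qed.

Lemma bounded_mult (g h : nat -> R) : bounded_seq g -> bounded_seq h -> bounded_seq (fun k => g k * h k).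
Proof.
  intros [M HM] [N HN]. exists (M * N). intros k. rewrite Rabs_mult.
  apply Rmult_le_compat; auto; apply Rabs_pos.
Qed.

Lemma bounded_scal (a : R) (g : nat -> R) : bounded_seq g -> bounded_seq (fun k => a * g k).
Proof. intros Hg. apply (bounded_mult (fun _ => a)); [exists (Rabs a); intros; lra|exact Hg]. Qed.

Lemma bounded_plus (g h : nat -> R) : bounded_seq g -> bounded_seq h -> bounded_seq (fun k => g k + h k).
Proof.
  intros [M HM] [N HN]. exists (M + N). intros k.
  eapply Rle_trans; [apply Rabs_triang|]. apply Rplus_le_compat; auto.
Qed.

Lemma bounded_entire (a c : nat -> R) (s : R) : entire a -> bounded_seq c -> bounded_seq (fun k => PSeries a (c k * s)).
Proof.
  intros Ha [C HC]. destruct (entire_bounded a (C * Rabs s) Ha) as [M [_ HM]].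
  exists M. intros k. apply HM. rewrite Rabs_mult. apply Rmult_le_compat_r; [apply Rabs_pos|apply HC].
Qed.

(** For t near t0 all arguments c_k s(t) lie in one disc, where a single bound on the derivative of
    the series makes the mean value estimate uniform in k. *)
Lemma equicont_entire (a c : nat -> R) (s : R -> R) (t0 : R) : entire a -> bounded_seq c -> continuous s t0 ->
  equicont_at (fun t k => PSeries a (c k * s t)) t0.
Proof.
  intros Ha [C HC] Hs eps.
  assert (HC0 : 0 <= C) by (eapply Rle_trans; [apply Rabs_pos|apply (HC 0%nat)]).
  destruct (entire_bounded (PS_derive a) (C * (Rabs (s t0) + 1)) (entire_derive a Ha)) as [M [HM0 HM]].
  assert (HCM : 0 <= C * M) by (apply Rmult_le_pos; assumption).
  assert (Hp : 0 < Rmin 1 (eps / (C * M + 1))).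
  { apply Rmin_pos; [lra|]. apply Rdiv_lt_0_compat; [apply cond_pos|lra]. }
  generalize (proj1 (filterlim_locally _ _) Hs (mkposreal _ Hp)). apply filter_imp. intros t Ht k.
  unball. assert (H1 := Rmin_l 1 (eps / (C * M + 1))). assert (H2 := Rmin_r 1 (eps / (C * M + 1))).
  set (x := c k * s t0). set (y := c k * s t).
  assert (Hs1 : Rabs (s t + - s t0) < 1) by lra.
  assert (Hst : Rabs (s t) <= Rabs (s t0) + 1).
  { replace (s t) with (s t0 + (s t + - s t0)) by ring. eapply Rle_trans; [apply Rabs_triang|]. lra. }
  assert (Hx : Rabs x <= C * (Rabs (s t0) + 1)).
  { unfold x. rewrite Rabs_mult. apply Rmult_le_compat; try apply Rabs_pos; [apply HC|lra]. }
  assert (Hy : Rabs y <= C * (Rabs (s t0) + 1)).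
  { unfold y. rewrite Rabs_mult. apply Rmult_le_compat; try apply Rabs_pos; [apply HC|lra]. }
  destruct (MVT_gen (PSeries a) x y (PSeries (PS_derive a))) as [z [Hz1 Hz2]].
  - intros; apply is_derive_entire, Ha.
  - intros; apply continuity_pt_filterlim, (continuous_entire a), Ha.
  - rewrite Hz2, Rabs_mult.
    assert (Hz : Rabs z <= C * (Rabs (s t0) + 1)).
    { apply Rabs_le_between in Hx. apply Rabs_le_between in Hy. apply Rabs_le.
      unfold Rmin, Rmax in Hz1. destruct (Rle_dec x y); lra. }
    apply Rle_trans with (M * (C * (eps / (C * M + 1)))).
    + apply Rmult_le_compat; try apply Rabs_pos; [apply HM, Hz|].
      unfold x, y. replace (c k * s t - c k * s t0) with (c k * (s t + - s t0)) by ring.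
      rewrite Rabs_mult. apply Rmult_le_compat; try apply Rabs_pos; [apply HC|lra].
    + apply Rmult_le_reg_r with (C * M + 1); [lra|].
      replace (M * (C * (eps / (C * M + 1))) * (C * M + 1)) with (C * M * eps) by (field; lra).
      destruct eps as [e He]; simpl; nra.
Qed.

Lemma equicont_fun_mult (f : R -> R) (g : R -> nat -> R) (t0 : R) : continuous f t0 ->
  equicont_at g t0 -> bounded_seq (g t0) -> equicont_at (fun t k => f t * g t k) t0.
Proof.
  intros Hf Hg [M HM] eps.
  assert (HM0 : 0 <= M) by (eapply Rle_trans; [apply Rabs_pos|apply (HM 0%nat)]).
  set (F := Rabs (f t0) + 1). assert (HF : 0 < F) by (unfold F; assert (H := Rabs_pos (f t0)); lra).
  assert (H1 : 0 < eps / 2 / F) by (apply Rdiv_lt_0_compat; [assert (H := cond_pos eps); lra|exact HF]).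
  assert (H2 : 0 < Rmin 1 (eps / 2 / (M + 1))).
  { apply Rmin_pos; [lra|]. apply Rdiv_lt_0_compat; [assert (H := cond_pos eps); lra|lra]. }
  generalize (filter_and _ _ (Hg (mkposreal _ H1)) (proj1 (filterlim_locally _ _) Hf (mkposreal _ H2))).
  apply filter_imp. intros t [Ht1 Ht2] k. specialize (Ht1 k). simpl in Ht1. unball.
  assert (L1 := Rmin_l 1 (eps / 2 / (M + 1))). assert (L2 := Rmin_r 1 (eps / 2 / (M + 1))).
  replace (f t * g t k - f t0 * g t0 k) with (f t * (g t k - g t0 k) + (f t + - f t0) * g t0 k) by ring.
  eapply Rle_trans; [apply Rabs_triang|]. rewrite !Rabs_mult.
  assert (Hft : Rabs (f t) <= F).
  { unfold F. replace (f t) with (f t0 + (f t + - f t0)) by ring. eapply Rle_trans; [apply Rabs_triang|]. lra. }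
  assert (B1 : Rabs (f t) * Rabs (g t k - g t0 k) <= F * (eps / 2 / F)).
  { apply Rmult_le_compat; try apply Rabs_pos; assumption. }
  assert (B2 : Rabs (f t + - f t0) * Rabs (g t0 k) <= (eps / 2 / (M + 1)) * (M + 1)).
  { apply Rmult_le_compat; try apply Rabs_pos; [lra|]. specialize (HM k). lra. }
  replace (F * (eps / 2 / F)) with (eps / 2) in B1 by (field; lra).
  replace (eps / 2 / (M + 1) * (M + 1)) with (eps / 2) in B2 by (field; lra). lra.
Qed.

Lemma equicont_seq_mult (b : nat -> R) (g : R -> nat -> R) (t0 : R) : bounded_seq b ->
  equicont_at g t0 -> equicont_at (fun t k => b k * g t k) t0.
Proof.
  intros [M HM] Hg eps.
  assert (HM0 : 0 <= M) by (eapply Rle_trans; [apply Rabs_pos|apply (HM 0%nat)]).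
  assert (H1 : 0 < eps / (M + 1)) by (apply Rdiv_lt_0_compat; [apply cond_pos|lra]).
  generalize (Hg (mkposreal _ H1)). apply filter_imp. intros t Ht k. specialize (Ht k). simpl in Ht.
  rewrite <- Rmult_minus_distr_l, Rabs_mult.
  apply Rle_trans with ((M + 1) * (eps / (M + 1))); [|right; field; lra].
  apply Rmult_le_compat; try apply Rabs_pos; [|exact Ht]. specialize (HM k). lra.
Qed.

Lemma equicont_plus (g h : R -> nat -> R) (t0 : R) : equicont_at g t0 -> equicont_at h t0 ->
  equicont_at (fun t k => g t k + h t k) t0.
Proof.
  intros Hg Hh eps. assert (H1 : 0 < eps / 2) by (assert (H := cond_pos eps); lra).
  generalize (filter_and _ _ (Hg (mkposreal _ H1)) (Hh (mkposreal _ H1))). apply filter_imp.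
  intros t [Ht1 Ht2] k. specialize (Ht1 k). specialize (Ht2 k). simpl in *.
  replace (g t k + h t k - (g t0 k + h t0 k)) with ((g t k - g t0 k) + (h t k - h t0 k)) by ring.
  eapply Rle_trans; [apply Rabs_triang|]. lra.
Qed.

Section Family.
Variable alpha : R.
Hypothesis Halpha : 1 < alpha < 2.
Variables (c a b : nat -> R).
Hypotheses (Hc : bounded_seq c) (Hba : bounded_seq a) (Hbb : bounded_seq b).

Let Ha : 1 < alpha := proj1 Halpha.

Lemma mlk_unfold (mu x t : R) :
  mlk alpha mu x t = Rpower t (mu - 1) * PSeries (ml_coef alpha mu) (x * Rpower t alpha).
Proof. unfold mlk, gps. rewrite PSeries_pow. reflexivity. Qed.

Lemma bounded_mlk (mu t : R) : 0 < mu -> bounded_seq (fun k => mlk alpha mu (c k) t).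
Proof.
  intros Hmu. destruct (bounded_scal (Rpower t (mu - 1)) _ (bounded_entire (ml_coef alpha mu) c (Rpower t alpha)
    (entire_ml alpha Ha mu Hmu) Hc)) as [M HM].
  exists M. intros k. rewrite mlk_unfold. apply HM.
Qed.

Lemma equicont_ext (g h : R -> nat -> R) (t0 : R) : (forall t k, g t k = h t k) -> equicont_at g t0 -> equicont_at h t0.
Proof. intros E H eps. generalize (H eps). apply filter_imp. intros t Ht k. rewrite <- !E. apply Ht. Qed.

Lemma equicont_mlk (mu t0 : R) : 0 < mu -> 0 < t0 -> equicont_at (fun t k => mlk alpha mu (c k) t) t0.
Proof.
  intros Hmu Ht. apply (equicont_ext (fun t k => Rpower t (mu - 1) * PSeries (ml_coef alpha mu) (c k * Rpower t alpha))).
  - intros; symmetry; apply mlk_unfold.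
  - apply (equicont_fun_mult (fun t => Rpower t (mu - 1)) (fun t k => PSeries (ml_coef alpha mu) (c k * Rpower t alpha))).
    + apply continuous_Rpower, Ht.
    + apply (equicont_entire (ml_coef alpha mu) c (fun t => Rpower t alpha)); [apply entire_ml; assumption|exact Hc|].
      apply continuous_Rpower, Ht.
    + apply bounded_entire; [apply entire_ml; assumption|exact Hc].
Qed.

Lemma bounded_ml1 (t : R) : bounded_seq (fun k => ml1 alpha (c k) t).
Proof. apply (bounded_entire (ml_coef alpha 1)); [apply entire_ml; lra|exact Hc]. Qed.

Lemma bounded_ml2 (t : R) : bounded_seq (fun k => ml2 alpha (c k) t).
Proof. apply (bounded_scal t (fun k => PSeries (ml_coef alpha 2) (c k * rpow t alpha))), bounded_entire; [apply entire_ml; lra|exact Hc]. Qed.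

Lemma equicont_ml1 (t0 : R) : equicont_at (fun t k => ml1 alpha (c k) t) t0.
Proof.
  apply (equicont_entire (ml_coef alpha 1) c (fun t => rpow t alpha)); [apply entire_ml; lra|exact Hc|].
  apply continuous_rpow; lra.
Qed.

Lemma equicont_ml2 (t0 : R) : equicont_at (fun t k => ml2 alpha (c k) t) t0.
Proof.
  apply (equicont_fun_mult (fun t => t) (fun t k => PSeries (ml_coef alpha 2) (c k * rpow t alpha))).
  - apply continuous_id.
  - apply (equicont_entire (ml_coef alpha 2) c (fun t => rpow t alpha)); [apply entire_ml; lra|exact Hc|].
    apply continuous_rpow; lra.
  - apply bounded_entire; [apply entire_ml; lra|exact Hc].
Qed.

(** The k-th multiplier of the solution operator at time t; [dfam] and [ddfam] are its first two
    time derivatives for 0 < t. *)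
Definition fam (t : R) (k : nat) : R := a k * ml1 alpha (c k) t + b k * ml2 alpha (c k) t.
Definition dfam (t : R) (k : nat) : R := a k * (c k * mlk alpha alpha (c k) t) + b k * mlk alpha 1 (c k) t.
Definition ddfam (t : R) (k : nat) : R :=
  a k * (c k * mlk alpha (alpha - 1) (c k) t) + b k * (c k * mlk alpha alpha (c k) t).

Lemma bounded_fam t : bounded_seq (fam t).
Proof. apply bounded_plus; apply bounded_mult; auto; [apply bounded_ml1|apply bounded_ml2]. Qed.

Lemma bounded_dfam t : bounded_seq (dfam t).
Proof. apply bounded_plus; apply bounded_mult; auto; [apply bounded_mult; auto|]; apply bounded_mlk; lra. Qed.

Lemma bounded_ddfam t : bounded_seq (ddfam t).
Proof. apply bounded_plus; apply bounded_mult; auto; apply bounded_mult; auto; apply bounded_mlk; lra. Qed.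

Lemma equicont_fam t : equicont_at fam t.
Proof.
  apply equicont_plus; (apply equicont_seq_mult; [assumption|]); [apply equicont_ml1|apply equicont_ml2].
Qed.

Lemma equicont_dfam t : 0 < t -> equicont_at dfam t.
Proof.
  intros Ht. apply equicont_plus; (apply equicont_seq_mult; [assumption|]).
  - apply equicont_seq_mult; [assumption|]. apply equicont_mlk; lra.
  - apply equicont_mlk; lra.
Qed.

Lemma equicont_ddfam t : 0 < t -> equicont_at ddfam t.
Proof.
  intros Ht. apply equicont_plus; (apply equicont_seq_mult; [assumption|]);
  (apply equicont_seq_mult; [assumption|]); apply equicont_mlk; lra.
Qed.

Lemma is_derive_fam t k : 0 < t -> is_derive (fun s => fam s k) t (dfam t k).
Proof.
  intros Ht. unfold fam, dfam.
  apply (is_derive_plus (fun s => a k * ml1 alpha (c k) s) (fun s => b k * ml2 alpha (c k) s)); apply is_derive_scal.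
  - apply is_derive_ml1; lra.
  - rewrite <- ml1_eq by lra. apply is_derive_ml2; lra.
Qed.

Lemma is_derive_dfam t k : 0 < t -> is_derive (fun s => dfam s k) t (ddfam t k).
Proof.
  intros Ht. unfold dfam, ddfam.
  apply (is_derive_plus (fun s => a k * (c k * mlk alpha alpha (c k) s)) (fun s => b k * mlk alpha 1 (c k) s)); apply is_derive_scal.
  - apply is_derive_scal, is_derive_mlk; lra.
  - apply is_derive_mlk_1; lra.
Qed.

Lemma mlk_bound (mu T : R) : 0 < mu -> 0 < T ->
  exists M, 0 <= M /\ forall t k, 0 < t <= T -> Rabs (mlk alpha mu (c k) t) <= M * Rpower t (mu - 1).
Proof.
  intros Hmu HT. destruct Hc as [C HC].
  destruct (entire_bounded (ml_coef alpha mu) (C * Rpower T alpha) (entire_ml alpha Ha mu Hmu)) as [M [HM0 HM]].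
  exists M. split; [exact HM0|]. intros t k Ht. rewrite mlk_unfold, Rabs_mult, Rmult_comm.
  rewrite (Rabs_pos_eq (Rpower t (mu - 1))) by apply Rlt_le, Rpower_pos.
  apply Rmult_le_compat_r; [apply Rlt_le, Rpower_pos|]. apply HM.
  rewrite Rabs_mult, (Rabs_pos_eq (Rpower _ _)) by apply Rlt_le, Rpower_pos.
  apply Rmult_le_compat; [apply Rabs_pos|apply Rlt_le, Rpower_pos|apply HC|apply Rle_Rpower_l; lra].
Qed.

(** The index alpha - 1 produces the singularity t^(alpha - 2) at 0; it is integrable since 1 <
    alpha, and the constant is the same for all k. *)
Lemma ddfam_bound (T : R) : 0 < T ->
  exists M, forall t k, 0 < t <= T -> Rabs (ddfam t k) <= M * Rpower t (alpha - 2).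
Proof.
  intros HT. destruct (mlk_bound (alpha - 1) T ltac:(lra) HT) as [M1 [H10 H1]].
  destruct (mlk_bound alpha T ltac:(lra) HT) as [M2 [H20 H2]].
  destruct Hc as [C HC]. destruct Hba as [A0 HA]. destruct Hbb as [B0 HB].
  assert (C0 : 0 <= C) by (eapply Rle_trans; [apply Rabs_pos|apply (HC 0%nat)]).
  assert (A00 : 0 <= A0) by (eapply Rle_trans; [apply Rabs_pos|apply (HA 0%nat)]).
  assert (B00 : 0 <= B0) by (eapply Rle_trans; [apply Rabs_pos|apply (HB 0%nat)]).
  exists (A0 * (C * M1) + B0 * (C * (M2 * T))). intros t k Ht. unfold ddfam.
  specialize (H1 t k Ht). specialize (H2 t k Ht).
  replace (alpha - 1 - 1) with (alpha - 2) in H1 by ring.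
  assert (HP := Rpower_pos t (alpha - 2)).
  assert (E : Rpower t (alpha - 1) <= T * Rpower t (alpha - 2)).
  { replace (alpha - 1) with (1 + (alpha - 2)) by ring. rewrite Rpower_plus, Rpower_1 by lra.
    apply Rmult_le_compat_r; lra. }
  eapply Rle_trans; [apply Rabs_triang|]. rewrite !Rabs_mult.
  set (P := Rpower t (alpha - 2)) in *.
  assert (G1 : Rabs (a k) * (Rabs (c k) * Rabs (mlk alpha (alpha - 1) (c k) t)) <= A0 * (C * (M1 * P))).
  { apply Rmult_le_compat; [apply Rabs_pos| |apply HA|].
    - apply Rmult_le_pos; apply Rabs_pos.
    - apply Rmult_le_compat; try apply Rabs_pos; [apply HC|exact H1]. }
  assert (G2 : Rabs (b k) * (Rabs (c k) * Rabs (mlk alpha alpha (c k) t)) <= B0 * (C * (M2 * (T * P)))).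
  { apply Rmult_le_compat; [apply Rabs_pos| |apply HB|].
    - apply Rmult_le_pos; apply Rabs_pos.
    - apply Rmult_le_compat; try apply Rabs_pos; [apply HC|].
      eapply Rle_trans; [exact H2|]. apply Rmult_le_compat_l; assumption. }
  replace ((A0 * (C * M1) + B0 * (C * (M2 * T))) * P) with (A0 * (C * (M1 * P)) + B0 * (C * (M2 * (T * P)))) by ring. lra.
Qed.

Lemma caputo_fam (t : R) (k : nat) : 0 < t ->
  is_RInt_gen (fun s => Rpower (t - s) (- (alpha - 1)) * ddfam s k) (at_right 0) (at_left t)
    (c k * Gamma (2 - alpha) * fam t k).
Proof.
  intros Ht.
  assert (H := is_RInt_gen_plus _ _ _ _
    (is_RInt_gen_scal _ (a k) _ (caputo_ml1 alpha (c k) Halpha t Ht))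
    (is_RInt_gen_scal _ (b k) _ (caputo_ml2 alpha (c k) Halpha t Ht))).
  replace (c k * Gamma (2 - alpha) * fam t k) with
    (plus (scal (a k) (c k * Gamma (2 - alpha) * ml1 alpha (c k) t)) (scal (b k) (c k * Gamma (2 - alpha) * ml2 alpha (c k) t))).
  2:{ unfold plus, scal, fam; simpl; unfold mult; simpl. ring. }
  refine (is_RInt_gen_ext_interval _ _ _ _ Ht _ H).
  intros s Hs. unfold plus, scal, ddfam; simpl; unfold mult; simpl. ring.
Qed.

Section Vector.
Variable E : CompleteNormedModule R_AbsRing.
Context {rip : E -> E -> R} {pr : nat -> E -> E}.
Hypothesis HE : orthogonal_resolution E rip pr.

Notation diag := (diag (V := E) pr).

Lemma bounded_c_fam t : bounded_seq (fun k => c k * fam t k).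
Proof. apply bounded_mult; [exact Hc|apply bounded_fam]. Qed.

Lemma continuous_diag_fam (x : E) (t : R) : continuous (fun s => diag (fam s) x) t.
Proof. apply (continuous_diag HE); [apply bounded_fam|apply equicont_fam]. Qed.

Lemma continuous_diag_c_fam (x : E) (t : R) : continuous (fun s => diag (fun k => c k * fam s k) x) t.
Proof.
  apply (continuous_diag HE (fun s k => c k * fam s k)); [apply bounded_c_fam|].
  apply equicont_seq_mult; [exact Hc|apply equicont_fam].
Qed.

Lemma locally_pos (t : R) (P : R -> Prop) : 0 < t -> (forall s, 0 < s -> P s) -> locally t P.
Proof.
  intros Ht H. exists (mkposreal t Ht). intros s Hs. apply H. unball. apply Rabs_def2 in Hs. lra.
Qed.

Lemma is_derive_diag_fam (x : E) (t : R) : 0 < t -> is_derive (fun s => diag (fam s) x) t (diag (dfam t) x).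
Proof.
  intros Ht. apply (is_derive_diag HE fam dfam).
  - apply bounded_fam.
  - apply bounded_dfam.
  - apply locally_pos; [exact Ht|]. intros s Hs k. apply is_derive_fam, Hs.
  - apply equicont_dfam, Ht.
Qed.

Lemma is_derive_diag_dfam (x : E) (t : R) : 0 < t -> is_derive (fun s => diag (dfam s) x) t (diag (ddfam t) x).
Proof.
  intros Ht. apply (is_derive_diag HE dfam ddfam).
  - apply bounded_dfam.
  - apply bounded_ddfam.
  - apply locally_pos; [exact Ht|]. intros s Hs k. apply is_derive_dfam, Hs.
  - apply equicont_ddfam, Ht.
Qed.

(** Existence and value are separated: the vector integral converges by domination with a Beta
    kernel, and its value is found by testing against each [pr k z], where [caputo_fam] applies. *)
Lemma caputo_diag_fam (x : E) (t : R) : 0 < t ->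
  is_RInt_gen (fun s => scal (/ Rpower (t - s) (alpha - 1)) (diag (ddfam s) x)) (at_right 0) (at_left t)
    (scal (Gamma (2 - alpha)) (diag (fun k => c k * fam t k) x)).
Proof.
  intros Ht. destruct (ddfam_bound t Ht) as [M HM].
  assert (Hx : 0 <= norm x) by apply norm_ge_0.
  assert (Hbeta := beta_integral t (2 - alpha) (alpha - 1) Ht ltac:(lra) ltac:(lra)).
  apply (is_RInt_gen_scal _ (M * norm x)) in Hbeta.
  match type of Hbeta with is_RInt_gen _ _ _ ?v => set (B := v) in Hbeta end.
  destruct (ex_RInt_gen_dom (V := E) (at_right 0) (at_left t) _ _ (fun s => 0 < s < t)
    (fun s => scal (/ Rpower (t - s) (alpha - 1)) (diag (ddfam s) x))
    (fun s => scal (M * norm x) (beta_kernel t (2 - alpha - 1) (alpha - 1 - 1) s))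
    B (ends_in_interval t Ht)) as [I HI]; [| |exact Hbeta|].
  - intros s Hs. apply (continuous_scal (V := E) (fun s => / Rpower (t - s) (alpha - 1)) (fun s => diag (ddfam s) x)).
    + apply (continuous_ext (fun s => Rpower (t - s) (- (alpha - 1)))); [intros; apply Rpower_Ropp|].
      eapply continuous_of_derive, is_derive_Rpower_minus, Hs.
    + apply (continuous_diag HE); [apply bounded_ddfam|apply equicont_ddfam, Hs].
  - intros s Hs. eapply Rle_trans; [apply (norm_scal (V := E))|].
    assert (HP := Rpower_pos (t - s) (alpha - 1)).
    change (Rabs (/ Rpower (t - s) (alpha - 1)) * norm (diag (ddfam s) x) <= M * norm x * beta_kernel t (2 - alpha - 1) (alpha - 1 - 1) s).
    rewrite Rabs_pos_eq by (apply Rlt_le, Rinv_0_lt_compat, HP).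
    unfold beta_kernel. rewrite <- Rpower_Ropp. replace (2 - alpha - 1) with (- (alpha - 1)) by ring.
    replace (alpha - 1 - 1) with (alpha - 2) by ring.
    replace (M * norm x * (Rpower (t - s) (- (alpha - 1)) * Rpower s (alpha - 2))) with
      (Rpower (t - s) (- (alpha - 1)) * (M * Rpower s (alpha - 2) * norm x)) by ring.
    apply Rmult_le_compat_l; [apply Rlt_le, Rpower_pos|].
    apply (norm_diag_le HE). intros k. apply HM; lra.
  - replace (scal (Gamma (2 - alpha)) (diag (fun k => c k * fam t k) x)) with I; [exact HI|].
    apply (rip_ext HE). intros k z.
    assert (H1 := is_RInt_gen_rip HE _ _ _ I (pr k z) _ _ HI).
    rewrite (rip_scal_l HE), (rip_diag HE) by apply bounded_c_fam.
    assert (H2 := is_RInt_gen_scal _ (rip x (pr k z)) _ (caputo_fam t k Ht)).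
    replace (Gamma (2 - alpha) * (c k * fam t k * rip x (pr k z))) with
      (scal (rip x (pr k z)) (c k * Gamma (2 - alpha) * fam t k)) by (Rsimp; ring).
    refine (is_RInt_gen_uniq _ _ _ _ _ _ _ H1 _).
    refine (is_RInt_gen_ext_interval _ _ _ _ Ht _ H2).
    intros s Hs. rewrite (rip_scal_l HE), (rip_diag HE) by apply bounded_ddfam.
    rewrite Rpower_Ropp. Rsimp. ring.
Qed.

Lemma is_RInt_diag_fam (x : E) (T : R) : 0 < T ->
  (forall k, is_RInt (fun t => fam t k) 0 T 1) -> is_RInt (fun t => diag (fam t) x) 0 T x.
Proof.
  intros HT Hint.
  assert (Hex : ex_RInt (fun t => diag (fam t) x) 0 T).
  { apply (ex_RInt_continuous (V := E)). intros; apply continuous_diag_fam. }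
  destruct Hex as [I HI]. cut (I = x); [intros EI; rewrite EI in HI; exact HI|].
  apply (rip_ext HE). intros k z.
  assert (H1 := is_RInt_rip HE _ _ _ _ (pr k z) HI).
  assert (H2 := is_RInt_scal _ _ _ (rip x (pr k z)) _ (Hint k)).
  rewrite <- (is_RInt_unique (V := R_CompleteNormedModule) _ _ _ _ H1).
  transitivity (scal (rip x (pr k z)) 1); [|Rsimp; Req; ring].
  apply (is_RInt_unique (V := R_CompleteNormedModule)). revert H2. apply is_RInt_ext.
  intros t _. rewrite (rip_diag HE) by apply bounded_fam.
  Rsimp. ring.
Qed.

End Vector.
End Family.

(** * The Hilbert space as a real space *)

Definition as_real_complete (K : scalar_kind) (H : CompleteNormedModule (scalar K)) : CompleteNormedModule R_AbsRing :=
  CompleteNormedModule.Pack R_AbsRing H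
    (CompleteNormedModule.Class R_AbsRing H (NormedModule.class R_AbsRing (as_real H))
      (CompleteNormedModule.mixin _ _ (CompleteNormedModule.class (scalar K) H))) H.

Section ScalarField.
Variable K : scalar_kind.

Lemma sre_plus (x y : scalar K) : sre (plus x y) = sre x + sre y.
Proof. destruct K; reflexivity. Qed.

Lemma sre_sinj_mult (a : R) (x : scalar K) : sre (mult (sinj K a) x) = a * sre x.
Proof. destruct K; [reflexivity|]. simpl. ring. Qed.

Lemma sre_sinj (a : R) : sre (sinj K a) = a.
Proof. destruct K; reflexivity. Qed.

Lemma sre_sconj (x : scalar K) : sre (sconj x) = sre x.
Proof. destruct K; reflexivity. Qed.

Lemma sconj_sinj (a : R) : sconj (sinj K a) = sinj K a.
Proof. destruct K; [reflexivity|]. unfold sconj, sinj, Cconj, RtoC; simpl. rewrite Ropp_0. reflexivity. Qed.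

Lemma sconj_mult (x y : scalar K) : sconj (mult x y) = mult (sconj x) (sconj y).
Proof.
  destruct K; [reflexivity|]. destruct x, y. unfold sconj, Cconj, mult; simpl. unfold Cmult; simpl. f_equal; ring.
Qed.

Lemma scalar_mult_comm (x y : scalar K) : mult x y = mult y x.
Proof. destruct K; [apply Rmult_comm|apply Cmult_comm]. Qed.

(** The real part forgets half of a complex number, but multiplication by -i brings the other half
    back. *)
Lemma sre_inj (x y : scalar K) : (forall a, sre (mult a x) = sre (mult a y)) -> x = y.
Proof.
  destruct K; simpl; intros H.
  - specialize (H 1). unfold mult in H; simpl in H. lra.
  - destruct x as [x1 x2], y as [y1 y2].
    assert (H1 := H (1, 0)). assert (H2 := H (0, -1)). unfold mult in *; simpl in *. f_equal; lra.
Qed.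

End ScalarField.

Section Hilbert.
Variables (K : scalar_kind) (H : CompleteNormedModule (scalar K)) (ip : H -> H -> scalar K) (v : nat -> H).
Hypotheses (Hip : is_inner_product ip) (Hv : complete_orthonormal_system ip v).

Lemma ip_scal_r (a : scalar K) (x y : H) : ip x (scal a y) = mult (sconj a) (ip x y).
Proof. rewrite (ip_conj Hip (scal a y) x), (ip_scal_l Hip), sconj_mult, <- (ip_conj Hip y x). reflexivity. Qed.

Definition rip (x y : H) : R := sre (ip x y).

Definition proj (k : nat) (x : H) : H := scal (ip x (v k)) (v k).

Lemma ip_proj_l (k : nat) (x y : H) : ip (proj k x) y = mult (ip x (v k)) (ip (v k) y).
Proof. apply (ip_scal_l Hip). Qed.

Lemma ip_proj_r (k : nat) (x y : H) : ip x (proj k y) = mult (ip (v k) y) (ip x (v k)).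
Proof. unfold proj. rewrite ip_scal_r, <- (ip_conj Hip). reflexivity. Qed.

Lemma ip_zero_l (y : H) : ip zero y = zero.
Proof.
  assert (E : ip (plus zero zero) y = plus (ip zero y) (ip zero y)) by apply (ip_plus_l Hip).
  rewrite plus_zero_l in E.
  apply (plus_reg_l (G := scalar K) (ip zero y)). rewrite plus_zero_r. symmetry. exact E.
Qed.

Lemma hilbert_resolution : orthogonal_resolution (as_real H) rip proj.
Proof.
  destruct Hv as [Hv1 [Hv2 Hv3]]. split.
  - intros x y z. unfold rip. rewrite <- sre_plus. f_equal. apply (ip_plus_l Hip).
  - intros a x y. unfold rip. rewrite <- sre_sinj_mult. f_equal. apply (ip_scal_l Hip).
  - intros x y. unfold rip. rewrite (ip_conj Hip y x). apply sre_sconj.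
  - intros x. unfold rip. rewrite (ip_norm Hip). apply sre_sinj.
  - intros k x y. unfold rip. rewrite ip_proj_l, ip_proj_r. f_equal. apply scalar_mult_comm.
  - intros k x. unfold proj at 1. rewrite ip_proj_l, Hv1, mult_one_r. reflexivity.
  - intros j k x y Hjk. unfold rip. rewrite ip_proj_l, ip_proj_r, (Hv2 _ _ Hjk).
    assert (Hz : forall a : scalar K, mult a zero = zero) by (intros a; apply (mult_zero_r (K := scalar K))).
    rewrite !Hz. destruct K; reflexivity.
  - intros x Hx. apply Hv3. intros k.
    assert (E : ip (proj k x) (v k) = ip x (v k)) by (rewrite ip_proj_l, Hv1, mult_one_r; reflexivity).
    rewrite <- E. assert (E2 : proj k x = zero) by apply Hx. rewrite E2. apply ip_zero_l.
  - intros a Ha. exact (ex_series_Cauchy (V := as_real_complete K H) a Ha).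
Qed.

Variables (A : operator H) (lam : nat -> R).
Hypotheses (HA : self_adjoint ip A) (Hpos : positive_operator ip A)
  (Heig : forall k, dom A (v k) /\ A (v k) = scal (sinj K (lam k)) (v k)).

Lemma rip_op_proj (x : H) (k : nat) (z : H) : dom A x -> rip (A x) (proj k z) = lam k * rip x (proj k z).
Proof.
  intros Hx. destruct HA as [_ [_ Hadj]]. destruct (Heig k) as [Hd He].
  assert (E : ip (A x) (v k) = mult (sinj K (lam k)) (ip x (v k))).
  { transitivity (ip x (A (v k))).
    - exact (proj2 (Hadj (v k) (A (v k))) (conj Hd eq_refl) x Hx).
    - rewrite He, ip_scal_r, sconj_sinj. reflexivity. }
  unfold rip. rewrite !ip_proj_r, E, <- sre_sinj_mult. f_equal.
  rewrite !mult_assoc. f_equal. apply scalar_mult_comm.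
Qed.

(** The assumption only concerns real parts. Replacing x by a x for every scalar a recovers the full
    adjoint relation, and self-adjointness concludes. *)
Lemma op_of_rip (y z : H) : (forall x, dom A x -> rip (A x) y = rip x z) -> dom A y /\ A y = z.
Proof.
  intros Hyz. destruct HA as [Hlin [_ Hadj]]. apply Hadj. intros x Hx. apply sre_inj. intros a.
  rewrite <- !(ip_scal_l Hip), <- (op_scal Hlin) by exact Hx. apply Hyz. apply (dom_scal Hlin), Hx.
Qed.

Lemma norm_v (k : nat) : norm (v k) = 1.
Proof.
  assert (E := ip_norm Hip (v k)). rewrite (proj1 Hv), <- (sinj_one K) in E.
  apply (f_equal (@sre K)) in E. rewrite !sre_sinj in E. assert (0 <= norm (v k)) by apply norm_ge_0. nra.
Qed.

Lemma eigenvalue_pos (k : nat) : 0 < lam k.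
Proof.
  destruct (Heig k) as [Hd He].
  assert (Hn : v k <> zero).
  { intros E. assert (N := norm_v k).
    assert (N0 : norm (v k) = 0) by (rewrite E; exact (norm_zero (V := H))). lra. }
  assert (P : 0 < sre (ip (A (v k)) (v k))) by exact (Hpos (v k) Hd Hn). rewrite He, (ip_scal_l Hip), (proj1 Hv), mult_one_r, sre_sinj in P. exact P.
Qed.

(** Eigenvalues accumulating at 0 would give unit eigenvectors whose images under the inverse, v_k /
    lam_k, have norms tending to infinity, while compactness extracts a convergent subsequence. *)
Lemma eigenvalues_bounded_below : has_compact_inverse A -> exists l0, 0 < l0 /\ forall k, l0 <= lam k.
Proof.
  intros [B0 [_ [HB2' HB3]]]. destruct HA as [Hlin _].
  set (B := B0 : H -> H). assert (HB2 : forall x : H, dom A x -> B (A x) = x) by exact HB2'.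
  apply NNPP. intros Hno.
  assert (Hk : forall n : nat, exists k, lam k < / INR (S n)).
  { intros n. apply NNPP. intros Hn. apply Hno. exists (/ INR (S n)). split.
    - apply Rinv_0_lt_compat, lt_0_INR; lia.
    - intros k. apply Rnot_lt_le. intros Hlt. apply Hn. exists k; exact Hlt. }
  set (kap := fun n => proj1_sig (constructive_indefinite_description _ (Hk n))).
  assert (Hkap : forall n, lam (kap n) < / INR (S n)).
  { intros n. unfold kap. destruct (constructive_indefinite_description _ (Hk n)); assumption. }
  destruct (HB3 (fun n => v (kap n))) as [sub [l [Hsub Hl]]].
  { exists 1. intros n. rewrite norm_v. lra. }
  assert (HBv : forall k, B (v k) = scal (sinj K (/ lam k)) (v k)).
  { intros k. destruct (Heig k) as [Hd He]. assert (Hp := eigenvalue_pos k).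
    rewrite <- (HB2 (scal (sinj K (/ lam k)) (v k))) by (apply (dom_scal Hlin), Hd). f_equal.
    assert (E : A (scal (sinj K (/ lam k)) (v k)) = scal (sinj K (/ lam k)) (A (v k))) by exact (op_scal Hlin _ Hd).
    rewrite E, He, scal_assoc, <- sinj_mult, Rinv_l, sinj_one by lra.
    symmetry. apply (scal_one (V := H)). }
  assert (Hsubn : forall n, (n <= sub n)%nat).
  { induction n as [|n IH]; [lia|]. specialize (Hsub n). lia. }
  assert (Hnorm : forall n, INR n <= norm (B (v (kap (sub n))))).
  { intros n. rewrite HBv. assert (Hp := eigenvalue_pos (kap (sub n))). assert (Hlt := Hkap (sub n)).
    set (mu := lam (kap (sub n))) in *. set (w := v (kap (sub n))).
    assert (N1 : norm w = 1) by apply norm_v.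
    (* The lower bound on the norm of mu^(-1) w is read off 1 = |mu (mu^(-1) w)| <= mu |mu^(-1)
       w|. *)
    assert (N2 : norm (scal (sinj K mu) (scal (sinj K (/ mu)) w)) <= mu * norm (scal (sinj K (/ mu)) w)).
    { eapply Rle_trans; [apply (norm_scal (V := H))|].
      replace (abs (sinj K mu)) with mu by (rewrite abs_sinj, Rabs_pos_eq; lra). right; reflexivity. }
    rewrite scal_assoc, <- sinj_mult, Rinv_r, sinj_one in N2 by lra.
    assert (E1 : scal one w = w) by apply (scal_one (V := H)). rewrite E1, N1 in N2.
    assert (HS : 0 < INR (S (sub n))) by (apply lt_0_INR; lia).
    assert (HSn : INR n <= INR (S (sub n))) by (apply le_INR; specialize (Hsubn n); lia).
    set (q := norm (scal (sinj K (/ mu)) w)) in *.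
    assert (Hq : 0 < q) by (apply Rnot_le_lt; intros Hq; assert (mu * q <= 0) by nra; lra).
    apply Rle_trans with (INR (S (sub n))); [exact HSn|].
    apply Rmult_le_reg_l with (/ INR (S (sub n))); [apply Rinv_0_lt_compat, HS|].
    rewrite Rinv_l by lra. apply Rle_trans with (mu * q); [exact N2|]. apply Rmult_le_compat_r; lra. }
  assert (Hlim : filterlim (fun n => norm (B (v (kap (sub n))))) eventually (locally (norm l))).
  { apply (filterlim_comp _ _ _ _ norm _ _ _ Hl). apply filterlim_norm. }
  destruct (proj1 (filterlim_locally _ _) Hlim (mkposreal 1 Rlt_0_1)) as [N HN].
  destruct (INR_unbounded (norm l + 1)) as [n0 Hn0].
  specialize (HN (N + n0)%nat ltac:(lia)). specialize (Hnorm (N + n0)%nat).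
  rewrite plus_INR in Hnorm. assert (0 <= INR N) by apply pos_INR.
  unball. apply Rabs_def2 in HN. lra.
Qed.

End Hilbert.

(** * The nonlocal problem *)

Section Coefficients.
Variables (alpha nu T : R) (lam : nat -> R).
Hypotheses (Halpha : 1 < alpha < 2) (Hnu : 0 < nu) (HT : 0 < T) (Hlam : forall k, 0 < lam k).

Let Ha : 1 < alpha := proj1 Halpha.

Definition rate (k : nat) : R := - nu_k nu lam k ^ 2.

Notation ML mu k := (Mittag_Leffler alpha mu (rate k * rpow T alpha)).
Notation D k := (Delta_k alpha nu T lam k).

(** [coef1] and [coef2] solve a = a m_1 + b m_2 and 1 = a m_2 + b m_3 at time T, by Cramer's rule
    with m_2 = T E_2, m_3 = T^2 E_3 and determinant T^2 Delta_k. The factor phi_k enters later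
    through [diag]. *)
Definition coef1 (k : nat) : R := ML 2 k / (T * D k).
Definition coef2 (k : nat) : R := (1 - ML 1 k) / (T ^ 2 * D k).

Lemma rate_eq (k : nat) : rate k = - (nu ^ 2 * (lam k / (1 + lam k))).
Proof.
  unfold rate, nu_k. assert (H := Hlam k).
  rewrite Rpow_mult_distr, pow2_sqrt by (apply Rlt_le, Rdiv_lt_0_compat; lra). reflexivity.
Qed.

Lemma rate_neg (k : nat) : rate k < 0.
Proof.
  rewrite rate_eq. assert (H := Hlam k).
  assert (0 < nu ^ 2 * (lam k / (1 + lam k))); [|lra].
  apply Rmult_lt_0_compat; [apply pow_lt, Hnu|apply Rdiv_lt_0_compat; lra].
Qed.

Lemma rate_bound (k : nat) : - nu ^ 2 <= rate k.
Proof.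
  rewrite rate_eq. assert (H := Hlam k). assert (H2 : 0 < nu ^ 2) by apply pow_lt, Hnu.
  assert (H3 : lam k / (1 + lam k) <= 1).
  { apply Rmult_le_reg_r with (1 + lam k); [lra|]. unfold Rdiv. rewrite Rmult_assoc, Rinv_l by lra. lra. }
  nra.
Qed.

Lemma rate_le (l0 : R) (k : nat) : 0 < l0 -> l0 <= lam k -> rate k <= - (nu ^ 2 * (l0 / (1 + l0))).
Proof.
  intros H0 Hl. rewrite rate_eq. apply Ropp_le_contravar, Rmult_le_compat_l; [apply pow2_ge_0|].
  apply Rmult_le_reg_r with ((1 + lam k) * (1 + l0)); [apply Rmult_lt_0_compat; lra|].
  replace (l0 / (1 + l0) * ((1 + lam k) * (1 + l0))) with (l0 * (1 + lam k)) by (field; lra).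
  replace (lam k / (1 + lam k) * ((1 + lam k) * (1 + l0))) with (lam k * (1 + l0)) by (field; lra). nra.
Qed.

Lemma rate_relation (k : nat) : rate k * (1 + lam k) + nu ^ 2 * lam k = 0.
Proof. rewrite rate_eq. assert (H := Hlam k). field. lra. Qed.

Lemma bounded_rate : bounded_seq rate.
Proof.
  exists (nu ^ 2). intros k. apply Rabs_le. assert (H1 := rate_bound k). assert (H2 := rate_neg k).
  assert (H3 := pow2_ge_0 nu). lra.
Qed.

Definition Delta_fun (z : R) : R :=
  PSeries (ml_coef alpha 2) z ^ 2 + PSeries (ml_coef alpha 3) z * (1 - PSeries (ml_coef alpha 1) z).

Lemma Delta_fun_eq (k : nat) : D k = Delta_fun (rate k * rpow T alpha).
Proof. unfold Delta_k, Delta_fun, rate. rewrite !Mittag_Leffler_PSeries. reflexivity. Qed.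

(** Delta depends on c and T only through z = c T^alpha, so the determinant may be taken at time 1
    with c = z. *)
Lemma Delta_fun_pos (z : R) : z < 0 -> 0 < Delta_fun z.
Proof.
  intros Hz. assert (H := mlk_determinant_pos alpha Halpha z 1 Hz Rlt_0_1).
  rewrite !mlk_unfold in H.
  assert (E : forall x, Rpower 1 x = 1) by (intros x; unfold Rpower; rewrite ln_1, Rmult_0_r; apply exp_0).
  rewrite !E, !Rmult_1_l, Rmult_1_r in H. exact H.
Qed.

Lemma rpow_T_pos : 0 < rpow T alpha.
Proof. rewrite rpow_pos by exact HT. apply Rpower_pos. Qed.

Lemma Delta_pos (k : nat) : 0 < D k.
Proof.
  rewrite Delta_fun_eq. apply Delta_fun_pos.
  assert (H1 := rate_neg k). assert (H2 := rpow_T_pos). nra.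
Qed.

(** Positivity for each k does not yet bound the reciprocals. The arguments fill at most a compact
    interval of negative numbers, on which the continuous [Delta_fun] attains a positive minimum. *)
Lemma Delta_bounded_below (l0 : R) : 0 < l0 -> (forall k, l0 <= lam k) ->
  exists d, 0 < d /\ forall k, d <= D k.
Proof.
  intros H0 Hl. assert (HX := rpow_T_pos). set (X := rpow T alpha) in *.
  set (c0 := nu ^ 2 * (l0 / (1 + l0))).
  assert (Hc0 : 0 < c0) by (apply Rmult_lt_0_compat; [apply pow_lt, Hnu|apply Rdiv_lt_0_compat; lra]).
  assert (Hk : forall k, - nu ^ 2 * X <= rate k * X <= - c0 * X).
  { intros k. assert (H1 := rate_bound k). assert (H2 := rate_le l0 k H0 (Hl k)). fold c0 in H2.
    split; apply Rmult_le_compat_r; lra. }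
  destruct (continuity_ab_min Delta_fun (- nu ^ 2 * X) (- c0 * X)) as [m [Hm1 Hm2]].
  - destruct (Hk 0%nat). lra.
  - intros z _. apply continuity_pt_filterlim. unfold Delta_fun.
    assert (HC : forall mu, 0 < mu -> continuous (PSeries (ml_coef alpha mu)) z).
    { intros mu Hmu. apply continuous_entire, entire_ml; assumption. }
    apply (continuous_plus (fun z => PSeries (ml_coef alpha 2) z ^ 2)
      (fun z => PSeries (ml_coef alpha 3) z * (1 - PSeries (ml_coef alpha 1) z))).
    + apply (continuous_comp (PSeries (ml_coef alpha 2)) (fun x => x ^ 2)); [apply HC; lra|].
      apply (ex_derive_continuous (fun x => x ^ 2)). auto_derive. exact I.
    + apply (continuous_mult (PSeries (ml_coef alpha 3)) (fun z => 1 - PSeries (ml_coef alpha 1) z)); [apply HC; lra|].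
      apply (continuous_minus (fun _ => 1) (PSeries (ml_coef alpha 1))); [apply continuous_const|apply HC; lra].
  - exists (Delta_fun m). split.
    + apply Delta_fun_pos. nra.
    + intros k. rewrite Delta_fun_eq. apply Hm1, Hk.
Qed.

Lemma bounded_coef (l0 : R) : 0 < l0 -> (forall k, l0 <= lam k) -> bounded_seq coef1 /\ bounded_seq coef2.
Proof.
  intros H0 Hl. destruct (Delta_bounded_below l0 H0 Hl) as [d [Hd HD]].
  assert (HB : bounded_seq (fun k => / D k)).
  { exists (/ d). intros k. assert (H := Delta_pos k).
    rewrite Rabs_pos_eq by (apply Rlt_le, Rinv_0_lt_compat, H). apply Rinv_le_contravar; auto. }
  assert (HM : forall mu, 0 < mu -> bounded_seq (fun k => ML mu k)).
  { intros mu Hmu. destruct (bounded_entire (ml_coef alpha mu) rate (rpow T alpha) (entire_ml alpha Ha mu Hmu) bounded_rate) as [M HM].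
    exists M. intros k. rewrite Mittag_Leffler_PSeries. apply HM. }
  split.
  - destruct (bounded_mult _ _ (bounded_scal (/ T) _ (HM 2 ltac:(lra))) HB) as [M HMM].
    exists M. intros k. unfold coef1. assert (H := Delta_pos k).
    replace (ML 2 k / (T * D k)) with (/ T * ML 2 k * / D k) by (field; lra). apply HMM.
  - assert (H1 : bounded_seq (fun _ => 1)) by (exists 1; intros; rewrite Rabs_R1; lra).
    destruct (bounded_mult _ _ (bounded_scal (/ T ^ 2) _ (bounded_lin 1 (-1) _ _ H1 (HM 1 ltac:(lra)))) HB) as [M HMM].
    exists M. intros k. unfold coef2. assert (H := Delta_pos k).
    replace ((1 - ML 1 k) / (T ^ 2 * D k)) with (/ T ^ 2 * (1 * 1 + -1 * ML 1 k) * / D k) by (field; lra). apply HMM.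
Qed.

Notation sol := (fam alpha rate coef1 coef2).

Lemma ml1_ML (k : nat) (t : R) : ml1 alpha (rate k) t = Mittag_Leffler alpha 1 (rate k * rpow t alpha).
Proof. rewrite Mittag_Leffler_PSeries. reflexivity. Qed.

Lemma ml2_ML (k : nat) (t : R) : ml2 alpha (rate k) t = t * Mittag_Leffler alpha 2 (rate k * rpow t alpha).
Proof. rewrite Mittag_Leffler_PSeries. reflexivity. Qed.

Lemma sol_periodic (k : nat) : sol 0 k = sol T k.
Proof.
  unfold fam. rewrite (ml1_0 alpha), ml2_0, ml1_ML, ml2_ML. unfold coef1, coef2.
  assert (H := Delta_pos k). field. lra.
Qed.

Lemma sol_mean (k : nat) : is_RInt (fun t => sol t k) 0 T 1.
Proof.
  assert (H1 := is_RInt_ml1 alpha (rate k) T Halpha HT).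
  assert (H2 := is_RInt_ml2 alpha (rate k) T Halpha HT).
  assert (H := is_RInt_plus _ _ _ _ _ _ (is_RInt_scal _ _ _ (coef1 k) _ H1) (is_RInt_scal _ _ _ (coef2 k) _ H2)).
  replace 1 with (plus (scal (coef1 k) (mlk alpha 2 (rate k) T)) (scal (coef2 k) (mlk alpha 3 (rate k) T))).
  - exact H.
  - Rsimp. rewrite !mlk_unfold, <- !Mittag_Leffler_PSeries.
    replace (2 - 1) with 1 by ring. replace (3 - 1) with (1 + 1) by ring.
    rewrite Rpower_plus, Rpower_1, <- rpow_pos by exact HT. unfold coef1, coef2.
    assert (HD := Delta_pos k).
    assert (E : D k = ML 2 k ^ 2 + ML 3 k * (1 - ML 1 k)) by reflexivity.
    transitivity ((ML 2 k ^ 2 + ML 3 k * (1 - ML 1 k)) / D k); [field; lra|]. rewrite <- E. field. lra.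
Qed.

End Coefficients.

(** * Uniqueness and existence in the Hilbert space *)

Section Problem.
Variables (K : scalar_kind) (H : CompleteNormedModule (scalar K)) (ip : H -> H -> scalar K) (v : nat -> H)
  (A : operator H) (lam : nat -> R) (alpha nu T : R) (phi : H).
Hypotheses (Hip : is_inner_product ip) (Hv : complete_orthonormal_system ip v) (HA : self_adjoint ip A)
  (Heig : forall k, dom A (v k) /\ A (v k) = scal (sinj K (lam k)) (v k))
  (Hlam : forall k, 0 < lam k) (Halpha : 1 < alpha < 2) (Hnu : 0 < nu) (HT : 0 < T).

Notation E := (as_real_complete K H).
Notation rp := (rip K H ip).
Notation pr := (proj K H ip v).
Notation c := (rate nu lam).

Let HE : orthogonal_resolution (as_real H) rp pr := hilbert_resolution K H ip v Hip Hv.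

(** For each t, [is_Caputo] comes with its own pair of derivatives on (0, t). The scalar uniqueness
    theorem wants one pair on (0, T); [Derive] provides it, since it agrees with all the local
    ones. *)
Lemma solution_coordinates (w : R -> as_real H) (k : nat) (z : H) : is_solution A alpha nu T phi w ->
  exists f f2 : R -> R,
    (forall s, 0 < s < T -> is_derive (fun s => rp (w s) (pr k z)) s (f s)) /\
    (forall s, 0 < s < T -> is_derive f s (f2 s)) /\
    (forall t, 0 < t < T -> is_RInt_gen (fun s => Rpower (t - s) (- (alpha - 1)) * f2 s) (at_right 0) (at_left t)
       (c k * Gamma (2 - alpha) * rp (w t) (pr k z))).
Proof.
  intros [_ [Du [HDu [Hdom [_ [_ [_ Heq]]]]]] _ _].
  set (p := pr k z). set (W := fun s => rp (w s) p).
  set (f := fun s => Derive W s).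
  assert (Hloc : forall t s (P : R -> Prop), 0 < s < t -> (forall y, 0 < y < t -> P y) -> locally s P).
  { intros t s P Hs HP. assert (Hd : 0 < Rmin s (t - s)) by (apply Rmin_pos; lra).
    exists (mkposreal _ Hd). intros y Hy. apply HP. unball. apply Rabs_def2 in Hy.
    assert (M1 := Rmin_l s (t - s)). assert (M2 := Rmin_r s (t - s)). lra. }
  assert (HG : 0 < Gamma (2 - alpha)) by (apply Gamma_pos; lra).
  assert (Key : forall t, 0 < t < T -> exists h1 h2 : R -> R,
    (forall s, 0 < s < t -> is_derive W s (h1 s)) /\ (forall s, 0 < s < t -> is_derive h1 s (h2 s)) /\
    is_RInt_gen (fun s => Rpower (t - s) (- (alpha - 1)) * h2 s) (at_right 0) (at_left t) (c k * Gamma (2 - alpha) * W t)).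
  { intros t Ht. destruct (HDu t Ht) as [h1 [h2 [I [H1 [H2 [HI HD]]]]]].
    exists (fun s => rp (h1 s) p), (fun s => rp (h2 s) p). split; [|split].
    - intros s Hs. apply (is_derive_rip HE), H1, Hs.
    - intros s Hs. apply (is_derive_rip HE), H2, Hs.
    - assert (HI' := is_RInt_gen_rip HE _ _ _ I p _ _ HI).
      replace (c k * Gamma (2 - alpha) * W t) with (rp I p).
      + refine (is_RInt_gen_ext_interval _ _ _ _ (proj1 Ht) _ HI').
        intros s Hs. rewrite (rip_scal_l HE), Rpower_Ropp. reflexivity.
      + assert (HDp : rp (Du t) p = / Gamma (2 - alpha) * rp I p).
        { rewrite HD. apply (rip_scal_l HE). }
        destruct (Hdom t Ht) as [Hd1 Hd2].
        assert (Q := f_equal (fun x => rp x p) (Heq t Ht)). cbv beta in Q.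
        rewrite (rip_zero_l HE), !(rip_plus_l HE), (rip_scal_l HE) in Q.
        assert (Q1 : rp (A (w t)) p = lam k * rp (w t) p) by (apply (rip_op_proj K H ip v Hip A lam HA Heig), Hd1).
        assert (Q2 : rp (A (Du t)) p = lam k * rp (Du t) p) by (apply (rip_op_proj K H ip v Hip A lam HA Heig), Hd2).
        assert (Hrel := rate_relation nu lam Hlam k). assert (Hl := Hlam k).
        (* In coordinate k the equation becomes (1 + lam_k) D^alpha W = - nu^2 lam_k W, and dividing
           by 1 + lam_k produces the rate. *)
        assert (Q3 : rp (Du t) p * (1 + lam k) = - nu ^ 2 * lam k * rp (w t) p).
        { transitivity (rp (Du t) p + lam k * rp (Du t) p); [ring|]. rewrite <- Q2.
          transitivity (- (nu ^ 2 * rp (A (w t)) p)); [|rewrite Q1; ring].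
          assert (Q' : rp (Du t) p + rp (A (Du t)) p + nu ^ 2 * rp (A (w t)) p = 0) by exact Q. lra. }
        assert (Q4 : rp (Du t) p = c k * W t).
        { apply Rmult_eq_reg_r with (1 + lam k); [|lra]. rewrite Q3. change (rp (w t) p) with (W t).
          replace (c k * W t * (1 + lam k)) with (c k * (1 + lam k) * W t) by ring.
          replace (c k * (1 + lam k)) with (- nu ^ 2 * lam k) by lra. reflexivity. }
        transitivity (Gamma (2 - alpha) * rp (Du t) p); [rewrite HDp; field; lra|rewrite Q4; ring]. }
  assert (Hf : forall s, 0 < s < T -> is_derive W s (f s)).
  (* The data at time t describe W on (0, t) only, so a time strictly between s and T is taken. *)
  { intros s Hs. destruct (Key ((s + T) / 2) ltac:(lra)) as [h1 [_ [H1 _]]].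
    apply Derive_correct. exists (h1 s). apply H1; lra. }
  assert (Hff : forall t (h1 h2 : R -> R), 0 < t < T -> (forall s, 0 < s < t -> is_derive W s (h1 s)) ->
     (forall s, 0 < s < t -> is_derive h1 s (h2 s)) -> forall s, 0 < s < t -> is_derive f s (h2 s)).
  { intros t h1 h2 Ht H1 H2 s Hs. apply (is_derive_ext_loc h1); [|apply H2, Hs].
    apply (Hloc t); [exact Hs|]. intros y Hy. symmetry. apply is_derive_unique, H1, Hy. }
  exists f, (Derive f). split; [exact Hf|]. split.
  - intros s Hs. destruct (Key ((s + T) / 2) ltac:(lra)) as [h1 [h2 [H1 [H2 _]]]].
    apply Derive_correct. exists (h2 s). apply (Hff ((s + T) / 2) h1 h2); auto; lra.
  - intros t Ht. destruct (Key t Ht) as [h1 [h2 [H1 [H2 H3]]]].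
    refine (is_RInt_gen_ext_interval _ _ _ _ (proj1 Ht) _ H3).
    intros s Hs. f_equal. symmetry. apply is_derive_unique, (Hff t h1 h2 Ht H1 H2 s Hs).
Qed.

Lemma solution_unique (u w : R -> as_real H) : is_solution A alpha nu T phi u -> is_solution A alpha nu T phi w ->
  forall t, 0 <= t <= T -> w t = u t.
Proof.
  intros Hu Hw t Ht. apply (rip_ext HE). intros k z.
  destruct (solution_coordinates u k z Hu) as [fu [fu2 [U1 [U2 U3]]]].
  destruct (solution_coordinates w k z Hw) as [fw [fw2 [W1 [W2 W3]]]].
  set (p := pr k z) in *.
  assert (Hz : rp (w t) p - rp (u t) p = 0).
  { apply (scalar_nonlocal_unique alpha (c k) T Halpha (rate_neg nu lam Hnu Hlam k) HT
      (fun s => rp (w s) p - rp (u s) p) (fun s => fw s - fu s) (fun s => fw2 s - fu2 s)); [| | | | | |exact Ht].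
    - intros s Hs.
      assert (L : forall x : as_real H, filterlim (fun y : as_real H => rp y p) (locally x) (locally (rp x p))).
      { intros x. exact (linear_cont (U := as_real H) (V := R_NormedModule) _ x (is_linear_rip HE p)). }
      assert (Cw := filterlim_comp _ _ _ _ (fun y : as_real H => rp y p) _ _ _ (sol_continuous Hw Hs) (L (w s))).
      assert (Cu := filterlim_comp _ _ _ _ (fun y : as_real H => rp y p) _ _ _ (sol_continuous Hu Hs) (L (u s))).
      exact (filterlim_Rminus _ _ _ _ _ Cw Cu).
    - intros s Hs. apply (is_derive_minus (fun s => rp (w s) p) (fun s => rp (u s) p)); [apply W1, Hs|apply U1, Hs].
    - intros s Hs. apply (is_derive_minus fw fu); [apply W2, Hs|apply U2, Hs].
    - intros s Hs. assert (G := is_RInt_gen_minus _ _ _ _ (W3 s Hs) (U3 s Hs)).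
      rewrite Rmult_minus_distr_l.
      refine (is_RInt_gen_ext_interval _ _ _ _ (proj1 Hs) _ G).
      intros y Hy. Rsimp. ring.
    - rewrite (sol_nonlocal Hw), (sol_nonlocal Hu). reflexivity.
    - assert (Iw := is_RInt_rip HE _ _ _ _ p (sol_integral Hw)).
      assert (Iu := is_RInt_rip HE _ _ _ _ p (sol_integral Hu)).
      assert (G := is_RInt_minus _ _ _ _ _ _ Iw Iu). rewrite (minus_eq_zero (G := R_AbelianGroup)) in G. exact G. }
  fold p. lra.
Qed.

Variable l0 : R.
Hypotheses (Hl0 : 0 < l0) (Hl0_le : forall k, l0 <= lam k).

Notation a := (coef1 alpha nu T lam).
Notation b := (coef2 alpha nu T lam).

Let Hc : bounded_seq c := bounded_rate nu lam Hnu Hlam.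
Let Hba : bounded_seq a := proj1 (bounded_coef alpha nu T lam Halpha Hnu HT Hlam l0 Hl0 Hl0_le).
Let Hbb : bounded_seq b := proj2 (bounded_coef alpha nu T lam Halpha Hnu HT Hlam l0 Hl0 Hl0_le).

Definition series_solution (x : H) (t : R) : as_real H := diag (V := as_real H) pr (fam alpha c a b t) x.
Definition series_caputo (x : H) (t : R) : as_real H := diag (V := as_real H) pr (fun k => c k * fam alpha c a b t k) x.

(** [A] commutes with bounded diagonal operators: the coordinates match, and [graph_by_coordinates]
    turns this into membership in the domain. *)
Lemma op_diag (g : nat -> R) (x : H) : bounded_seq g -> dom A x ->
  dom A (diag (V := as_real H) pr g x) /\ A (diag (V := as_real H) pr g x) = diag (V := as_real H) pr g (A x).
Proof.
  intros Hg Hx. apply (graph_by_coordinates HE (dom A) A lam).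
  - intros y k z Hy. apply (rip_op_proj K H ip v Hip A lam HA Heig), Hy.
  - intros y z Hyz. apply (op_of_rip K H ip Hip A HA y z Hyz).
  - intros k z. rewrite !(rip_diag HE) by exact Hg.
    assert (Q : rp (A x) (pr k z) = lam k * rp x (pr k z)) by (apply (rip_op_proj K H ip v Hip A lam HA Heig), Hx).
    rewrite Q. ring.
Qed.

(** Because phi lies in the domain, A u and A D^alpha u are the same two series with A phi in place
    of phi, and their continuity is an instance of the general one. The equation then holds
    coordinatewise by [rate_relation]. *)
Lemma series_solution_correct : dom A phi -> is_solution A alpha nu T phi (series_solution phi).
Proof.
  intros Hphi.
  assert (HbF : forall t, bounded_seq (fam alpha c a b t)) by (intros t; apply bounded_fam; assumption).
  assert (HbcF : forall t, bounded_seq (fun k => c k * fam alpha c a b t k)) by (intros t; apply bounded_c_fam; assumption).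
  assert (HC : forall x t, continuous (series_solution x) t).
  { intros x t. apply (continuous_diag_fam alpha Halpha c a b Hc Hba Hbb E HE). }
  assert (HCc : forall x t, continuous (series_caputo x) t).
  { intros x t. apply (continuous_diag_c_fam alpha Halpha c a b Hc Hba Hbb E HE). }
  assert (HAu : forall t, dom A (series_solution phi t) /\ A (series_solution phi t) = series_solution (A phi) t).
  { intros t. apply op_diag; [apply HbF|exact Hphi]. }
  assert (HAD : forall t, dom A (series_caputo phi t) /\ A (series_caputo phi t) = series_caputo (A phi) t).
  { intros t. apply op_diag; [apply HbcF|exact Hphi]. }
  split.
  - intros t _. apply continuous_within, HC.
  - exists (series_caputo phi). split; [|split; [|split; [|split; [|split]]]].
    + intros t Ht.
      exists (fun s => diag (V := as_real H) pr (dfam alpha c a b s) phi), (fun s => diag (V := as_real H) pr (ddfam alpha c a b s) phi),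
        (scal (Gamma (2 - alpha)) (series_caputo phi t)).
      split; [|split; [|split]].
      * intros s Hs. apply (is_derive_diag_fam alpha Halpha c a b Hc Hba Hbb E HE phi s (proj1 Hs)).
      * intros s Hs. apply (is_derive_diag_dfam alpha Halpha c a b Hc Hba Hbb E HE phi s (proj1 Hs)).
      * apply (caputo_diag_fam alpha Halpha c a b Hc Hba Hbb E HE phi t (proj1 Ht)).
      * assert (HG : 0 < Gamma (2 - alpha)) by (apply Gamma_pos; lra).
        apply (rip_ext HE). intros k z.
        rewrite !(rip_scal_l HE). field. lra.
    + intros t _. split; [apply HAu|apply HAD].
    + intros t _. apply HCc.
    + intros t _. apply (continuous_ext (series_solution (A phi))); [intros s; symmetry; apply HAu|apply HC].
    + intros t _. apply (continuous_ext (series_caputo (A phi))); [intros s; symmetry; apply HAD|apply HCc].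
    + intros t _. apply (rip_ext HE). intros k z.
      rewrite (rip_zero_l HE), !(rip_plus_l HE), (rip_scal_l HE).
      assert (Q : rp (A phi) (pr k z) = lam k * rp phi (pr k z)) by (apply (rip_op_proj K H ip v Hip A lam HA Heig), Hphi).
      assert (Q1 : rp (A (series_solution phi t)) (pr k z) = fam alpha c a b t k * (lam k * rp phi (pr k z))).
      { rewrite (proj2 (HAu t)), <- Q. apply (rip_diag HE), HbF. }
      assert (Q2 : rp (A (series_caputo phi t)) (pr k z) = c k * fam alpha c a b t k * (lam k * rp phi (pr k z))).
      { rewrite (proj2 (HAD t)), <- Q. apply (rip_diag HE), HbcF. }
      assert (Q3 : rp (series_caputo phi t) (pr k z) = c k * fam alpha c a b t k * rp phi (pr k z)).
      { apply (rip_diag HE), HbcF. }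
      transitivity (c k * fam alpha c a b t k * rp phi (pr k z) + c k * fam alpha c a b t k * (lam k * rp phi (pr k z))
         + nu ^ 2 * (fam alpha c a b t k * (lam k * rp phi (pr k z)))).
      { rewrite <- Q1, <- Q2, <- Q3. reflexivity. }
      assert (Hrel := rate_relation nu lam Hlam k).
      transitivity ((c k * (1 + lam k) + nu ^ 2 * lam k) * (fam alpha c a b t k * rp phi (pr k z))); [ring|].
      rewrite Hrel. ring.
  - apply (rip_ext HE). intros k z. unfold series_solution.
    rewrite !(rip_diag HE) by apply HbF.
    rewrite (sol_periodic alpha nu T lam Halpha Hnu HT Hlam). reflexivity.
  - apply (is_RInt_diag_fam alpha Halpha c a b Hc Hba Hbb E HE phi T HT).
    intros k. apply (sol_mean alpha nu T lam Halpha Hnu HT Hlam).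
Qed.

Lemma is_series_series_solution (t : R) :
  is_series (solution_term ip v lam alpha nu T phi t) (series_solution phi t).
Proof.
  assert (HbF : bounded_seq (fam alpha c a b t)) by (apply bounded_fam; assumption).
  apply (is_series_ext (V := H) (fun k => scal (sinj K (fam alpha c a b t k)) (pr k phi))).
  - intros k. unfold solution_term, proj. rewrite scal_assoc. f_equal.
    assert (G : forall (x : scalar K) (y z : R), mult (sinj K (y + z)) x = plus (mult x (sinj K y)) (mult x (sinj K z))).
    { intros x y z. rewrite scalar_mult_comm, sinj_plus. apply (mult_distr_l (K := scalar K)). }
    rewrite <- G. f_equal. f_equal.
    unfold fam. rewrite ml1_ML, ml2_ML. unfold coef1, coef2, rate, Rdiv. ring.
  - exact (is_series_diag HE (fam alpha c a b t) phi HbF).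
Qed.

End Problem.

Theorem theorem1p2 (K : scalar_kind) (H : CompleteNormedModule (scalar K))
  (ip : H -> H -> scalar K) (A : operator H) (v : nat -> H) (lam : nat -> R)
  (alpha nu T : R) (phi : H) :
  is_inner_product ip ->
  separable H ->
  self_adjoint ip A ->
  positive_operator ip A ->
  unbounded_operator A ->
  has_compact_inverse A ->
  complete_orthonormal_system ip v ->
  (forall k, dom A (v k) /\ A (v k) = scal (sinj K (lam k)) (v k)) ->
  1 < alpha < 2 ->
  0 < nu ->
  0 < T ->
  dom A phi ->
  (forall k, Delta_k alpha nu T lam k <> 0) /\
  exists u : R -> H,
    is_solution A alpha nu T phi u /\
    (forall w : R -> H, is_solution A alpha nu T phi w ->
       forall t, 0 <= t <= T -> w t = u t) /\
    (forall t, 0 <= t <= T ->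
       is_series (solution_term ip v lam alpha nu T phi t) (u t)).
Proof.
  intros Hip _ HA Hpos _ Hinv Hv Heig Halpha Hnu HT Hphi.
  assert (Hlam := eigenvalue_pos K H ip v Hip Hv A lam Hpos Heig).
  destruct (eigenvalues_bounded_below K H ip v Hip Hv A lam HA Hpos Heig Hinv) as [l0 [Hl0 Hl]].
  (* Division of reals is total, so Delta_k <> 0 is what makes the quotients in the series
     genuine. *)
  split.
  - intros k. apply Rgt_not_eq, Delta_pos; assumption.
  - assert (Hsol := series_solution_correct K H ip v A lam alpha nu T phi Hip Hv HA Heig Hlam Halpha Hnu HT l0 Hl0 Hl Hphi).
    exists (series_solution K H ip v lam alpha nu T phi). split; [exact Hsol|]. split.
    + intros w Hw. apply (solution_unique K H ip v A lam alpha nu T phi Hip Hv HA Heig Hlam Halpha Hnu HT); assumption.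
    + intros t _. apply (is_series_series_solution K H ip v lam alpha nu T phi Hip Hv Hlam Halpha Hnu HT l0 Hl0 Hl).
Qed.
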